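(* Let $K$ be an oriented, non-split link with alternating diagram $D\subset\mathbb{R}^2$, and let $G$ be its Tait digraph. Fix a root vertex $r$ of $G$ and a basepoint $q$ in a face of $G$ adjacent to $r$, and let $\mathcal{T}$ be the set of spanning trees of $G$. Then, with $\iota_+,\overline{\iota}_+,\varepsilon_-,\overline{\varepsilon}_-$ as in the context, the symmetrized Alexander polynomial $\Delta_K$ of $K$ is given by $$\Delta_K(t)=\sum_{T\in\mathcal{T}}(t^{1/2})^{\iota_+(T)-\varepsilon_-(T)}(-t^{1/2})^{\overline{\varepsilon}_-(T)-\overline{\iota}_+(T)}$$ (equality up to sign), and $$\Delta_K(t)=(-t)^{-\sigma(K)/2}\sum_{T\in\mathcal{T}}(-t)^{\varepsilon_-(T)-\iota_+(T)},\qquad \Delta_K(t)=(-t)^{-\sigma(K)/2}\sum_{T\in\mathcal{T}}(-t)^{\overline{\varepsilon}_-(T)-\overline{\iota}_+(T)}$$ (equalities up to multiplication by a constant in $\{\pm1,\pm i\}$, with $(-t)^{1/2}=i\,t^{1/2}$), where $\sigma(K)$ is the signature of $K$.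
   Context: Alexander polynomial and signature. For a Seifert matrix $V$ of $K$, $\Delta_K(t)=\det(t^{1/2}V-t^{-1/2}V^{\top})\in\mathbb{Z}[t^{1/2},t^{-1/2}]$, regarded as defined only up to sign, and $\sigma(K)$ is the signature of $V+V^{\top}$, with the convention that the trefoil with positive crossings has signature $-2$. All links are oriented and non-split. A link is alternating if it has a diagram in which each component alternates between over- and undercrossings (an alternating diagram). Crossing signs: rotate the picture so both strands point upward; the crossing is positive if the overstrand runs from lower left to upper right, negative if it runs from lower right to upper left. Tait digraph. Let $D\subset\mathbb{R}^2$ be an alternating diagram of a non-split link. Regions of $D$ are the components of the complement of the underlying 4-valent plane graph. Choose the checkerboard shading of the regions such that at every crossing, when the picture is rotated so that the overstrand runs from lower left to upper right, the top and bottom regions are the shaded ones. The Tait digraph $G=(V,E)$ is the plane digraph with one vertex in each shaded region and one edge through each crossing, joining the vertices of the two shaded regions at that crossing (loops and multiple edges allowed), directed to match the overcrossing: rotating so that the overstrand is directed from lower left to upper right, the edge points from the bottom region to the top region. An edge is positive or negative according to the sign of its crossing; $E=E_+\sqcup E_-$. A face of $G$ is adjacent to $r$ if its boundary contains $r$. Activities. Fix a root vertex $r\in V$ and a basepoint $q\in\mathbb{R}^2\setminus G$. Let $T$ be a spanning tree of $G$ (viewed as a set of edges). An edge $e\in T$ is internally semi-active if it points away from the component of $T\setminus\{e\}$ containing $r$, and internally semi-passive otherwise. For $e\in E\setminus T$, let $\mathrm{Cyc}_T(e)$ be the unique cycle in $T\cup\{e\}$, oriented counter-clockwise around $q$ in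 $\mathbb{R}^2\cup\{\infty\}$ (so that the side containing $q$ lies on its left); $e$ is externally semi-active if its direction agrees with this orientation, and externally semi-passive otherwise. Let $\iota_+(T)$, $\overline{\iota}_+(T)$ be the numbers of internally semi-active, respectively semi-passive, edges in $T\cap E_+$, and $\varepsilon_-(T)$, $\overline{\varepsilon}_-(T)$ the numbers of externally semi-active, respectively semi-passive, edges in $E_-\setminus T$. *)

(* Defs.v *)
From HB Require Import structures.
From mathcomp Require Import all_boot all_order all_fingroup all_algebra all_field.

Set Implicit Arguments.
Unset Strict Implicit.
Unset Printing Implicit Defensive.

Import GRing.Theory Num.Theory.
Local Open Scope ring_scope.

(* A digraph drawn on the oriented sphere, with signed edges.  [eleft e] and
   [eright e] are the faces to the left and to the right of [e] for an observer
   moving along [e] from [etail e] to [ehead e]. *)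
Record plane_digraph := PlaneDigraph {
  vertex : finType;
  edge : finType;
  face : finType;
  etail : edge -> vertex;
  ehead : edge -> vertex;
  eleft : edge -> face;
  eright : edge -> face;
  epositive : edge -> bool }.

Section Activities.
Variable G : plane_digraph.
Implicit Types (A C T : {set edge G}) (e : edge G).
Implicit Types (u v r : vertex G) (f g q : face G).

Definition endpoint e v := (v == etail e) || (v == ehead e).

(* The boundary of [f] contains [v].  The last disjunct is for a vertex without
   edges: in a connected graph the only face surrounds it. *)
Definition adjacent f v :=
  [exists e, endpoint e v && ((f == eleft e) || (f == eright e))]
  || [forall e, ~~ endpoint e v].

Definition joined A : rel (vertex G) := fun u v =>
  [exists e in A, ((etail e == u) && (ehead e == v))
               || ((etail e == v) && (ehead e == u))].

(* A loop counts twice. *)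
Definition degree A v : nat :=
  (#|[set e in A | etail e == v]| + #|[set e in A | ehead e == v]|)%N.

(* Simple closed paths: connected nonempty 2-regular edge sets. *)
Definition is_cycle C :=
  [&& C != set0,
      [forall v, (degree C v == 0%N) || (degree C v == 2)]
    & [forall e1 in C, forall e2 in C,
        connect (joined C) (etail e1) (etail e2)]].

Definition spanning_tree T :=
  [forall u, forall v, connect (joined T) u v]
  && [forall C : {set edge G}, is_cycle C ==> ~~ (C \subset T)].

Definition int_active r T e := connect (joined (T :\ e)) r (etail e).

(* The unique cycle in [e |: T]. *)
Definition Cyc T e : {set edge G} :=
  odflt set0 [pick C | is_cycle C && (C \subset e |: T)].

(* The connected components of the complement of a cycle [C] in the sphere are
   the classes of faces under [connect (sharing_side C)]. *)
Definition sharing_side C : rel (face G) := fun f g =>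
  [exists e in ~: C, ((eleft e == f) && (eright e == g))
                  || ((eleft e == g) && (eright e == f))].

(* [Cyc T e] oriented with [q] on its left agrees with the direction of [e]
   exactly when the side of [Cyc T e] to the left of [e] contains [q]. *)
Definition ext_active q T e := connect (sharing_side (Cyc T e)) (eleft e) q.

Definition iota_pos r T : nat :=
  #|[set e in T | epositive e && int_active r T e]|.
Definition iota_pos_bar r T : nat :=
  #|[set e in T | epositive e && ~~ int_active r T e]|.
Definition eps_neg q T : nat :=
  #|[set e in ~: T | ~~ epositive e && ext_active q T e]|.
Definition eps_neg_bar q T : nat :=
  #|[set e in ~: T | ~~ epositive e && ~~ ext_active q T e]|.

End Activities.

(* An oriented diagram on the oriented sphere in which every component meets a
   crossing.  The boolean in [crossing * bool] selects a strand of the crossing,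
   [true] for the overstrand; [next (x, s) = (y, s')] means that the arc leaving
   [x] along strand [s] next arrives at [y] along strand [s']. *)
Record crossing_diagram := CrossingDiagram {
  crossing : finType;
  positive : crossing -> bool;
  next : {perm (crossing * bool)} }.

Section Diagram.
Variable D : crossing_diagram.

(* The arcs of the underlying 4-valent graph; [(x, s)] is the arc leaving [x]
   along strand [s]. *)
Definition arc : Type := (crossing D * bool)%type.

Definition arc_in (x : crossing D) (s : bool) : arc := (next D)^-1%g (x, s).
Definition arc_out (x : crossing D) (s : bool) : arc := (x, s).

(* Arc ends [(x, s, o)]: at crossing [x], on strand [s], on the outgoing arc if
   [o] and on the incoming arc otherwise. *)
Definition dart := (crossing D * bool * bool)%type.

Definition opposite (d : dart) : dart :=
  let: (x, s, o) := d in
  if o then (next D (x, s), false) else (arc_in x s, true).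

(* The next dart counterclockwise around the crossing.  At a positive crossing
   the counterclockwise order is over-out, under-out, over-in, under-in; at a
   negative one it is over-out, under-in, over-in, under-out. *)
Definition rotate (d : dart) : dart :=
  let: (x, s, o) := d in (x, ~~ s, o (+) (s (+) positive x)).

(* A dart [d] stands for the corner between [d] and [rotate d]; [next_corner]
   walks along the boundary of the region containing that corner. *)
Definition next_corner (d : dart) : dart := opposite (rotate d).

Definition region (d : dart) : {set dart} :=
  [set d' | fconnect next_corner d d'].

Definition adjacent_crossings : rel (crossing D) := fun x y =>
  [exists s, ((next D (x, s)).1 == y) || ((next D (y, s)).1 == x)].

Definition crossings_connected :=
  [forall x, forall y, connect adjacent_crossings x y].

(* Euler's formula, the graph having twice as many edges as crossings. *)
Definition euler_sphere :=
  #|[set region d | d : dart]| == #|crossing D|.+2.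

Definition strands_alternate := [forall a, (next D a).2 == ~~ a.2].

(* With the overstrand running from lower left to upper right, the top and
   bottom corners are the ones just counterclockwise of its two ends. *)
Definition shaded_at (c : crossing D * bool) : {set dart} :=
  region (c.1, true, c.2).
Definition unshaded_at (c : crossing D * bool) : {set dart} :=
  region (rotate (c.1, true, c.2)).

Definition shaded_region := {A : {set dart} | A \in [set shaded_at c | c : _]}.
Definition unshaded_region :=
  {A : {set dart} | A \in [set unshaded_at c | c : _]}.

Definition shaded_corner (x : crossing D) (o : bool) : shaded_region :=
  exist _ (shaded_at (x, o)) (imset_f _ isT).
Definition unshaded_corner (x : crossing D) (o : bool) : unshaded_region :=
  exist _ (unshaded_at (x, o)) (imset_f _ isT).

(* With the overstrand directed from lower left to upper right, the corners
   just counterclockwise of over-in, over-out, [rotate over-out] and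
   [rotate over-in] are the bottom, top, left and right ones. *)
Definition tait_of_crossings : plane_digraph :=
  @PlaneDigraph shaded_region (crossing D) unshaded_region
    (fun x => shaded_corner x false) (fun x => shaded_corner x true)
    (fun x => unshaded_corner x true) (fun x => unshaded_corner x false)
    (@positive D).

(* Draw a crossing with both strands pointing up.  Smoothing it leaves a left
   arc and a right arc of Seifert circles, both pointing up; the left one comes
   in on the strand from the lower left (the overstrand if and only if the
   crossing is positive) and leaves on the strand to the upper left. *)
Definition left_in x := arc_in x (positive x).
Definition left_out x := arc_out x (~~ positive x).
Definition right_in x := arc_in x (~~ positive x).
Definition right_out x := arc_out x (positive x).

(* Each Seifert circle spans a disk, all disks lying above the sphere of the
   diagram, and each crossing gives a half-twisted band.  An integer flow on the
   arcs obeying Kirchhoff's law at the crossings is a 1-cycle on the surface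
   running along the boundaries of the disks; at [x] it crosses the band from
   left to right [band f x] times. *)
Definition is_flow (f : arc -> int) :=
  forall x, f (left_in x) + f (right_in x) = f (left_out x) + f (right_out x).

Definition band (f : arc -> int) (x : crossing D) : int :=
  f (left_in x) - f (left_out x).

(* The surface retracts onto its Seifert graph (disks as vertices, bands as
   edges), so flows have the same homology class if and only if they cross every
   band equally often. *)
Definition homology_basis n (b : 'I_n -> arc -> int) : Prop :=
  (forall i, is_flow (b i)) /\
  (forall f, is_flow f -> exists! z : 'rV[int]_n,
     forall x, band f x = \sum_i z 0 i * band (b i) x).

(* The linking number of [f] with the push-off [g^+] of [g] to the positive side
   of the surface, which next to a Seifert circle is its right-hand side.  It
   is a signed count of the places where [g^+] runs over [f]: they occur where
   [f] passes into a band from the disk on its left while [g^+] runs along that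
   disk, and each has sign -1.  The half twist makes [g^+] turn into the band
   after [f] at a positive crossing and before [f] at a negative one, so [f]
   passes under all of the incoming, respectively outgoing, flow of [g^+]. *)
Definition seifert_form (f g : arc -> int) : int :=
  - \sum_x band f x * g (if positive x then left_in x else left_out x).

Definition seifert_mx n (b : 'I_n -> arc -> int) : 'M[int]_n :=
  \matrix_(i, j) seifert_form (b i) (b j).

End Diagram.

(* [RoundCircle] is the crossingless diagram of the unknot, the only connected
   diagram with a component that meets no crossing. *)
Variant link_diagram := RoundCircle | Crossings of crossing_diagram.

Definition planar (D : link_diagram) :=
  if D is Crossings D' then euler_sphere D' else true.

Definition connected_diagram (D : link_diagram) :=
  if D is Crossings D' then crossings_connected D' else true.

Definition alternating (D : link_diagram) :=
  if D is Crossings D' then strands_alternate D' else true.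

(* Whichever side of the circle is shaded, the graph is a single vertex. *)
Definition tait_of_circle : plane_digraph :=
  @PlaneDigraph unit void unit (of_void _) (of_void _) (of_void _) (of_void _)
    (of_void _).

Definition tait_digraph (D : link_diagram) : plane_digraph :=
  if D is Crossings D' then tait_of_crossings D' else tait_of_circle.

Definition row_enlargement n (V : 'M[int]_n) (u : 'rV[int]_n) :
    'M[int]_(n + (1 + 1)) :=
  block_mx V 0 (col_mx u 0) (block_mx 0 0 1%:M 0).

Definition col_enlargement n (V : 'M[int]_n) (u : 'cV[int]_n) :
    'M[int]_(n + (1 + 1)) :=
  block_mx V (row_mx u 0) 0 (block_mx 0 1%:M 0 0).

Inductive s_equivalent m (V : 'M[int]_m) : forall n, 'M[int]_n -> Prop :=
| SRefl : s_equivalent V V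
| SCongruence n (W P : 'M[int]_n) of P \in unitmx & s_equivalent V W :
    s_equivalent V (P *m W *m P^T)
| SRowEnlarge n (W : 'M[int]_n) u of s_equivalent V W :
    s_equivalent V (row_enlargement W u)
| SColEnlarge n (W : 'M[int]_n) u of s_equivalent V W :
    s_equivalent V (col_enlargement W u)
| SRowReduce n (W : 'M[int]_n) u of s_equivalent V (row_enlargement W u) :
    s_equivalent V W
| SColReduce n (W : 'M[int]_n) u of s_equivalent V (col_enlargement W u) :
    s_equivalent V W.

(* All Seifert matrices of a link, coming from any connected Seifert surface and
   any basis of its homology, are S-equivalent; so those of the link with
   diagram [D] are S-equivalent to the ones given by Seifert's algorithm on
   [D]. *)
Definition seifert_matrix (D : link_diagram) n (V : 'M[int]_n) : Prop :=
  match D with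
  | RoundCircle => s_equivalent (0 : 'M[int]_0) V
  | Crossings D' => exists m (b : 'I_m -> arc D' -> int),
      homology_basis b /\ s_equivalent (seifert_mx b) V
  end.

(* Laurent polynomials in t^(1/2) with coefficients in Z[i] are regarded as
   elements of the field of rational functions in t^(1/2) over [algC]. *)
Definition ratfun : fieldType := {fraction {poly algC}}.
Definition sqrt_t : ratfun := tofrac ('X : {poly algC}).
Definition imag : ratfun := tofrac (('i : algC)%:P).
Definition var_t : ratfun := sqrt_t ^+ 2.

Definition alexander n (V : 'M[int]_n) : ratfun :=
  let W : 'M[ratfun]_n := map_mx intr V in
  \det (sqrt_t *: W - sqrt_t^-1 *: W^T).

Definition matrix_signature n (A : 'M[algC]_n) : int :=
  #|[set i | 0 < spectral_diag A 0 i]|%:Z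
  - #|[set i | spectral_diag A 0 i < 0]|%:Z.

Definition signature n (V : 'M[int]_n) : int :=
  matrix_signature (map_mx intr (V + V^T)).

(* Main.v *)
Require Import Defs.
From mathcomp Require Import all_boot all_order all_fingroup all_algebra all_field.
From mathcomp Require Import ring zify.
Set Implicit Arguments.
Unset Strict Implicit.
Unset Printing Implicit Defensive.
Import Order.TTheory GRing.Theory Num.Theory.
Local Open Scope ring_scope.

(* An integer flow on the arcs of the diagram is the difference across the arcs of a
   potential on the regions, that is, of a potential [a] on the vertices and a potential
   [b] on the faces of the Tait digraph [G].  In terms of potentials the Seifert form is
   a sum over the crossings.  Complete a homology basis by flows along the Seifert
   circles, and its band crossings by the edges of a spanning tree of the Seifert graph:
   both completions are unimodular, so det (s V - s^-1 V^T) is, up to sign and a power of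
   [s], the determinant of a matrix with one row per crossing and one column per region
   other than [r] and [q], whose row at an edge involves only its ends and its sides.

   The Leibniz expansion of such a matrix is a sum over sets [T] of edges (those that
   select an end), in which only the spanning trees survive, each with a single
   permutation, hence with an activity monomial.  All trees have the same sign: if [M]
   is the matrix with unit weights and [M_T] its part for [T], then M M_T^T is positive
   definite because coboundaries of [G] and of its dual are orthogonal.  Rescaling rows
   and columns along the potential of one particular flow trivializes the weights not
   counted by the activities.

   The remaining power of [s] is trivial by the symmetry s -> s^-1, once the exponents of
   the tree sum have mean zero.  To see this, sum over forests with one edge less than a
   tree: the active and the passive ways to complete one are counted by the coboundary
   of the indicator of the component of the root, whose sum over the positive edges
   vanishes as the diagram alternates.

   The difference of the two exponents does not depend on the tree; it is minus the
   signature.  Indeed the symmetrized Seifert form is negative definite on the classes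
   with [b] constant along the dual negative edges and positive definite on those with
   [a] constant along the positive edges, and the dimensions of the two spaces add up to
   the rank of the homology. *)

(** The determinant is pinned down only up to sign and a power of [s], because the unimodular
    changes of basis and the rescaling are tracked no further; the symmetry has to supply the
    exponent. It is read at [s = i X], with [X] the square root of [t]: there [- s ^+ 2 = X ^+ 2],
    so up to a common factor every tree contributes with coefficient 1, and evaluation and
    derivative at 1 compare mean exponents. That only spanning trees survive is an Euler
    characteristic count: if the edges outside [T] failed to connect the faces, the part of the
    sphere not reached from [q] would be a nonempty union of open discs with at least as many edges
    as vertices and faces together. Adjacency of [q] and [r] enters in two ways: an edge touching
    both starts this count, and an arc between them allows flows to be normalized so that their
    potentials vanish at both. *)

(** * Spherical digraphs *)

(** The dual edge crosses [e] from right to left. The sides are chosen so that the dual of the dual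
    is [G] itself, which amounts to reversing the orientation of the sphere. The signs are exchanged
    because internal activity is counted at positive edges and external activity at negative
    ones. *)
Definition dual (G : plane_digraph) : plane_digraph :=
  @PlaneDigraph (face G) (edge G) (vertex G)
    (@eright G) (@eleft G) (@ehead G) (@etail G) (fun e => ~~ epositive e).

Definition cobound (G : plane_digraph) (R : zmodType) (a : vertex G -> R)
  (e : edge G) : R := a (ehead e) - a (etail e).

Notation dcobound := (@cobound (dual _) _).

Definition spans (G : plane_digraph) (A : {set edge G}) :=
  forall u v : vertex G, connect (joined A) u v.

Section Connectivity.
Variable G : plane_digraph.
Implicit Types (A B : {set edge G}) (u v : vertex G).

Lemma joined_sym A : symmetric (joined A).
Proof.
by move=> u v; apply/existsP/existsP => -[e /andP[eA H]]; exists e; rewrite eA orbC.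
Qed.

Lemma connect_joined_sym A : connect_sym (joined A).
Proof. by apply: sym_connect_sym; apply: joined_sym. Qed.

Lemma joined_edge A e : e \in A -> connect (joined A) (etail e) (ehead e).
Proof. by move=> eA; apply: connect1; apply/existsP; exists e; rewrite eA !eqxx. Qed.

Lemma joined_edgeV A e : e \in A -> connect (joined A) (ehead e) (etail e).
Proof. by move=> eA; rewrite connect_joined_sym joined_edge. Qed.

Lemma joined_ind A (P : vertex G -> Prop) u v :
  (forall e, e \in A -> P (etail e) -> P (ehead e)) ->
  (forall e, e \in A -> P (ehead e) -> P (etail e)) ->
  connect (joined A) u v -> P u -> P v.
Proof.
move=> H1 H2 /connectP[p]; elim: p u => [|w p IH] u /=; first by move=> _ ->.
case/andP=> /existsP[e /andP[eA]] H uwp ev Pu; apply: (IH w) => //.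
case/orP: H => /andP[/eqP eu /eqP ew]; first by rewrite -ew; apply: H1; rewrite ?eu.
by rewrite -eu; apply: H2; rewrite ?ew.
Qed.

Lemma joined_const A (S : Type) (a : vertex G -> S) u v :
  (forall e, e \in A -> a (ehead e) = a (etail e)) ->
  connect (joined A) u v -> a u = a v.
Proof.
move=> H uv; apply: (@joined_ind A (fun w => a u = a w) u v) => // e eA ->.
  by rewrite H.
by rewrite H.
Qed.

Lemma joined_sub A B u v :
  (forall e, e \in A -> connect (joined B) (etail e) (ehead e)) ->
  connect (joined A) u v -> connect (joined B) u v.
Proof.
move=> H uv.
apply: (@joined_ind A (fun w => connect (joined B) u w) u v) => // e eA /connect_trans.
  by apply; apply: H.
by apply; rewrite connect_joined_sym; apply: H.
Qed.

Lemma joinedS A B u v : A \subset B ->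
  connect (joined A) u v -> connect (joined B) u v.
Proof. by move=> /subsetP AB; apply: joined_sub => e eA; apply: joined_edge; apply: AB. Qed.

Variable K : fieldType.

Definition incmx A : 'M[K]_(#|vertex G|, #|A|) :=
  \matrix_(i, j) ((enum_val i == ehead (enum_val j))%:R
                  - (enum_val i == etail (enum_val j))%:R).

Definition row_of (I : finType) (a : I -> K) : 'rV[K]_#|I| := \row_i a (enum_val i).
Definition fun_of (I : finType) (r : 'rV[K]_#|I|) (v : I) : K := r 0 (enum_rank v).

Lemma row_ofK (I : finType) (a : I -> K) : fun_of (row_of a) =1 a.
Proof. by move=> v; rewrite /fun_of mxE enum_rankK. Qed.

Lemma sum_fun_of (I : finType) (r : 'rV[K]_#|I|) (v : I) :
  \sum_i r 0 i * (enum_val i == v)%:R = fun_of r v.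
Proof.
rewrite (bigD1 (enum_rank v)) //= enum_rankK eqxx mulr1 big1 ?addr0 // => i ne.
case: eqP => [e|]; rewrite ?mulr0 //.
by rewrite -e enum_valK eqxx in ne.
Qed.

Lemma mul_incmx A (r : 'rV[K]_#|vertex G|) j :
  (r *m incmx A) 0 j = cobound (fun_of r) (enum_val j).
Proof.
rewrite !mxE /cobound -!sum_fun_of -sumrB; apply: eq_bigr => i _.
by rewrite mxE mulrBr.
Qed.

Lemma ker_incmx A (r : 'rV[K]_#|vertex G|) :
  r *m incmx A = 0 <-> forall e, e \in A -> cobound (fun_of r) e = 0.
Proof.
split=> [H e eA|H]; last first.
  by apply/rowP=> j; rewrite mul_incmx H ?enum_valP // mxE.
have := mul_incmx r (enum_rank_in eA e).
by rewrite H mxE enum_rankK_in.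
Qed.

(** A vector of the left kernel is a function constant along the edges of [A], hence constant. *)
Lemma rank_incmx_ge A : spans A -> (#|vertex G| <= \rank (incmx A) + 1)%N.
Proof.
move=> sA; suff: (\rank (kermx (incmx A)) <= 1)%N.
  rewrite mxrank_ker => H; have := rank_leq_row (incmx A); lia.
have sub: (kermx (incmx A) <= (const_mx 1 : 'rV[K]_#|vertex G|))%MS.
  apply/rV_subP => r /sub_kermxP /ker_incmx H.
  have [v0 _|e0] := pickP (@predT (vertex G)); last first.
    suff -> : r = 0 by apply: sub0mx.
    by apply/rowP => i; have := e0 (enum_val i).
  apply/submxP; exists ((fun_of r v0)%:M); rewrite mul_scalar_mx.
  apply/rowP => i; rewrite !mxE mulr1 -[i]enum_valK -/(fun_of r _).
  apply: (joined_const _ (sA _ _)) => e eA.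
  by apply/eqP; rewrite -subr_eq0; apply/eqP; exact: H.
exact: leq_trans (mxrankS sub) (rank_leq_row _).
Qed.
End Connectivity.

Lemma spans_card (G : plane_digraph) (A : {set edge G}) :
  spans A -> (#|vertex G| <= #|A| + 1)%N.
Proof.
move=> /(@rank_incmx_ge G rat) H; have := rank_leq_col (incmx rat A); lia.
Qed.

(** [dcobound b] is the boundary of the 2-chain [b], so this says that boundaries of faces are
    cycles. *)
Definition cut_cycle_orthogonal (G : plane_digraph) :=
  forall (R : comNzRingType) (a : vertex G -> R) (b : face G -> R),
    \sum_e cobound a e * dcobound b e = 0.

(** A homological substitute for an embedding in the sphere: connectedness and Euler's formula leave
    no room for first homology between the coboundaries and the orthogonal complement of the dual
    coboundaries. The conditions are invariant under duality. *)
Record spherical (G : plane_digraph) : Prop := Spherical {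
  spherical_conn : spans [set: edge G];
  spherical_dconn : @spans (dual G) [set: edge G];
  spherical_euler : (#|vertex G| + #|face G| = #|edge G| + 2)%N;
  spherical_orth : cut_cycle_orthogonal G }.

Lemma spherical_dual G : spherical G -> spherical (dual G).
Proof.
case=> c d e o; split=> //=; first by rewrite addnC.
move=> R a b; rewrite -[RHS](o R b a); apply: eq_bigr => x _.
by rewrite mulrC.
Qed.

(** * Exactness: edge functions that have a potential *)

Section Exactness.
Variables (G : plane_digraph) (G_sph : spherical G).

(** The two incidence matrices have rank at least [#|vertex G| - 1] and [#|face G| - 1]. By Euler's
    formula the row space of the first, which lies in the kernel of the transpose of the second,
    already has the dimension of that kernel. *)
Lemma exact_field (K : fieldType) (y : edge G -> K) :
  (forall b : face G -> K, \sum_e y e * dcobound b e = 0) ->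
  exists a : vertex G -> K, y =1 cobound a.
Proof.
move=> H; set A := incmx K [set: edge G].
set B := @incmx (dual G) K [set: edge G].
have sumT (F : edge G -> K) : \sum_(j < #|[set: edge G]|) F (enum_val j) = \sum_e F e.
  by rewrite -(big_enum_val F) /=; apply: eq_bigl => e; rewrite inE.
have AB : A *m B^T = 0.
  apply/row_matrixP => i; rewrite row_mul row0.
  apply/trmx_inj; rewrite trmx_mul trmxK trmx0; apply/row_matrixP => k.
  rewrite row0 row_mul; apply/matrixP => i0 j0; rewrite !ord1 {i0 j0} !mxE.
  rewrite -[RHS](spherical_orth G_sph (fun v => (v == enum_val i)%:R)
     (fun f => (f == enum_val k)%:R)) -sumT.
  apply: eq_bigr => j _; rewrite !mxE /cobound /= mulrC.
  by rewrite ![_ == enum_val i]eq_sym ![_ == enum_val k]eq_sym.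
have rA := rank_incmx_ge K (spherical_conn G_sph).
have rB := @rank_incmx_ge (dual G) K _ (spherical_dconn G_sph).
have sub : (A <= kermx B^T)%MS by apply/sub_kermxP.
have sub' : (kermx B^T <= A)%MS.
  rewrite -(mxrank_leqif_sup sub) eqn_leq mxrankS //= mxrank_ker mxrank_tr.
  have := spherical_euler G_sph; have := cardsT (edge G).
  rewrite -/A -/B in rA rB; have {}rB : (#|face G| <= \rank B + 1)%N := rB.
  set x := #|[set: edge G]|.
  move: rA rB; move: (\rank A) (\rank B); clear; lia.
have /submxP[r yr] : ((\row_j y (enum_val j) : 'rV[K]_#|[set: edge G]|) <= A)%MS.
  apply: submx_trans sub'; apply/sub_kermxP/rowP => k; rewrite !mxE.
  rewrite -[RHS](H (fun f => (f == enum_val k)%:R)) -sumT; apply: eq_bigr => j _.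
  by rewrite !mxE /cobound /= ![_ == enum_val k]eq_sym.
exists (fun_of r) => e.
have /rowP/(_ (enum_rank_in (in_setT e) e)) := yr.
by rewrite mul_incmx mxE !enum_rankK_in ?inE.
Qed.

Lemma exact_int (y : edge G -> int) :
  (forall b : face G -> int, \sum_e y e * dcobound b e = 0) ->
  exists a : vertex G -> int, y =1 cobound a.
Proof.
move=> H; have [|a ya] := @exact_field rat (fun e => (y e)%:~R).
  (* Rational test functions reduce to integral ones, the indicators of single faces. *)
  move=> b; have -> : \sum_e (y e)%:~R * dcobound b e =
     \sum_f b f * (\sum_e y e * dcobound (fun g : face G => (g == f)%:Z) e)%:~R.
    transitivity (\sum_f \sum_e b f * ((y e)%:~R * (dcobound (fun g : face G => (g == f)%:Z)
      e)%:~R)).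
      rewrite exchange_big /=; apply: eq_bigr => e _.
      rewrite (eq_bigr (fun f => (y e)%:~R * (b f * (eleft e == f)%:R - b f * (eright e == f)%:R))).
        rewrite -mulr_sumr sumrB /cobound /=; congr (_ * (_ - _)).
          rewrite (bigD1 (eleft e)) //= eqxx mulr1 big1 ?addr0 // => f.
          by rewrite eq_sym => /negPf ->; rewrite mulr0.
        rewrite (bigD1 (eright e)) //= eqxx mulr1 big1 ?addr0 // => f.
        by rewrite eq_sym => /negPf ->; rewrite mulr0.
      move=> f _; rewrite /cobound /= rmorphB /=.
      by case: (_ == f); case: (_ == f); rewrite /=; ring.
    apply: eq_bigr => f _; rewrite rmorph_sum mulr_sumr; apply: eq_bigr => e _.
    by rewrite rmorphM.
  by rewrite big1 // => f _; rewrite H mulr0.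
have [v0 _|e0] := pickP (@predT (vertex G)); last first.
  by exists (fun=> 0) => e; have := e0 (ehead e).
(* Differences along edges are integers, so the potential normalized at [v0] is integral;
   [Num.floor] only reads off its values. *)
exists (fun v => Num.floor (a v - a v0)) => e.
have I v : a v - a v0 \is a Num.int.
  apply: (@joined_ind G [set: edge G] (fun w => a w - a v0 \is a Num.int) v0 v).
  - move=> f _ Hf; have -> : a (ehead f) - a v0 = (a (etail f) - a v0) + (y f)%:~R.
      by rewrite ya /cobound; ring.
    by rewrite rpredD ?intr_int.
  - move=> f _ Hf; have -> : a (etail f) - a v0 = (a (ehead f) - a v0) - (y f)%:~R.
      by rewrite ya /cobound; ring.
    by rewrite rpredB ?intr_int.
  - exact: (spherical_conn G_sph).
  - by rewrite subrr.
apply: (@intr_inj rat); rewrite ya /cobound rmorphB /= !floorK //.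
by ring.
Qed.
End Exactness.

(** * Spanning trees *)

(** Dimension count for a sequence from [I'] through [I] to [J] that is exact in the middle. With
    [I'] empty it says that an injective map needs at least [#|I|] coordinates. *)
Lemma exact_card (K : fieldType) (X Y Z : finType) (I : {set X}) (J : {set Y})
    (I' : {set Z}) (L : X -> Y -> K) (M : Z -> X -> K) :
  (forall x : X -> K, (forall i, i \notin I -> x i = 0) ->
     (forall j, j \in J -> \sum_i x i * L i j = 0) ->
     exists c : Z -> K, forall i, x i = \sum_(z in I') c z * M z i) ->
  (#|I| <= #|J| + #|I'|)%N.
Proof.
move=> H.
pose Lm : 'M[K]_(#|I|, #|J|) := \matrix_(i, j) L (enum_val i) (enum_val j).
pose Mm : 'M[K]_(#|I'|, #|I|) := \matrix_(i, j) M (enum_val i) (enum_val j).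
have sub : (kermx Lm <= Mm)%MS.
  apply/rV_subP => r /sub_kermxP rL.
  pose x i := \sum_k r 0 k * (enum_val k == i)%:R.
  have xE k : x (enum_val k) = r 0 k.
    rewrite /x (bigD1 k) //= eqxx mulr1 big1 ?addr0 // => j ne.
    by rewrite (inj_eq enum_val_inj) (negPf ne) mulr0.
  have x0 i : i \notin I -> x i = 0.
    move=> iI; rewrite /x big1 // => k _; case: eqP => [e|]; rewrite ?mulr0 //.
    by case/negP: iI; rewrite -e enum_valP.
  have [||c cE] := H x => //.
    move=> j jJ; have /rowP/(_ (enum_rank_in jJ j)) := rL; rewrite !mxE => e; rewrite -[RHS]e {e}.
    rewrite (bigID (mem I)) /= [X in _ + X]big1 ?addr0; last first.
      by move=> i /x0 ->; rewrite mul0r.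
    rewrite big_enum_val; apply: eq_bigr => k _.
    by rewrite xE mxE enum_rankK_in.
  apply/submxP; exists (\row_k c (enum_val k)); apply/rowP => k.
  rewrite -xE cE big_enum_val !mxE; apply: eq_bigr => j _.
  by rewrite !mxE.
have := mxrankS sub; rewrite mxrank_ker.
have := rank_leq_col Lm; have := rank_leq_row Mm.
by move: (\rank _) (\rank _) => *; lia.
Qed.

(** * Even edge sets, the cycles modulo 2 *)

Definition even_set (G : plane_digraph) (C : {set edge G}) :=
  forall v, ~~ odd (degree C v).

Section EvenSets.
Variable G : plane_digraph.
Implicit Types (C D T : {set edge G}).

Lemma natr_F2 n : (n%:R == 0 :> 'F_2) = ~~ odd n.
Proof. by rewrite -(dvdn_pcharf (pchar_Fp (isT : prime 2))) dvdn2. Qed.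

Lemma oppr_F2 (x : 'F_2) : - x = x.
Proof. exact: oppr_pchar2 (pchar_Fp (isT : prime 2)) x. Qed.

Lemma degree_sum (R : pzSemiRingType) C v :
  (degree C v)%:R = \sum_(e in C) ((ehead e == v)%:R + (etail e == v)%:R) :> R.
Proof.
have cnt (P : pred (edge G)) : (#|[set e in C | P e]|)%:R = \sum_(e in C) (P e)%:R :> R.
  rewrite -sum1_card natr_sum big_mkcond [RHS]big_mkcond /=.
  by apply: eq_bigr => e _; rewrite inE; case: (e \in C); case: (P e).
by rewrite /degree natrD !cnt big_split addrC.
Qed.

Lemma sum_pick (R : pzSemiRingType) (I : finType) (a : I -> R) (j : I) :
  \sum_i a i * (j == i)%:R = a j.
Proof.
rewrite (bigD1 j) //= eqxx mulr1 big1 ?addr0 // => i.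
by rewrite eq_sym => /negPf ->; rewrite mulr0.
Qed.

Lemma even_cocycle C (a : vertex G -> 'F_2) :
  even_set C -> \sum_e (e \in C)%:R * cobound a e = 0.
Proof.
move=> ev; transitivity (\sum_v a v * (degree C v)%:R); last first.
  by apply: big1 => v _; move: (ev v); rewrite -natr_F2 => /eqP ->; rewrite mulr0.
under [RHS]eq_bigr => v _ do rewrite degree_sum mulr_sumr.
rewrite exchange_big /= [RHS]big_mkcond /=; apply: eq_bigr => e _.
case: (e \in C); rewrite ?mul0r ?mul1r //.
under eq_bigr => v _ do rewrite mulrDr.
by rewrite big_split /= !sum_pick /cobound oppr_F2.
Qed.

Lemma support_even (x : edge G -> 'F_2) :
  (forall v, \sum_e x e * ((ehead e == v)%:R - (etail e == v)%:R) = 0) ->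
  even_set [set e | x e != 0].
Proof.
move=> H v; rewrite -natr_F2 degree_sum -[X in _ == X](H v) big_mkcond /=.
apply/eqP; apply: eq_bigr => e _; rewrite inE oppr_F2.
case: eqP => [->|]; rewrite ?mul0r //=.
have : (x e == 0) || (x e == 1) by case: (x e) => [[|[|[]]]].
by case/orP => /eqP -> //; rewrite mul1r.
Qed.

Lemma is_cycle_even C : is_cycle C -> even_set C.
Proof.
by case/and3P => _ /forallP H _ v; case/orP: (H v) => /eqP ->.
Qed.

(** A minimal nonempty even subset is a cycle. It is connected because a connected part of it is
    again even; its degrees are at least 2, while their sum is at most twice the number of its
    vertices. *)
Lemma even_has_cycle C : C != set0 -> even_set C ->
  exists2 C', is_cycle C' & C' \subset C.
Proof.
move=> C0 Cev.
pose P D := [&& D != set0, D \subset C & [forall v, ~~ odd (degree D v)]].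
have PC : P C by rewrite /P C0 subxx; apply/forallP.
case: (@arg_minnP _ C P (fun D : {set edge G} => #|D|) PC).
move=> {PC} B /and3P[B0 BC /forallP Bev] Bmin; exists B => //.
have Bmin' D : D != set0 -> D \subset B -> even_set D -> D = B.
  move=> D0 DB Dev; apply/eqP; rewrite eqEcard DB Bmin //.
  by rewrite /P D0 (subset_trans DB BC); apply/forallP.
have conn e1 e2 : e1 \in B -> e2 \in B -> connect (joined B) (etail e1) (etail e2).
  move=> e1B e2B; pose D := [set e in B | connect (joined B) (etail e1) (etail e)].
  suff DB : D = B by move: e2B; rewrite -{1}DB inE => /andP[].
  apply: Bmin'; first by apply/set0Pn; exists e1; rewrite inE e1B connect0.
    by apply/subsetP => e; rewrite inE => /andP[].
  move=> v; have [cv|ncv] := boolP (connect (joined B) (etail e1) v).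
    have -> : degree D v = degree B v; last exact: Bev.
    congr addn; apply: eq_card => e; rewrite !inE;
      have [eB|//] := boolP (e \in B); case: eqP => [ev|]; rewrite ?andbF //= ?andbT.
      by rewrite ev.
    by apply: connect_trans cv _; rewrite -ev joined_edgeV.
  suff -> : degree D v = 0%N by [].
  apply/eqP; rewrite addn_eq0 !cards_eq0; apply/andP; split; apply/eqP/setP => e;
    rewrite !inE; apply/negP => /andP[/andP[eB ce] /eqP ev]; case/negP: ncv.
    by rewrite -ev.
  by apply: connect_trans ce _; rewrite -ev joined_edge.
apply/and3P; split => //; last first.
  by apply/forall_inP => e1 e1B; apply/forall_inP => e2 e2B; apply: conn.
have [e0 e0B] := set0Pn _ B0.
pose W := [set v | degree B v != 0%N].
have e0W : etail e0 \in W.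
  rewrite inE addn_eq0 negb_and !cards_eq0; apply/orP; left.
  by apply/set0Pn; exists e0; rewrite inE e0B eqxx.
(* Without [e0] no nonempty even set is left, so the boundary map modulo 2 is injective; one vertex
   may be omitted because the values of a boundary sum to zero. *)
have cardB : (#|B| <= #|W|)%N.
  rewrite (cardsD1 e0) e0B (cardsD1 (etail e0) W) e0W !add1n ltnS.
  rewrite -[leqRHS]addn0 -(cards0 (edge G)).
  apply: (@exact_card 'F_2 _ _ _ (B :\ e0) (W :\ etail e0) set0
     (fun e v => (ehead e == v)%:R - (etail e == v)%:R) (fun _ _ => 0)).
  move=> x x0 xker; exists (fun=> 0) => i; rewrite big1 //; last by move=> ? _; rewrite mulr0.
  have out v : degree B v = 0%N -> forall e, x e * ((ehead e == v)%:R - (etail e == v)%:R) = 0.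
    move=> /eqP; rewrite addn_eq0 !cards_eq0 => /andP[/eqP/setP t0 /eqP/setP h0] e.
    have [eB|neB] := boolP (e \in B).
      have := t0 e; have := h0 e; rewrite !inE eB /= => -> ->.
      by rewrite subr0 mulr0.
    by rewrite x0 ?mul0r // inE (negPf neB) andbF.
  pose s v := \sum_e x e * ((ehead e == v)%:R - (etail e == v)%:R).
  have s0 v : v != etail e0 -> s v = 0.
    move=> ne; have [vW|nvW] := boolP (v \in W); first by apply: xker; rewrite !inE ne;
      rewrite inE in vW.
    by rewrite /s big1 // => e _; apply: out; apply/eqP; rewrite inE negbK in nvW.
  have ssum : \sum_v s v = 0.
    rewrite /s exchange_big /= big1 // => e _; rewrite -mulr_sumr sumrB.
    have one u : \sum_v (u == v)%:R = 1 :> 'F_2.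
      by rewrite -[RHS](@sum_pick 'F_2 _ (fun=> 1) u); apply: eq_bigr => ? _; rewrite mul1r.
    by rewrite !one subrr mulr0.
  have sall v : s v = 0.
    have [->|/s0//] := eqVneq v (etail e0).
    by move: ssum; rewrite (bigD1 (etail e0)) //= [X in _ + X]big1 ?addr0.
  have Dev := support_even sall; set D := [set e | x e != 0] in Dev.
  have sDB : D \subset B :\ e0.
    by apply/subsetP => e; rewrite inE; apply: contraR => /x0 ->.
  have [D0|D0] := eqVneq D set0.
    by have /setP/(_ i) := D0; rewrite !inE => /negbFE/eqP.
  have DB := Bmin' D D0 (subset_trans sDB (subsetDl _ _)) Dev.
  by move: sDB; rewrite DB => /subsetP/(_ _ e0B); rewrite !inE eqxx.
have sumdeg : (\sum_v degree B v = 2 * #|B|)%N.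
  have := @degree_sum nat B; rewrite /GRing.natmul => dE.
  transitivity (\sum_v \sum_(e in B) ((ehead e == v) + (etail e == v)))%N.
    by apply: eq_bigr => v _; have := degree_sum nat B v; rewrite natn => ->;
      apply: eq_bigr => e _; rewrite !natn.
  rewrite exchange_big /= -sum1_card big_distrr /=; apply: eq_bigr => e _.
  rewrite big_split /=.
  have one u : (\sum_v (u == v) = 1)%N.
    by rewrite (bigD1 u) //= eqxx big1 // => i; rewrite eq_sym => /negPf ->.
  by rewrite !one.
have sumW : (\sum_(v in W) degree B v = 2 * #|B|)%N.
  rewrite -sumdeg [RHS](bigID (mem W)) /= [X in (_ + X)%N]big1 ?addn0 // => v.
  by rewrite inE negbK => /eqP.
have ge2 v : v \in W -> (2 <= degree B v)%N.
  by rewrite inE; move: (Bev v); case: (degree B v) => [|[|]].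
apply/forallP => v; have [vW|] := boolP (v \in W); last by rewrite inE negbK => ->.
apply/orP; right; apply/eqP/anti_leq; rewrite ge2 // andbT.
have le2 : (\sum_(w in W :\ v) 2 <= \sum_(w in W :\ v) degree B w)%N.
  by apply: leq_sum => w; rewrite inE => /andP[_ /ge2].
rewrite sum_nat_const in le2.
have sumWv : (degree B v + \sum_(w in W :\ v) degree B w = 2 * #|B|)%N.
  rewrite -sumW [RHS](bigD1 v) //=; congr addn; apply: eq_bigl => w.
  by rewrite !inE andbC.
have cW : #|W| = #|W :\ v|.+1 by rewrite (cardsD1 v W) vW.
rewrite -(leq_add2r (\sum_(w in W :\ v) degree B w)) sumWv.
rewrite (leq_trans _ (leq_add (leqnn 2) le2)) // -mulSn mulnC -cW.
by rewrite leq_mul2r cardB orbT.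
Qed.
End EvenSets.

(** The self-dual form of a spanning tree: absence of cycles in [T] is replaced by connectedness of
    the faces through the complement of [T]. *)
Definition is_tree (G : plane_digraph) (T : {set edge G}) :=
  spans T /\ @spans (dual G) (~: T).

Lemma dual_tree G (T : {set edge G}) : is_tree T -> @is_tree (dual G) (~: T).
Proof. by case=> sT sdT; split=> //; rewrite setCK. Qed.

Section Trees.
Variables (G : plane_digraph) (G_sph : spherical G).
Implicit Types (T C : {set edge G}).

(** The two spanning conditions bound [T] and its complement from below, and Euler's formula turns
    both bounds into equalities. *)
Lemma tree_card T : is_tree T -> #|vertex G| = #|T|.+1.
Proof.
case=> /spans_card cT /(@spans_card (dual G)) cdT.
have {}cdT : (#|face G| <= #|~: T| + 1)%N := cdT.
have := spherical_euler G_sph; have := cardsC T.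
by move: cT cdT; clear; lia.
Qed.

(** A cycle modulo 2 bounds a set of faces: the form of the Jordan curve theorem used here. *)
Lemma even_dcobound T : even_set T ->
  exists b : face G -> 'F_2, forall e, (e \in T)%:R = dcobound b e.
Proof.
move=> ev; have [a|b bE] := @exact_field (dual G) (spherical_dual G_sph) 'F_2
    (fun e => (e \in T)%:R); last by exists b.
exact: (@even_cocycle G T a ev).
Qed.

Lemma dcobound_even (b : face G -> bool) : even_set [set e | b (eleft e) != b (eright e)].
Proof.
have -> : [set e | b (eleft e) != b (eright e)] =
    [set e | dcobound (fun f => (b f)%:R : 'F_2) e != 0].
  by apply/setP => e; rewrite !inE /cobound /=; case: (b _); case: (b _).
apply: support_even => v.
rewrite -[RHS](spherical_orth G_sph (fun w => (w == v)%:R) (fun f => (b f)%:R)).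
by apply: eq_bigr => e _; rewrite mulrC.
Qed.

(** If the faces fall apart, the boundary of one class is an even subset of [T] and contains a
    cycle. Conversely a cycle inside [T] bounds a colouring of the faces that is constant along the
    connected complement. *)
Lemma spanning_treeP T : reflect (is_tree T) (spanning_tree T).
Proof.
apply: (iffP andP) => [[/forallP sT /forallP acyc]|[sT sdT]]; split.
- by move=> u v; move/forallP: (sT u); apply.
- move=> f0 f1; apply: contraT => nc.
  pose b f := connect (@joined (dual G) (~: T)) f0 f.
  have bT e : e \notin T -> b (eleft e) = b (eright e).
    move=> eT; apply: (same_connect_r (@connect_joined_sym (dual G) _)).
    by apply: (@joined_edgeV (dual G)); rewrite inE.
  pose C := [set e | b (eleft e) != b (eright e)].
  have CT : C \subset T.
    by apply/subsetP => e; rewrite inE; apply: contraR => /bT ->.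
  have C0 : C != set0.
    apply: contra nc => /eqP/setP C0; suff e : b f0 = b f1 by rewrite -/(b f1) -e /b connect0.
    apply: (@joined_const (dual G) [set: edge G]); last exact: spherical_dconn.
    by move=> e _; have := C0 e; rewrite !inE => /negbFE/eqP.
  have [C' cC' C'C] := even_has_cycle C0 (dcobound_even b).
  by have /implyP/(_ cC') := acyc C'; rewrite (subset_trans C'C CT).
- by apply/forallP => u; apply/forallP.
- apply/forallP => C; apply/implyP => cC; apply/negP => /subsetP CT.
  have [b bE] := even_dcobound (is_cycle_even cC).
  case/and3P: cC => /set0Pn[e eC] _ _; have := bE e.
  rewrite eC /cobound /= (@joined_const (dual G) (~: T) _ b (eleft e) (eright e)) ?subrr //.
  move=> x; rewrite inE => xT; apply/eqP; rewrite -subr_eq0; apply/eqP.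
  have := bE x; rewrite /cobound /= => <-; case: (boolP (x \in C)) => // /CT xT'.
  by rewrite xT' in xT.
Qed.

(** * Trees rooted at [r] *)

Section Children.
Variables (r : vertex G) (T : {set edge G}).
Hypothesis tT : is_tree T.

(** The end of a tree edge farther from the root; [parent] is the nearer one. *)
Definition child x := if int_active r T x then ehead x else etail x.
Definition parent x := if int_active r T x then etail x else ehead x.
Local Notation W x := (connect (joined (T :\ x)) r).

Lemma child_parent (A : {set edge G}) x :
  joined A (parent x) (child x) = joined A (etail x) (ehead x).
Proof. by rewrite /child /parent; case: ifP => // _; rewrite joined_sym. Qed.

Lemma tree_bridge x : x \in T -> ~~ connect (joined (T :\ x)) (etail x) (ehead x).
Proof.
move=> xT; apply/negP => c; have sT : spans (T :\ x).
  move=> u v; apply: joined_sub (tT.1 u v) => e eT.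
  have [->//|ne] := eqVneq e x; apply: joined_edge.
  by rewrite !inE ne.
have := spans_card sT; have := tree_card tT; rewrite (cardsD1 x T) xT.
by lia.
Qed.

(** A walk in [T] from the root stays on the root side until it uses [x], so one end of [x] is on
    that side. *)
Lemma parentW x : x \in T -> W x (parent x).
Proof.
move=> xT; rewrite /parent; case: ifPn => // na; apply: contraT => nh.
case/negP: (na); rewrite /int_active.
apply: (@joined_ind G T (fun w => W x w) r _ _ _ (tT.1 r _) (connect0 _ _)) => e eT.
  have [->|ne] := eqVneq e x; first by move=> h; case/negP: na.
  by move/connect_trans; apply; rewrite joined_edge // !inE ne.
have [->|ne] := eqVneq e x; first by move=> h; rewrite h in nh.
by move/connect_trans; apply; rewrite joined_edgeV // !inE ne.
Qed.

Lemma childNW x : x \in T -> ~~ W x (child x).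
Proof.
move=> xT; apply/negP => c; case/negP: (tree_bridge xT).
have key a b : W x a -> W x b -> connect (joined (T :\ x)) a b.
  by move=> ra; apply: connect_trans; rewrite connect_joined_sym.
by have := parentW xT; move: c; rewrite /child /parent; case: ifP => _ c p; apply: key.
Qed.

Lemma child_neq_parent x : x \in T -> child x != parent x.
Proof. by move=> xT; apply: contraNneq (childNW xT) => ->; apply: parentW. Qed.

Lemma endpoint_cases x v : endpoint x v -> v = child x \/ v = parent x.
Proof. by rewrite /child /parent => /orP[] /eqP ->; case: ifP; auto. Qed.

Lemma child_neq_root x : x \in T -> child x != r.
Proof. by move=> xT; apply: contraNneq (childNW xT) => ->; apply: connect0. Qed.

(* Walking from the root inside [W x] crosses [y] only if both ends of [y] are there. *)
Lemma W_sub x y u : ~~ (W x (child y) && W x (parent y)) ->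
  y \in T -> W x u -> W y u.
Proof.
move=> nW yT xu; have {}nW : ~~ (W x (etail y) && W x (ehead y)).
  by move: nW; rewrite /child /parent; case: ifP => // _; rewrite andbC.
suff [] : W x u /\ W y u by [].
apply: (@joined_ind G (T :\ x) (fun w => W x w /\ W y w) r u _ _ xu) => //.
  move=> e eT [xe ye]; have xh : W x (ehead e) := connect_trans xe (joined_edge eT).
  split=> //; have [ey|ne] := eqVneq e y; first by rewrite -ey xe xh in nW.
  by apply: connect_trans ye _; apply: joined_edge; move: eT; rewrite !inE ne => /andP[].
move=> e eT [xe ye]; have xh : W x (etail e) := connect_trans xe (joined_edgeV eT).
split=> //; have [ey|ne] := eqVneq e y; first by rewrite -ey xe xh in nW.
by apply: connect_trans ye _; apply: joined_edgeV; move: eT; rewrite !inE ne => /andP[].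
Qed.

(** If two edges shared a child, the root side of each would exclude the parent of the other. But
    then the root side of [x], which contains [parent x], lies inside that of [y]. *)
Lemma child_inj : {in T &, injective child}.
Proof.
move=> x y xT yT cE; apply: contraTeq (parentW xT) => ne.
have pyx : ~~ W x (parent y).
  apply: contra (childNW xT) => py; rewrite cE; apply: connect_trans py _.
  apply: connect1; rewrite child_parent; apply/existsP; exists y.
  by rewrite !inE eq_sym ne yT !eqxx.
have pxy : ~~ W y (parent x).
  apply: contra (childNW yT) => px; rewrite -cE; apply: connect_trans px _.
  apply: connect1; rewrite child_parent; apply/existsP; exists x.
  by rewrite !inE ne xT !eqxx.
by apply: contra pxy; apply: W_sub; rewrite // negb_and pyx orbT.
Qed.

Lemma child_surj v : v != r -> exists2 x, x \in T & child x = v.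
Proof.
move=> vr; have /imsetP[x xT ->] : v \in child @: T; last by exists x.
have sub : child @: T \subset [set~ r].
  by apply/subsetP => _ /imsetP[x xT ->]; rewrite !inE child_neq_root.
suff cE : child @: T == [set~ r] by rewrite (eqP cE) !inE.
rewrite eqEcard sub (card_in_imset child_inj) cardsC1.
by rewrite (tree_card tT) /=.
Qed.

(** Induction on the size of the root side. An edge marking its parent takes the vertex that is the
    child of some [y]; the root side of [y] is smaller, so [y] marks its child and the two marks
    collide. *)
Lemma child_unique (s : edge G -> vertex G) :
  {in T &, injective s} -> (forall x, x \in T -> endpoint x (s x)) ->
  (forall x, x \in T -> s x != r) -> forall x, x \in T -> s x = child x.
Proof.
move=> sinj send snr x; have [n] := ubnP #|[set w | W x w]|.
elim: n x => // n IH x leW xT; have [//|sp] := endpoint_cases (send x xT).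
have [y yT cy] := child_surj (snr x xT).
have pW := parentW xT; rewrite -sp -cy in pW.
have cyN := childNW yT.
have sub : [set w | W y w] \proper [set w | W x w].
  apply/properP; split; last by exists (child y); rewrite !inE.
  apply/subsetP => u; rewrite !inE; apply: W_sub => //.
  have : ~~ W y (parent x) by rewrite -sp -cy.
  by move/negPf ->; rewrite andbF.
have sy : s y = child y by apply: IH => //; apply: leq_trans (proper_card sub) _.
have yx : y = x by apply: sinj; rewrite // sy.
by rewrite -yx.
Qed.

Lemma int_active_child x : x \in T -> ~~ connect (joined (T :\ x)) r (etail x) ->
  connect (joined (T :\ x)) r (ehead x).
Proof. by move=> xT na; move: (parentW xT); rewrite /parent /int_active (negPf na). Qed.
End Children.
End Trees.

Section ExternalActivity.
Variables (G : plane_digraph) (G_sph : spherical G).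

(** The sides of the fundamental cycle of [e] are the two classes of faces left when [e] is removed
    from the dual tree; [q] is on the left of [e] exactly when it is not joined to the right
    face. *)
Lemma ext_active_dual q (T : {set edge G}) e : is_tree T -> e \notin T ->
  ext_active q T e = ~~ @int_active (dual G) q (~: T) e.
Proof.
move=> tT eT; have dT := dual_tree tT.
have sideE (C : {set edge G}) : sharing_side C =2 @joined (dual G) (~: C).
  move=> f g; apply: eq_existsb => x; congr andb => /=.
  by rewrite orbC; congr orb; rewrite andbC.
have eT' : e \in ~: T by rewrite inE.
have nb := tree_bridge (spherical_dual G_sph) dT eT'.
pose b f := connect (@joined (dual G) (~: T :\ e)) (eleft e) f.
have bT x : x \notin e |: T -> b (eleft x) = b (eright x).
  rewrite !inE negb_or => /andP[ne xT].
  apply: (same_connect_r (@connect_joined_sym (dual G) _)).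
  by apply: (@joined_edgeV (dual G)); rewrite !inE ne xT.
have CT : [set x | b (eleft x) != b (eright x)] \subset e |: T.
  by apply/subsetP => x; rewrite inE; apply: contraR => /bT ->.
have C0 : [set x | b (eleft x) != b (eright x)] != set0.
  apply/set0Pn; exists e; rewrite inE {1}/b connect0.
  by move: nb; rewrite (@connect_joined_sym (dual G)) /b /= => /negPf ->.
(* This cycle shows that the choice in [Cyc] does not fall back on its default [set0]. *)
have [C' cC' C'C] := even_has_cycle C0 (dcobound_even G_sph b).
rewrite /ext_active /Cyc; case: pickP => [C /andP[cC CeT]|/(_ C')]; last first.
  by rewrite cC' (subset_trans C'C CT).
have eC : e \in C.
  have /spanning_treeP - /(_ G_sph)/andP[_ /forallP/(_ C)/implyP/(_ cC)] := tT.
  apply: contraR => neC; apply/subsetP => x xC.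
  by have := subsetP CeT x xC; rewrite !inE; case: eqP xC => // ->; rewrite (negPf neC).
rewrite (eq_connect (sideE _)) /=.
apply/idP/idP => [c|na].
  (* The colouring [d] is constant off [C] and changes across [e], so [q] cannot be joined to both
     sides of [e]. *)
  apply/negP => /= qe; have [d dE] := even_dcobound G_sph (is_cycle_even cC).
  have := dE e; rewrite eC /cobound /=.
  have outC x : x \notin C -> d (eleft x) = d (eright x).
    by move=> xC; apply/eqP; rewrite -subr_eq0 -[X in X == _]/(dcobound d x) -dE (negPf xC).
  rewrite (@joined_const (dual G) (~: C) _ d _ _ _ c); last first.
    by move=> x; rewrite inE => /outC.
  rewrite (@joined_const (dual G) (~: T :\ e) _ d _ _ _ qe) ?subrr //.
  move=> x; rewrite !inE => /andP[ne xT]; apply: outC.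
  by apply: contra xT => /(subsetP CeT); rewrite !inE (negPf ne).
have := int_active_child dT eT' na.
rewrite (@connect_joined_sym (dual G)); apply: joinedS.
apply/subsetP => x; rewrite !inE => /andP[ne xT].
by apply: contra xT => /(subsetP CeT); rewrite !inE (negPf ne).
Qed.
End ExternalActivity.

(** * The tree determinant *)

(* The faces around a vertex can be visited by crossing only edges at that vertex. *)
Definition star_connected (G : plane_digraph) :=
  forall (v : vertex G) e e', endpoint e v -> endpoint e' v ->
    connect (@joined (dual G) [set x | endpoint x v]) (eleft e) (eleft e').

Notation dendpoint := (@endpoint (dual _)).

(* A Kauffman state: every edge marks one of its two ends or two sides; [r] and
   [q] are the only unmarked vertex and face. *)
Record kauffman_state (G : plane_digraph) (r : vertex G) (q : face G)
    (s : edge G -> vertex G + face G) : Prop := KauffmanState {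
  state_inj : injective s;
  state_root : forall e, s e != inl r;
  state_base : forall e, s e != inr q;
  state_incident : forall e,
    match s e with inl v => endpoint e v | inr f => dendpoint e f end }.

Definition tree_of (A B : Type) (E : finType) (s : E -> A + B) : {set E} :=
  [set e | if s e is inl _ then true else false].

(** * Kauffman states come from spanning trees *)

Section StateTree.
Variables (G : plane_digraph) (G_sph : spherical G).
Hypothesis G_star : star_connected (dual G).
Variables (r : vertex G) (q : face G) (e0 : edge G).
Hypotheses (e0r : endpoint e0 r) (e0q : dendpoint e0 q).
Variable s : edge G -> vertex G + face G.
Hypothesis s_state : kauffman_state r q s.
Local Notation T := (tree_of s).

Lemma state_surj z : z != inl r -> z != inr q -> exists e, s e = z.
Proof.
move=> zr zq; have : z \in s @: [set: edge G]; last by case/imsetP => e _ ->; exists e.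
suff E : s @: [set: edge G] == ~: [set inl r; inr q].
  by rewrite (eqP E) !inE negb_or zr zq.
rewrite eqEcard; apply/andP; split.
  apply/subsetP => _ /imsetP[e _ ->]; rewrite !inE negb_or.
  by rewrite (state_root s_state) (state_base s_state).
rewrite card_imset; last exact: state_inj s_state.
rewrite cardsT; have := cardsC [set inl r; inr q : vertex G + face G].
rewrite cards2 card_sum /=; have := spherical_euler G_sph.
by move: #|edge G| #|vertex G| #|face G| => *; lia.
Qed.

(** Suppose some faces, [F1], are not reached from [q] through edges outside [T]. With the edges
    between them and the vertices surrounded by them they form an open set. The marks give it Euler
    characteristic at most 0, but the complement of a connected set in the sphere is a union of open
    discs. *)
Lemma state_dual_spans : @spans (dual G) (~: T).
Proof.
pose F2 := [set f | connect (@joined (dual G) (~: T)) q f].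
have F2c e : e \notin T -> (eleft e \in F2) = (eright e \in F2).
  move=> eT; rewrite !inE; apply: (same_connect_r (@connect_joined_sym (dual G) _)).
  by apply: (@joined_edgeV (dual G)); rewrite inE.
have qF2 : q \in F2 by rewrite inE connect0.
suff F2T f : f \in F2.
  move=> f g; have := F2T f; have := F2T g; rewrite !inE => qg.
  by rewrite (@connect_joined_sym (dual G)) => /connect_trans; apply.
apply: contraT => fF1.
pose F1 := ~: F2.
pose E1 := [set e | (eleft e \in F1) && (eright e \in F1)].
pose V1 := [set v | [forall e, endpoint e v ==> (e \in E1)]].
have side e g : dendpoint e g -> g \in F2 -> e \notin E1.
  by case/orP => /eqP ->; rewrite !inE => ->; rewrite ?andbF.
have rV1 : r \notin V1.
  by rewrite inE; apply/forallPn; exists e0; rewrite negb_imply e0r (side _ q).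
(* A face of [F1] is marked by an edge outside [T], whose two sides lie in the same class, and a
   vertex of [V1] by one of its edges: all these marks come from distinct edges of [E1]. *)
have cnt1 : (#|F1| + #|V1| <= #|E1|)%N.
  rewrite -(card_imset E1 (state_inj s_state)).
  have inlI : injective (@inl (vertex G) (face G)) by move=> ? ? [].
  have inrI : injective (@inr (vertex G) (face G)) by move=> ? ? [].
  rewrite -(card_imset F1 inrI) -(card_imset V1 inlI) -cardsUI.
  rewrite [X in (_ + X)%N](_ : _ = 0%N) ?addn0; last first.
    apply/eqP; rewrite cards_eq0; apply/eqP/setP => z; rewrite !inE.
    by apply/negP => /andP[/imsetP[? _ ->] /imsetP[? _ //]].
  apply: subset_leq_card; apply/subsetP => z /setUP[] /imsetP[y yin ->].
    have [//||e se] := @state_surj (inr y).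
      by apply: contraTneq yin => -[->]; rewrite !inE negbK connect0.
    apply/imsetP; exists e => //; have := state_incident s_state e; rewrite se => ey.
    have eT : e \notin T by rewrite inE se.
    rewrite inE !(in_setC, F2c e eT) andbb.
    by case/orP: ey yin => /eqP ->; rewrite in_setC ?F2c.
  have [|//|e se] := @state_surj (inl y).
    by apply: contraTneq yin => -[->].
  apply/imsetP; exists e => //; have := state_incident s_state e; rewrite se => ey.
  by move: yin; rewrite inE => /forallP/(_ e)/implyP/(_ ey).
(* An edge function supported on [E1] and orthogonal to the boundaries of faces is the coboundary of
   some [a], which takes the single value [a r] around the connected set [F2]; subtracting it leaves
   a function supported on [V1]. One face [f] may be omitted because the pairings with all faces sum
   to zero. *)
have cnt2 : (#|E1| <= #|F1 :\ f| + #|V1|)%N.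
  apply: (@exact_card rat _ _ _ E1 (F1 :\ f) V1
     (fun e g => (eleft e == g)%:R - (eright e == g)%:R)
     (fun v e => (ehead e == v)%:R - (etail e == v)%:R)) => x x0 xker.
  pose sg g := \sum_e x e * ((eleft e == g)%:R - (eright e == g)%:R).
  have sg0 g : g != f -> sg g = 0.
    move=> ne; have [gF1|gF2] := boolP (g \in F1); first by apply: xker; rewrite in_setD1 ne.
    rewrite inE negbK in gF2; rewrite /sg big1 // => e _.
    have [eg|neg] := boolP (dendpoint e g); first by rewrite x0 ?mul0r // (side e g).
    move: neg; rewrite /endpoint negb_or /= ![g == _]eq_sym => /andP[/negPf -> /negPf ->].
    by rewrite subrr mulr0.
  have sgsum : \sum_g sg g = 0.
    rewrite /sg exchange_big big1 // => e _; rewrite -mulr_sumr sumrB.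
    have one (u : face G) : \sum_v (u == v)%:R = 1 :> rat.
      by rewrite -[RHS](@sum_pick rat (face G) (fun=> 1) u); apply: eq_bigr => ? _; rewrite mul1r.
    by rewrite !one subrr mulr0.
  have sgall g : sg g = 0.
    have [->|/sg0//] := eqVneq g f.
    by move: sgsum; rewrite (bigD1 f) //= [X in _ + X]big1 ?addr0.
  have [b|a aE] := exact_field G_sph (y := x).
    transitivity (\sum_g b g * sg g); last by rewrite big1 // => g _; rewrite sgall mulr0.
    rewrite /sg; under [RHS]eq_bigr => g _ do rewrite mulr_sumr.
    rewrite exchange_big /=; apply: eq_bigr => e _.
    under eq_bigr => g _ do rewrite mulrCA mulrBr.
    by rewrite -mulr_sumr sumrB !sum_pick.
  have aE1 e : e \notin E1 -> a (ehead e) = a (etail e).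
    by move=> /x0; rewrite aE => /eqP; rewrite subr_eq0 => /eqP.
  have dl (y : edge G) : dendpoint y (@eleft G y) by rewrite /endpoint /= eqxx orbT.
  have dr (y : edge G) : dendpoint y (@eright G y) by rewrite /endpoint /= eqxx.
  have aF2 g : g \in F2 -> forall e : edge G, dendpoint e g -> a (ehead e) = a r.
    (* The boundary of a face of [F2] is connected and avoids [E1], so [a] is constant on it. *)
    have around h (d e : edge G) : h \in F2 -> dendpoint d h -> dendpoint e h -> a (ehead e) = a
      (ehead d).
      move=> hF2 dh eh; apply: (@joined_const G [set x | dendpoint x h]).
        by move=> y; rewrite inE => yh; apply: aE1; apply: side yh _.
      exact: G_star eh dh.
    move=> gF2; suff [] : g \in F2 /\ forall e : edge G, dendpoint e g -> a (ehead e) = a r by [].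
    have qg : connect (@joined (dual G) (~: T)) q g by rewrite inE in gF2.
    apply: (@joined_ind (dual G) (~: T)
      (fun g => g \in F2 /\ forall e : edge G, dendpoint e g -> a (ehead e) = a r) q g) => //.
    - move=> y; rewrite inE => yT /= [yF2 H].
      have y2 : @eleft G y \in F2 by rewrite F2c.
      by split=> // e ey; rewrite (around _ y e y2 (dl y) ey) (H y (dr y)).
    - move=> y; rewrite inE => yT /= [yF2 H].
      have y2 : @eright G y \in F2 by rewrite -F2c.
      by split=> // e ey; rewrite (around _ y e y2 (dr y) ey) (H y (dl y)).
    - split=> // e eq0; rewrite (around q e0 e) //.
      have [/eqP ->|/eqP ->] := orP e0r => //.
      by rewrite aE1 // (side _ q).
  exists (fun v => a v - a r) => e.
  have V1c v : v \notin V1 -> a v = a r.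
    rewrite inE => /forallPn[d]; rewrite negb_imply => /andP[dv dE1].
    have [g gF2 dg] : exists2 g, g \in F2 & dendpoint d g.
      move: dE1; rewrite !inE negb_and !negbK => /orP[H|H].
        by exists (eleft d); rewrite ?inE // /endpoint /= eqxx orbT.
      by exists (eright d); rewrite ?inE // /endpoint /= eqxx.
    have := aF2 g gF2 d dg; case/orP: dv => /eqP -> //.
    by rewrite aE1.
  transitivity (\sum_v (a v - a r) * ((ehead e == v)%:R - (etail e == v)%:R)).
    under eq_bigr => v _ do rewrite mulrBr.
    by rewrite sumrB !sum_pick aE /cobound; ring.
  rewrite [LHS](bigID (mem V1)) /= [X in _ + X]big1 ?addr0 // => v /V1c ->.
  by rewrite subrr mul0r.
have fF1' : f \in F1 by rewrite inE.
by move: cnt1 cnt2; rewrite (cardsD1 f F1) fF1'; clear; lia.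
Qed.
End StateTree.

Section StateIsTree.
Variables (G : plane_digraph) (G_sph : spherical G).
Hypotheses (G_star : star_connected G) (dG_star : star_connected (dual G)).
Variables (r : vertex G) (q : face G) (e0 : edge G).
Hypotheses (e0r : endpoint e0 r) (e0q : dendpoint e0 q).

Lemma state_is_tree s : kauffman_state r q s -> is_tree (tree_of s).
Proof.
move=> st; split; last exact: (state_dual_spans G_sph dG_star e0r e0q st).
pose s' e := match s e with inl v => inr v | inr f => inl f end : face G + vertex G.
have st' : @kauffman_state (dual G) q r s'.
  case: st => i rt ba inc; split.
  - by move=> x y; rewrite /s' => xy; apply: i; case: (s x) (s y) xy => ? [] ? // [->].
  - by move=> e; have := ba e; rewrite /s'; case: (s e).
  - by move=> e; have := rt e; rewrite /s'; case: (s e).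
  - by move=> e; have := inc e; rewrite /s'; case: (s e).
have := state_dual_spans (spherical_dual G_sph) G_star e0q e0r st'.
suff -> : ~: @tree_of _ _ (edge (dual G)) s' = tree_of s by [].
by apply/setP => e; rewrite !inE /s'; case: (s e).
Qed.
End StateIsTree.

(* Induction on the Schur complement; [M] need not be symmetric. *)
Lemma posdef_det_gt0 (R : realFieldType) n (M : 'M[R]_n) :
  (forall x : 'rV_n, x != 0 -> 0 < (x *m M *m x^T) 0 0) -> 0 < \det M.
Proof.
elim: n M => [|n IH] M H; first by rewrite det_mx00.
rewrite -[n.+1]/(1 + n)%N in M H *; rewrite -(submxK M) in H *.
move: (ulsubmx M) (ursubmx M) (dlsubmx M) (drsubmx M) H => a b c d H.
have a_gt0 : 0 < a 0 0.
  have := H (row_mx 1%:M 0); rewrite tr_row_mx mul_row_block !mul1mx !mul0mx !addr0.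
  rewrite mul_row_col trmx1 mulmx1 trmx0 mulmx0 addr0; apply.
  apply/eqP => /(congr1 lsubmx); rewrite row_mxKl => /matrixP/(_ 0 0)/eqP.
  by rewrite !mxE eqxx oner_eq0.
have [k aE k_gt0] : exists2 k, a = k%:M & 0 < k.
  by exists (a 0 0) => //; apply/matrixP => i j; rewrite !ord1 !mxE eqxx.
subst a => {a_gt0}.
have -> : block_mx k%:M b c d =
   block_mx 1%:M 0 (k^-1 *: c) 1%:M *m block_mx k%:M b 0 (d - k^-1 *: (c *m b)).
  rewrite mulmx_block !mul1mx !mul0mx !addr0 -!scalemxAl mul_mx_scalar.
  by rewrite scalerA mulVf ?gt_eqF // scale1r addrC subrK.
rewrite det_mulmx det_lblock !det1 !mul1r det_ublock det_scalar1.
apply: mulr_gt0 => //; apply: IH => y y0.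
have := H (row_mx (- k^-1 *: (y *m c)) y).
rewrite tr_row_mx mul_row_block mul_mx_scalar scalerA mulrN mulfV ?gt_eqF //.
rewrite scaleN1r addNr mul_row_col mul0mx add0r mulmxBr -scalemxAl -!mulmxA scaleNr.
rewrite -!scalemxAr addrC scaleNr; apply; apply: contraNneq y0.
by move=> /(congr1 rsubmx); rewrite row_mxKr => ->; rewrite linear0.
Qed.

Section TreeDeterminant.
Variables (G : plane_digraph) (G_sph : spherical G).
Hypotheses (G_star : star_connected G) (dG_star : star_connected (dual G)).
Variables (r : vertex G) (q : face G) (e0 : edge G).
Hypotheses (e0r : endpoint e0 r) (e0q : dendpoint e0 q).
Implicit Types T : {set edge G}.
Variables (n : nat) (xi : 'I_n -> edge G) (rho : 'I_n -> vertex G + face G).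
Hypotheses (xi_bij : bijective xi) (rho_inj : injective rho).
Hypotheses (rho_r : forall j, rho j != inl r) (rho_q : forall j, rho j != inr q).

Section Weights.
Variables (K : comNzRingType) (al be ga de : edge G -> K).

Definition vertex_part (e : edge G) (z : vertex G + face G) : K :=
  al e * (z == inl (ehead e))%:R - be e * (z == inl (etail e))%:R.
Definition face_part (e : edge G) (z : vertex G + face G) : K :=
  ga e * (z == inr (eleft e))%:R - de e * (z == inr (eright e))%:R.
Definition weighted_mx : 'M[K]_n :=
  \matrix_(i, j) (vertex_part (xi i) (rho j) + face_part (xi i) (rho j)).
Definition masked_mx (T : {set edge G}) : 'M[K]_n :=
  \matrix_(i, j) (if xi i \in T then vertex_part (xi i) (rho j)
                  else face_part (xi i) (rho j)).
(** An edge of the tree marks its end away from [r], any other edge its side away from [q]; an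
    externally active edge has [q] on its left and so marks its right face. *)
Definition tree_weight (T : {set edge G}) : K :=
  \prod_e (if e \in T then (if int_active r T e then al e else be e)
           else (if ext_active q T e then de e else ga e)).

(** Each row is the sum of a vertex part and a face part; [T] records the rows that contribute their
    vertex part. *)
Lemma det_weighted : \det weighted_mx = \sum_T \det (masked_mx T).
Proof.
rewrite exchange_big /=; apply: eq_bigr => s _; rewrite -mulr_sumr; congr (_ * _).
under eq_bigr => i _ do rewrite mxE.
rewrite bigA_distr /=.
case: xi_bij => xi' xiK xi'K.
rewrite (reindex (fun T : {set edge G} => [set i | xi i \in T])) /=.
  by apply: eq_bigr => T _; apply: eq_bigr => i _; rewrite inE mxE.
exists (fun J : {set 'I_n} => [set e | xi' e \in J]) => T _.
  by apply/setP => e; rewrite !inE xi'K.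
by apply/setP => i; rewrite !inE xiK.
Qed.

Definition marks (T : {set edge G}) (e : edge G) (z : vertex G + face G) : bool :=
  match z with
  | inl v => (e \in T) && endpoint e v
  | inr f => (e \notin T) && dendpoint e f
  end.

Lemma masked0 T i j : ~~ marks T (xi i) (rho j) -> masked_mx T i j = 0.
Proof.
rewrite mxE /marks /vertex_part /face_part; case: ifP => eT; case: (rho j) => [v|f] /=.
- rewrite /endpoint negb_or => /andP[/negPf h1 /negPf h2].
  by rewrite !(inj_eq (@inl_inj _ _)) h1 h2 !mulr0 subrr.
- by rewrite !mulr0 subrr.
- by rewrite !mulr0 subrr.
rewrite /endpoint negb_or /= => /andP[/negPf h1 /negPf h2].
by rewrite !(inj_eq (@inr_inj _ _)) h1 h2 !mulr0 subrr.
Qed.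
End Weights.

Lemma xi_surj e : exists i, xi i = e.
Proof. by case: xi_bij => xi' _ xiK; exists (xi' e). Qed.

(** The default [inl r] is never reached, since [xi] is onto. *)
Definition state_of (s : {perm 'I_n}) (e : edge G) : vertex G + face G :=
  if [pick i | xi i == e] is Some i then rho (s i) else inl r.

Lemma state_ofE s i : state_of s (xi i) = rho (s i).
Proof.
rewrite /state_of; case: pickP => [j /eqP/(bij_inj xi_bij) -> //|/(_ i)].
by rewrite eqxx.
Qed.

Lemma state_of_kauffman T (s : {perm 'I_n}) :
  (forall i, marks T (xi i) (rho (s i))) ->
  kauffman_state r q (state_of s) /\ tree_of (state_of s) = T.
Proof.
move=> H; have mk e : marks T e (state_of s e).
  by have [i <-] := xi_surj e; rewrite state_ofE.
split.
  split=> [x y|e|e|e].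
  - have [i <-] := xi_surj x; have [j <-] := xi_surj y.
    by rewrite !state_ofE => /rho_inj/perm_inj ->.
  - by have [i <-] := xi_surj e; rewrite state_ofE.
  - by have [i <-] := xi_surj e; rewrite state_ofE.
  - by have := mk e; case: (state_of s e) => ? /andP[].
by apply/setP => e; have := mk e; rewrite inE; case: (state_of s e) => ? /andP[]; case: (e \in T).
Qed.

Lemma masked_term0 (K : comNzRingType) (al be ga de : edge G -> K) T (s : {perm 'I_n}) :
  ~~ [forall i, marks T (xi i) (rho (s i))] ->
  \prod_i masked_mx al be ga de T i (s i) = 0.
Proof.
by move=> /forallPn[i /masked0 H]; rewrite (bigD1 i) //= H mul0r.
Qed.

Lemma det_masked0 (K : comNzRingType) (al be ga de : edge G -> K) T :
  ~ is_tree T -> \det (masked_mx al be ga de T) = 0.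
Proof.
move=> nT; rewrite /determinant big1 // => s _; rewrite masked_term0 ?mulr0 //.
apply/negP => /forallP /state_of_kauffman[st sT].
by apply: nT; rewrite -sT; apply: (state_is_tree G_sph G_star dG_star e0r e0q st).
Qed.

Definition tree_state (T : {set edge G}) (e : edge G) : vertex G + face G :=
  if e \in T then inl (child r T e) else inr (@child (dual G) q (~: T) e).

Lemma marks_tree_state T (s : {perm 'I_n}) : is_tree T ->
  (forall i, marks T (xi i) (rho (s i))) <-> (forall i, rho (s i) = tree_state T (xi i)).
Proof.
move=> tT; have dT := dual_tree tT; split=> H i; last first.
  rewrite H /tree_state /marks /child; case: ifPn => eT; rewrite ?eT ?(negPf eT) /endpoint /=.
    by case: ifP; rewrite eqxx ?orbT.
  by case: ifP; rewrite eqxx ?orbT.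
have [st sT] := state_of_kauffman H.
have mk e : marks T e (state_of s e).
  by have [j <-] := xi_surj e; rewrite state_ofE.
rewrite -state_ofE /tree_state; move: (xi i) => e; case: ifPn => eT.
  pose g e := if state_of s e is inl v then v else r.
  have gE x : x \in T -> state_of s x = inl (g x).
    by move=> xT; have := mk x; rewrite /g; case: (state_of s x) => //= f; rewrite xT.
  rewrite gE //; congr inl; apply: (child_unique G_sph tT) => //.
  - move=> x y xT yT xy; apply: (state_inj st); rewrite !gE // xy //.
  - by move=> x xT; have := mk x; rewrite gE // => /andP[].
  - by move=> x xT; apply: contraNneq (state_root st x) => h; rewrite gE // h.
pose g e := if state_of s e is inr v then v else q.
have gE x : x \notin T -> state_of s x = inr (g x).
  by move=> xT; have := mk x; rewrite /g; case: (state_of s x) => //= f; rewrite (negPf xT).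
rewrite gE //; congr inr; apply: (child_unique (spherical_dual G_sph) dT); rewrite ?inE //.
- move=> x y; rewrite !inE => xT yT xy; apply: (state_inj st); rewrite !gE // xy //.
- by move=> x; rewrite inE => xT; have := mk x; rewrite gE // => /andP[].
- by move=> x; rewrite inE => xT; apply: contraNneq (state_base st x) => h; rewrite gE // h.
Qed.

Lemma tree_perm T : is_tree T ->
  exists s : {perm 'I_n}, forall i, rho (s i) = tree_state T (xi i).
Proof.
move=> tT; have dT := dual_tree tT.
have inj : injective (tree_state T).
  move=> x y; rewrite /tree_state; case: ifPn => xT; case: ifPn => yT // [].
    exact: (child_inj G_sph tT).
  by apply: (child_inj (spherical_dual G_sph) dT); rewrite inE.
have card : #|{: vertex G + face G}| = (n + 2)%N.
  rewrite card_sum (spherical_euler G_sph) -(bij_eq_card xi_bij) card_ord //.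
have ex i : exists j, rho j == tree_state T (xi i).
  have : tree_state T (xi i) \in rho @: [set: 'I_n]; last first.
    by case/imsetP => j _ ->; exists j.
  suff E : rho @: [set: 'I_n] == ~: [set inl r; inr q].
    rewrite (eqP E) !inE /tree_state; case: ifPn => eT.
      by rewrite (inj_eq (@inl_inj _ _)) (negPf (child_neq_root G_sph _ tT eT)).
    by rewrite (inj_eq (@inr_inj _ _)) (negPf (child_neq_root (spherical_dual G_sph) _ dT _)) //
      inE.
  rewrite eqEcard; apply/andP; split.
    by apply/subsetP => _ /imsetP[j _ ->]; rewrite !inE negb_or rho_r rho_q.
  rewrite card_imset // cardsT card_ord.
  by have := cardsC [set inl r; inr q : vertex G + face G]; rewrite cards2 card /=; lia.
pose f i := xchoose (ex i).
have fE i : rho (f i) = tree_state T (xi i) by apply/eqP; exact: (xchooseP (ex i)).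
have finj : injective f.
  by move=> i j /(congr1 rho); rewrite !fE => /inj/(bij_inj xi_bij).
by exists (perm finj) => i; rewrite permE.
Qed.

(** The sign [b] combines the sign of the permutation with the minus signs at tails and right sides.
    It depends neither on the ring nor on the weights, so it can be computed from unit weights over
    [rat]. *)
Lemma det_masked_tree T : is_tree T -> exists2 b : bool, True &
  forall (K : comNzRingType) (al be ga de : edge G -> K),
    \det (masked_mx al be ga de T) = (-1) ^+ b * tree_weight al be ga de T.
Proof.
move=> tT; have dT := dual_tree tT; have [s sE] := tree_perm tT.
pose sg (K : pzRingType) e : K := (-1) ^+ (if e \in T then ~~ int_active r T e else ext_active q T
  e).
have [b bE] : exists b : bool, forall K : comNzRingType, (-1) ^+ s * \prod_e sg K e = (-1) ^+ b :>
  K.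
  exists (s (+) odd (\sum_e (if e \in T then ~~ int_active r T e else ext_active q T e))) => K.
  by rewrite /sg prodrXr signr_addb signr_odd.
exists b => // K al be ga de.
rewrite /determinant (bigD1 s) //= [X in _ + X]big1 ?addr0; last first.
  move=> s' ne; rewrite masked_term0 ?mulr0 //; apply: contra ne => /forallP.
  move/(marks_tree_state _ tT) => s'E; apply/eqP/permP => i.
  by apply: rho_inj; rewrite s'E sE.
rewrite -bE -mulrA; congr (_ * _).
rewrite -big_split /= [RHS](reindex xi) /=; last exact: onW_bij.
apply: eq_bigr => i _; rewrite mxE sE /tree_state /sg; move: (xi i) => e.
have [eT|eT] := boolP (e \in T).
  rewrite /vertex_part !(inj_eq (@inl_inj _ _)).
  have := child_neq_parent G_sph r tT eT; rewrite /child /parent.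
  case: ifP => _ /negPf; rewrite eqxx => -> /=.
    by rewrite mulr1 mulr0 subr0 expr0 mul1r.
  by rewrite mulr1 mulr0 sub0r expr1 mulN1r.
rewrite (ext_active_dual G_sph _ tT eT).
have eT' : e \in ~: T by rewrite inE.
rewrite /face_part !(inj_eq (@inr_inj _ _)).
have := child_neq_parent (spherical_dual G_sph) q dT eT'; rewrite /child /parent /=.
case: ifP => _ /negPf; rewrite eqxx => -> /=.
  by rewrite mulr1 mulr0 subr0 expr0 mul1r.
by rewrite mulr1 mulr0 sub0r expr1 mulN1r.
Qed.

Local Notation one := (fun=> 1%:R).

Lemma masked_det_sign T : is_tree T ->
  0 < \det (weighted_mx (one : _ -> rat) one one one)
      * \det (masked_mx (one : _ -> rat) one one one T).
Proof.
move=> tT; rewrite -det_tr -det_mulmx; apply: posdef_det_gt0 => x x0.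
pose a v := \sum_j x 0 j * (rho j == inl v)%:R.
pose b f := \sum_j x 0 j * (rho j == inr f)%:R.
have vE e : \sum_j x 0 j * vertex_part (one : _ -> rat) one e (rho j) = cobound a e.
  rewrite /cobound /a -sumrB; apply: eq_bigr => j _.
  by rewrite /vertex_part !mul1r mulrBr.
have fE e : \sum_j x 0 j * face_part (one : _ -> rat) one e (rho j) = dcobound b e.
  rewrite /cobound /b -sumrB; apply: eq_bigr => j _.
  by rewrite /face_part !mul1r mulrBr.
rewrite !mulmxA -mulmxA.
have lE i : (x *m (weighted_mx (one : _ -> rat) one one one)^T) 0 i =
    cobound a (xi i) + dcobound b (xi i).
  rewrite mxE (eq_bigr (fun j => x 0 j * vertex_part (one : _ -> rat) one (xi i) (rho j)
     + x 0 j * face_part (one : _ -> rat) one (xi i) (rho j))) => [|j _].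
    by rewrite big_split /= vE fE.
  by rewrite !mxE mulrDr.
have rE i : (masked_mx (one : _ -> rat) one one one T *m x^T) i 0 =
    if xi i \in T then cobound a (xi i) else dcobound b (xi i).
  rewrite mxE -vE -fE -fun_if; case: ifP => eT;
    by apply: eq_bigr => j _; rewrite !mxE eT mulrC.
rewrite mxE; under eq_bigr => i _ do rewrite lE rE.
rewrite -(@reindex _ _ _ _ _ xi xpredT (fun e => (cobound a e + dcobound b e) *
   (if e \in T then cobound a e else dcobound b e))) /=; last exact: onW_bij.
(* The mixed products sum to zero by orthogonality, which leaves a sum of squares. *)
have -> : \sum_e (cobound a e + dcobound b e) * (if e \in T then cobound a e else dcobound b e)
  = \sum_e (if e \in T then cobound a e else dcobound b e) ^+ 2.
  rewrite -[RHS]addr0 -[X in _ = _ + X](spherical_orth G_sph a b) -big_split.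
  by apply: eq_bigr => e _ /=; case: ifP => _; ring.
rewrite lt_def sumr_ge0 => [|e _]; last exact: sqr_ge0.
rewrite andbT; apply: contra x0; rewrite psumr_eq0 => [/allP H|e _]; last exact: sqr_ge0.
have {}H e : (if e \in T then cobound a e else dcobound b e) = 0.
  by apply/eqP; rewrite -sqrf_eq0; apply: H; rewrite mem_index_enum.
(* If all squares vanish, [a] is constant along [T] and [b] along its complement, so both vanish
   with their values at [r] and [q]. *)
have a0 v : a v = 0.
  suff ar : a r = 0.
    rewrite -ar; apply: (@joined_const G T) (tT.1 v r) => e eT.
    by apply/eqP; rewrite -subr_eq0; have := H e; rewrite eT => <-.
  by rewrite /a big1 // => j _; rewrite (negPf (rho_r j)) mulr0.
have b0 f : b f = 0.
  suff ar : b q = 0.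
    rewrite -ar; apply: (@joined_const (dual G) (~: T)) (tT.2 f q) => e.
    rewrite inE => eT; apply/eqP; rewrite -subr_eq0.
    by have := H e; rewrite (negPf eT) => <-.
  by rewrite /b big1 // => j _; rewrite (negPf (rho_q j)) mulr0.
have xj j : \sum_k x 0 k * (rho k == rho j)%:R = x 0 j :> rat.
  rewrite (bigD1 j) //= eqxx mulr1 big1 ?addr0 // => k ne.
  by rewrite (inj_eq rho_inj) (negPf ne) mulr0.
apply/eqP/rowP => j; rewrite mxE -(xj j); case: (rho j) => [v|f]; [exact: a0|exact: b0].
Qed.

Theorem det_weighted_trees : exists b : bool,
  forall (K : comNzRingType) (al be ga de : edge G -> K),
    \det (weighted_mx al be ga de) =
      (-1) ^+ b * \sum_(T | spanning_tree T) tree_weight al be ga de T.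
Proof.
pose D := \det (weighted_mx (one : _ -> rat) one one one).
(* Every tree carries the sign of the full determinant at unit weights. *)
exists (D < 0) => K al be ga de; rewrite det_weighted mulr_sumr [RHS]big_mkcond /=.
apply: eq_bigr => T _; case: (spanning_treeP G_sph T) => [tT|nT]; last exact: det_masked0.
have [b _ bE] := det_masked_tree tT; rewrite bE; congr (_ ^+ _ * _).
have := masked_det_sign tT; rewrite bE -/D.
have -> : tree_weight (one : _ -> rat) one one one T = 1.
  by rewrite /tree_weight big1 // => e _; do !case: ifP.
rewrite mulr1; case: b {bE}; rewrite /= ?expr1 ?expr0 ?mulr1 ?mulrN1 ?oppr_gt0 => H.
  by rewrite H.
by rewrite ltNge (ltW H).
Qed.
End TreeDeterminant.

(** * The Tait digraph of an alternating diagram *)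

Section TaitDigraph.
Variable D : crossing_diagram.
Hypotheses (D_planar : euler_sphere D) (D_connected : crossings_connected D).
Hypothesis D_alt : strands_alternate D.
Local Notation X := (crossing D).
Local Notation G := (tait_of_crossings D).
Implicit Types (x y : X) (s o : bool) (d : dart D).

Definition succ s x : X := (Defs.next D (x, s)).1.

Lemma next_succ x s : Defs.next D (x, s) = (succ s x, ~~ s).
Proof.
by have /forallP/(_ (x, s))/eqP := D_alt; rewrite /succ; case: (Defs.next D _) => y s' /= ->.
Qed.

Lemma succ_inj s : injective (succ s).
Proof.
move=> x y E; suff : (x, s) = (y, s) by case.
by apply: (@perm_inj _ (Defs.next D)); rewrite !next_succ E.
Qed.

Lemma arc_in_succ x s : arc_in (succ s x) (~~ s) = (x, s).
Proof. by rewrite /arc_in -next_succ permK. Qed.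

Lemma next_corner_inj : injective (@next_corner D).
Proof.
have ri : injective (@rotate D).
  move=> [[x s] o] [[y s'] o'] [-> /negb_inj-> /addIb -> //].
have oi : injective (@opposite D).
  move=> [[x s] o] [[y s'] o'] /=; case: o; case: o' => // -[].
  - by move=> /perm_inj[-> ->].
  - by move=> /perm_inj[-> ->].
by move=> d d' /oi/ri.
Qed.

Lemma regionP d d' : reflect (region d = region d') (fconnect (@next_corner D) d d').
Proof.
apply: (iffP idP) => [c|E].
  apply/setP => z; rewrite !inE.
  exact: (same_connect (fconnect_sym next_corner_inj) c).
have : d' \in region d by rewrite E inE connect0.
by rewrite inE.
Qed.

Lemma region_next d : region (next_corner d) = region d.
Proof. by symmetry; apply/regionP; apply: fconnect1. Qed.

(** Here alternation produces the checkerboard: the strand of a dart does not change along a region,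
    so the shaded regions are those of overstrand darts. *)
Lemma next_corner_strand d : (next_corner d).1.2 = d.1.2.
Proof.
case: d => [[x s] o]; rewrite /next_corner /rotate /opposite.
case: ifP => _; first by rewrite next_succ /= negbK.
rewrite /arc_in /=; case E : ((Defs.next D)^-1%g (x, ~~ s)) => [y s'] /=.
have := congr1 (Defs.next D) E; rewrite permKV next_succ => -[_].
by move/negb_inj.
Qed.

Lemma fconnect_strand d d' : fconnect (@next_corner D) d d' -> d.1.2 = d'.1.2.
Proof.
move/iter_findex <-; elim: (findex _ _ _) => //= n IH.
by rewrite next_corner_strand.
Qed.

Lemma left_of_arc x s :
  region (x, s, true) = region (succ s x, s, s (+) positive (succ s x)).
Proof.
rewrite -[RHS]region_next; congr region.
by rewrite /next_corner /rotate /opposite addbb arc_in_succ.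
Qed.

Lemma right_of_arc x s :
  region (x, ~~ s, s (+) positive x) = region (succ s x, ~~ s, false).
Proof.
rewrite -[LHS]region_next; congr region.
by rewrite /next_corner /rotate /opposite addNb addbN addbb /= negbK next_succ.
Qed.

Lemma val_ehead x : val (@ehead G x) = region (x, true, true). Proof. by []. Qed.
Lemma val_etail x : val (@etail G x) = region (x, true, false). Proof. by []. Qed.
Lemma val_eleft x : val (@eleft G x) = region (x, false, positive x).
Proof. by rewrite /= /unshaded_at /=; case: positive. Qed.
Lemma val_eright x : val (@eright G x) = region (x, false, ~~ positive x).
Proof. by rewrite /= /unshaded_at /=; case: positive. Qed.

(** The arc leaving [x] as overstrand has the top corner of [x] on its left and the right corner on
    its right. The lemmas up to [under_right] compare the sides of an arc at its two ends. *)
Lemma over_left x : @ehead G x =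
  if positive (succ true x) then @etail G (succ true x) else @ehead G (succ true x).
Proof.
apply: val_inj; rewrite (fun_if val) val_ehead val_etail val_ehead left_of_arc.
by case: positive.
Qed.

Lemma over_right x : @eright G x =
  if positive (succ true x) then @eright G (succ true x) else @eleft G (succ true x).
Proof.
apply: val_inj; rewrite (fun_if val) !val_eright val_eleft.
by have /= := right_of_arc x true => ->; case: positive.
Qed.

Lemma under_left x :
  @eleft G (succ false x) = if positive x then @eleft G x else @eright G x.
Proof.
apply: val_inj; rewrite (fun_if val) val_eright !val_eleft.
by have /= := left_of_arc x false => <-; case: positive.
Qed.

Lemma under_right x :
  @etail G (succ false x) = if positive x then @ehead G x else @etail G x.
Proof.
apply: val_inj; rewrite (fun_if val) !val_etail val_ehead.
by have /= := right_of_arc x false => <-; case: positive.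
Qed.

(** Both members sum over the arcs that leave a crossing as overstrand: the first at their start,
    the second at their end, where they pass under. *)
Lemma corner_sum_over (V : nmodType) (Phi : vertex G -> face G -> V) :
  \sum_x Phi (@ehead G x) (@eright G x) =
  \sum_x (if positive x then Phi (@etail G x) (@eright G x)
          else Phi (@ehead G x) (@eleft G x)).
Proof.
rewrite [RHS](reindex_inj (@succ_inj true)); apply: eq_bigr => x _.
by rewrite over_left over_right; case: positive.
Qed.

Lemma corner_sum_under (V : nmodType) (Phi : vertex G -> face G -> V) :
  \sum_x Phi (@etail G x) (@eleft G x) =
  \sum_x (if positive x then Phi (@ehead G x) (@eleft G x)
          else Phi (@etail G x) (@eright G x)).
Proof.
rewrite [LHS](reindex_inj (@succ_inj false)); apply: eq_bigr => x _.
by rewrite under_left under_right; case: positive.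
Qed.

(** Expanded, the products at a crossing belong to the four arc ends between a shaded and an
    unshaded region, with one sign at over ends and the other at under ends; as the diagram
    alternates, the two ends of each arc cancel. *)
Lemma tait_orth : cut_cycle_orthogonal G.
Proof.
move=> R a b; pose Phi v f := a v * b f.
have H := corner_sum_over Phi; have H' := corner_sum_under Phi.
transitivity (\sum_x (Phi (@ehead G x) (@eleft G x) + Phi (@etail G x) (@eright G x))
  - (\sum_x Phi (@ehead G x) (@eright G x) + \sum_x Phi (@etail G x) (@eleft G x))).
  rewrite -big_split -sumrB; apply: eq_bigr => x _.
  by rewrite /cobound /Phi /=; ring.
rewrite H H' -big_split /= -sumrB big1 // => x _.
by case: positive; rewrite ?subrr // addrC subrr.
Qed.

Lemma surj_vertex (v : vertex G) : exists x o, v = if o then @ehead G x else @etail G x.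
Proof.
have /imsetP[[x o] _ E] := valP v; exists x, o; apply: val_inj.
by rewrite E; case: o E.
Qed.

Lemma surj_face (f : face G) : exists x o, f = if o then @eleft G x else @eright G x.
Proof.
have /imsetP[[x o] _ E] := valP f; exists x, o; apply: val_inj.
by rewrite E; case: o E.
Qed.

Lemma vertex_endpoint (v : vertex G) : exists x : edge G, endpoint x v.
Proof.
by have [x [o ->]] := surj_vertex v; exists x; rewrite /endpoint; case: o; rewrite eqxx ?orbT.
Qed.

Lemma tait_euler : (#|vertex G| + #|face G| = #|edge G| + 2)%N.
Proof.
rewrite /= !card_sig addn2.
have -> : #|crossing D|.+2 = #|[set region d | d : dart D]| by rewrite (eqP D_planar).
rewrite -cardsUI.
rewrite [X in (_ + X)%N](_ : _ = 0%N) ?addn0.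
  apply: eq_card => A; rewrite !inE; apply/orP/imsetP.
    by case=> /imsetP[[x o] _ ->]; eexists.
  case=> -[[x s] o] _ ->; case: s; [left|right].
    by apply/imsetP; exists (x, o).
  apply/imsetP; exists (x, o (+) ~~ positive x) => //.
  by rewrite /unshaded_at /=; case: o; case: positive.
apply/eqP; rewrite cards_eq0; apply/eqP/setP => A; rewrite !inE.
apply/negP => /andP[/imsetP[[x o] _ ->] /imsetP[[y o'] _]] /regionP/fconnect_strand.
by rewrite /rotate.
Qed.

Lemma adjacent_succ x y : adjacent_crossings x y ->
  exists s, y = succ s x \/ x = succ s y.
Proof. by case/existsP => s /orP[] /eqP <-; exists s; auto. Qed.

Lemma share_vertex x s : exists2 v : vertex G, @endpoint G x v & @endpoint G (succ s x) v.
Proof.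
rewrite /endpoint; case: s.
  exists (@ehead G x); first by rewrite eqxx orbT.
  by rewrite over_left; case: positive; rewrite eqxx ?orbT.
exists (@etail G (succ false x)); last by rewrite eqxx.
by rewrite under_right; case: positive; rewrite eqxx ?orbT.
Qed.

Lemma share_face x s :
  exists2 f : face G, @endpoint (dual G) x f & @endpoint (dual G) (succ s x) f.
Proof.
rewrite /endpoint; case: s.
  exists (@eright G x); first by rewrite eqxx.
  by rewrite over_right; case: positive; rewrite eqxx ?orbT.
exists (@eleft G (succ false x)); last by rewrite eqxx orbT.
by rewrite under_left; case: positive; rewrite eqxx ?orbT.
Qed.

Lemma connect_ends (H : plane_digraph) (A : {set edge H}) e u v :
  e \in A -> endpoint e u -> endpoint e v -> connect (joined A) u v.
Proof.
move=> eA /orP[] /eqP -> /orP[] /eqP ->; by [|exact: joined_edge|exact: joined_edgeV].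
Qed.

Lemma endpoint_head (H : plane_digraph) (e : edge H) : endpoint e (ehead e).
Proof. by rewrite /endpoint eqxx orbT. Qed.

Lemma connect_heads (H : plane_digraph) (A : {set edge H}) e e' u :
  e \in A -> e' \in A -> endpoint e u -> endpoint e' u ->
  connect (joined A) (ehead e) (ehead e').
Proof.
move=> eA e'A eu e'u.
exact: connect_trans (connect_ends eA (endpoint_head e) eu)
                     (connect_ends e'A e'u (endpoint_head e')).
Qed.

Lemma crossings_ind (P : X -> Prop) x0 :
  (forall x s, P x -> P (succ s x)) -> (forall x s, P (succ s x) -> P x) ->
  P x0 -> forall x, P x.
Proof.
move=> H1 H2 P0 x; have /forallP/(_ x0)/forallP/(_ x)/connectP[p] := D_connected.
elim: p x0 P0 => [|y p IH] x0 P0 /=; first by move=> _ ->.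
case/andP => /adjacent_succ[s [yE|xE]] yp ex; apply: IH yp ex; first by rewrite yE; apply: H1.
by apply: (H2 y s); rewrite -xE.
Qed.

(** Euler's formula forces at least two regions, hence a dart and a crossing. *)
Lemma crossing0 : X.
Proof.
have [x _|X0] := pickP (@predT X); first exact: x.
have : (0 < #|crossing D|.+2)%N by [].
rewrite -(eqP D_planar) => /card_gt0P => H; exfalso; case: H => A /imsetP[[[x s] o] _ _].
by have := X0 x.
Qed.

Lemma tait_conn : spans (G := G) [set: edge G].
Proof.
have hh x y : connect (joined (G := G) [set: edge G]) (@ehead G x) (@ehead G y).
  apply: (@crossings_ind (fun y => connect (joined (G := G) [set: edge G]) (@ehead G x) (@ehead G
    y)) x) => // z s.
    have [v v1 v2] := share_vertex z s.
    by move/connect_trans; apply; apply: (@connect_heads G _ z (succ s z) v); rewrite ?inE.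
  have [v v1 v2] := share_vertex z s.
  by move/connect_trans; apply; apply: (@connect_heads G _ (succ s z) z v); rewrite ?inE.
have eh (v : vertex G) : exists x, connect (joined (G := G) [set: edge G]) v (@ehead G x).
  have [x xv] := vertex_endpoint v; exists x.
  by apply: (@connect_ends G _ x); rewrite ?inE ?endpoint_head.
move=> u v; have [x ux] := eh u; have [y vy] := eh v.
rewrite connect_joined_sym in vy.
exact: connect_trans (connect_trans ux (hh x y)) vy.
Qed.

Lemma tait_dconn : @spans (dual G) [set: edge G].
Proof.
have hh x y : connect (@joined (dual G) [set: edge G]) (@eleft G x) (@eleft G y).
  apply: (@crossings_ind (fun y => connect (@joined (dual G) [set: edge G]) (@eleft G x) (@eleft G
    y)) x) => // z s.
    have [v v1 v2] := share_face z s.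
    by move/connect_trans; apply; apply: (@connect_heads (dual G) _ z (succ s z) v); rewrite ?inE.
  have [v v1 v2] := share_face z s.
  by move/connect_trans; apply; apply: (@connect_heads (dual G) _ (succ s z) z v); rewrite ?inE.
have eh (v : face G) : exists x, connect (@joined (dual G) [set: edge G]) v (@eleft G x).
  have [x [o ->]] := surj_face v; exists x.
  by apply: (@connect_ends (dual G) _ x); rewrite ?inE ?(@endpoint_head (dual G)) // /endpoint;
    case: o; rewrite eqxx ?orbT.
move=> u v; have [x ux] := eh u; have [y vy] := eh v.
rewrite (@connect_joined_sym (dual G)) in vy.
exact: connect_trans (connect_trans ux (hh x y)) vy.
Qed.

Theorem tait_spherical : spherical G.
Proof. by split; [exact: tait_conn|exact: tait_dconn|exact: tait_euler|exact: tait_orth]. Qed.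

Lemma next_corner_succ d : exists s,
  (next_corner d).1.1 = succ s d.1.1 \/ d.1.1 = succ s (next_corner d).1.1.
Proof.
case: d => [[x s] o]; rewrite /next_corner /rotate /opposite /=.
case: ifP => _; first by exists (~~ s); left.
case E : (arc_in x (~~ s)) => [y s'] /=; exists s'; right.
by have := congr1 (Defs.next D) E; rewrite permKV next_succ => -[].
Qed.

Lemma region_walk (P : dart D -> Prop) d d' :
  (forall e, region e = region d -> P e -> P (next_corner e)) ->
  region d = region d' -> P d -> P d'.
Proof.
move=> H /regionP/iter_findex <- Pd.
suff [] : region (iter (findex (@next_corner D) d d') (@next_corner D) d) = region d /\
  P (iter (findex (@next_corner D) d d') (@next_corner D) d) by [].
elim: (findex _ _ _) => //= n [E IH]; split; first by rewrite region_next.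
exact: H.
Qed.

Lemma endpoint_region (x : edge G) v : endpoint x v -> exists o, val v = region (x, true, o).
Proof. by case/orP => /eqP ->; [exists false|exists true]. Qed.

Lemma region_endpoint (x : edge G) (v : vertex G) o : val v = region (x, true, o) -> endpoint x v.
Proof.
rewrite /endpoint => E; case: o E => E; apply/orP; [right|left]; apply/eqP/val_inj; exact: E.
Qed.

Lemma dendpoint_region (x : edge G) v : @endpoint (dual G) x v ->
  exists o, val v = region (x, false, o).
Proof.
case/orP => /eqP ->; [exists (~~ positive x)|exists (positive x)].
  exact: val_eright.
exact: val_eleft.
Qed.

Lemma region_dendpoint (x : edge G) (v : face G) o :
  val v = region (x, false, o) -> @endpoint (dual G) x v.
Proof.
rewrite /endpoint => E; have [oE|oE] := eqVneq o (positive x).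
  by apply/orP; right; apply/eqP/val_inj; rewrite E val_eleft oE.
apply/orP; left; apply/eqP/val_inj; rewrite E val_eright.
by move: oE; case: o {E}; case: positive.
Qed.

(** Walk along the boundary of the region [v]: consecutive crossings are joined by an arc and share
    a face beside it. *)
Lemma tait_star : star_connected G.
Proof.
move=> v e e' /endpoint_region[o vE] /endpoint_region[o' vE'].
pose A : {set edge (dual G)} := [set x : edge G | endpoint x v].
suff [] : (e', true, o').1.2 /\ connect (@joined (dual G) A) (@eleft G e) (@eleft G (e', true,
  o').1.1) by [].
apply: (@region_walk (fun d => d.1.2 /\ connect (@joined (dual G) A) (@eleft G e) (@eleft G d.1.1))
  (e, true, o) (e', true, o')) => //; last by rewrite -vE.
move=> d dv [ds dc]; split; first by rewrite next_corner_strand.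
apply: connect_trans dc _.
have inA d1 : region d1 = region (e, true, o) -> d1.1.2 -> d1.1.1 \in A.
  case: d1 => [[x s] o1] /= E ss; rewrite inE; apply: (@region_endpoint _ _ o1).
  by rewrite vE -E; move: ss => ->.
have A1 := inA _ dv ds.
have A2 : (next_corner d).1.1 \in A by apply: inA; rewrite ?region_next // next_corner_strand.
have [s [E|E]] := next_corner_succ d.
  have [f f1 f2] := share_face d.1.1 s; rewrite -E in f2.
  exact: (@connect_heads (dual G) _ _ _ f).
have [f f1 f2] := share_face (next_corner d).1.1 s; rewrite -E in f2.
exact: (@connect_heads (dual G) _ _ _ f).
Qed.

Lemma tait_dstar : star_connected (dual G).
Proof.
move=> v e e' /dendpoint_region[o vE] /dendpoint_region[o' vE'].
pose A : {set edge G} := [set x | @endpoint (dual G) x v].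
suff [] : ~~ (e', false, o').1.2 /\ connect (@joined G A) (@ehead G e) (@ehead G (e', false,
  o').1.1) by [].
apply: (@region_walk (fun d => ~~ d.1.2 /\ connect (@joined G A) (@ehead G e) (@ehead G d.1.1))
  (e, false, o) (e', false, o')) => //; last by rewrite -vE.
move=> d dv [ds dc]; split; first by rewrite next_corner_strand.
apply: connect_trans dc _.
have inA d1 : region d1 = region (e, false, o) -> ~~ d1.1.2 -> d1.1.1 \in A.
  case: d1 => [[x s] o1] /= E ss; rewrite inE; apply: (@region_dendpoint _ _ o1).
  by rewrite vE -E; move: ss => /negPf ->.
have A1 := inA _ dv ds.
have A2 : (next_corner d).1.1 \in A by apply: inA; rewrite ?region_next // next_corner_strand.
have [s [E|E]] := next_corner_succ d.
  have [f f1 f2] := share_vertex d.1.1 s; rewrite -E in f2.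
  exact: (@connect_heads G _ _ _ f).
have [f f1 f2] := share_vertex (next_corner d).1.1 s; rewrite -E in f2.
exact: (@connect_heads G _ _ _ f).
Qed.
End TaitDigraph.

(** * Flows and potentials *)

Section Flows.
Variable D : crossing_diagram.
Hypotheses (D_planar : euler_sphere D) (D_connected : crossings_connected D).
Hypothesis D_alt : strands_alternate D.
Local Notation X := (crossing D).
Local Notation G := (tait_of_crossings D).
Local Notation h := (@ehead G).
Local Notation t := (@etail G).
Local Notation l := (@eleft G).
Local Notation r := (@eright G).
Implicit Types (x y : X) (s : bool).

Definition over_in (R : Type) (f : Defs.arc D -> R) x := f (arc_in x true).
Definition under_in (R : Type) (f : Defs.arc D -> R) x := f (arc_in x false).
Definition over_out (R : Type) (f : Defs.arc D -> R) x := f (x, true).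
Definition under_out (R : Type) (f : Defs.arc D -> R) x := f (x, false).

(* The flow across the arcs of a potential on the regions, left minus right. *)
Definition pot_flow (R : zmodType) (a : vertex G -> R) (b : face G -> R) (z : Defs.arc D) : R :=
  if z.2 then a (h z.1) - b (r z.1)
  else if positive z.1 then b (l z.1) - a (h z.1) else b (r z.1) - a (t z.1).

Lemma arc_inE x s : exists2 y, arc_in x s = (y, ~~ s) & succ (~~ s) y = x.
Proof.
case E : (arc_in x s) => [y s']; have := congr1 (Defs.next D) E.
rewrite permKV next_succ // => -[-> ss]; exists y => //.
  by congr pair; rewrite ss negbK.
by rewrite ss negbK.
Qed.

Section Potentials.
Variables (R : zmodType) (a : vertex G -> R) (b : face G -> R).
Local Notation f := (pot_flow a b).

Lemma pot_over_out x : over_out f x = a (h x) - b (r x). Proof. by []. Qed.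

Lemma pot_under_out x : under_out f x =
  if positive x then b (l x) - a (h x) else b (r x) - a (t x).
Proof. by []. Qed.

Lemma pot_over_in x : over_in f x = b (l x) - a (t x).
Proof.
rewrite /over_in; have [y -> <-] := arc_inE x true.
rewrite under_left // under_right // /pot_flow /=.
by case: positive.
Qed.

Lemma pot_under_in x : under_in f x =
  if positive x then a (t x) - b (r x) else a (h x) - b (l x).
Proof.
rewrite /under_in; have [y -> <-] := arc_inE x false.
have -> : f (y, ~~ false) = a (h y) - b (r y) by [].
rewrite (over_left D_alt y) (over_right D_alt y).
by case: positive.
Qed.
End Potentials.

Lemma is_flowP (f : Defs.arc D -> int) : is_flow f <->
  forall x, over_in f x + under_in f x = over_out f x + under_out f x.
Proof.
rewrite /is_flow /left_in /right_in /left_out /right_out /arc_out.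
by split=> H x; move: (H x); rewrite /over_in /under_in /over_out /under_out;
  case: positive => /=; clear; lia.
Qed.

Lemma pot_flow_is_flow (a : vertex G -> int) (b : face G -> int) : is_flow (pot_flow a b).
Proof.
apply/is_flowP => x; rewrite pot_over_in pot_under_in pot_over_out pot_under_out.
by case: positive; ring.
Qed.

(** The 4-valent graph of the diagram. Its faces are the regions, shaded and unshaded, and its
    cycles are the flows. *)
Definition arc_digraph : plane_digraph :=
  @PlaneDigraph X (Defs.arc D : finType) (vertex G + face G)%type
    (fun z => z.1) (fun z => succ z.2 z.1)
    (fun z => if z.2 then inl (h z.1) else inr (if positive z.1 then l z.1 else r z.1))
    (fun z => if z.2 then inr (r z.1) else inl (if positive z.1 then h z.1 else t z.1))
    (fun z => z.2).

Lemma pot_flowE (R : zmodType) (phi : vertex G + face G -> R) :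
  @cobound (dual arc_digraph) R phi =1 pot_flow (phi \o inl) (phi \o inr).
Proof. by case=> x s; rewrite /cobound /pot_flow /=; case: s; case: (positive x). Qed.

Lemma sum_arc (V : nmodType) (F : Defs.arc D -> V) :
  \sum_z F z = \sum_x F (x, true) + \sum_x F (x, false).
Proof.
rewrite -big_split /= (eq_bigr (fun z => F (z.1, z.2))); last by case.
rewrite -(pair_big xpredT xpredT (fun x s => F (x, s))) /=.
by apply: eq_bigr => x _; rewrite big_bool.
Qed.

Lemma sum_arc_in (V : nmodType) (F : Defs.arc D -> X -> V) :
  \sum_z F z (succ z.2 z.1) = \sum_x F (arc_in x true) x + \sum_x F (arc_in x false) x.
Proof.
rewrite sum_arc addrC; congr (_ + _).
  rewrite [RHS](reindex_inj (succ_inj D_alt (s := false))); apply: eq_bigr => x _ /=.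
  by rewrite (arc_in_succ D_alt x false).
rewrite [RHS](reindex_inj (succ_inj D_alt (s := true))); apply: eq_bigr => x _ /=.
by rewrite (arc_in_succ D_alt x true).
Qed.

Lemma arc_orth : cut_cycle_orthogonal arc_digraph.
Proof.
move=> R c phi.
transitivity (\sum_z c (succ z.2 z.1) * pot_flow (phi \o inl) (phi \o inr) z -
              \sum_z c z.1 * pot_flow (phi \o inl) (phi \o inr) z).
  rewrite -sumrB; apply: eq_bigr => z _.
  by rewrite -[dcobound phi z]/(@cobound (dual arc_digraph) R phi z) pot_flowE /cobound mulrBl.
rewrite (sum_arc_in (fun z x => c x * pot_flow (phi \o inl) (phi \o inr) z)) sum_arc /=.
rewrite -!big_split -sumrB big1 // => x _ /=.
have := pot_over_in (phi \o inl) (phi \o inr) x; rewrite /over_in => ->.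
have := pot_under_in (phi \o inl) (phi \o inr) x; rewrite /under_in => ->.
by rewrite /pot_flow /=; case: positive; ring.
Qed.

Lemma arc_spherical : spherical arc_digraph.
Proof.
split; last exact: arc_orth.
- have step x s : connect (joined (G := arc_digraph) [set: Defs.arc D]) x (succ s x).
    by apply: (@joined_edge arc_digraph _ (x, s)); rewrite inE.
  move=> x y.
  apply: (@crossings_ind D D_connected (fun y => connect (joined (G := arc_digraph) [set: Defs.arc
    D]) x y) x) => //.
    by move=> z s /connect_trans; apply.
  by move=> z s /connect_trans; apply; rewrite connect_joined_sym.
- pose C := connect (@joined (dual arc_digraph) [set: Defs.arc D]).
  have Csym u v : C u v = C v u by rewrite /C connect_joined_sym.
  have Ctr v u w : C u v -> C v w -> C u w by apply: connect_trans.
  have Ca (z : Defs.arc D) : C (@eright arc_digraph z) (@eleft arc_digraph z).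
    by apply: (@joined_edge (dual arc_digraph)); rewrite inE.
  have hr x : C (inl (h x)) (inr (r x)) by rewrite Csym; exact: (Ca (x, true)).
  have tl x : C (inl (t x)) (inr (l x)).
    have [y yE <-] := arc_inE x true.
    have : C (inl (if positive y then h y else t y))
             (inr (if positive y then l y else r y)) := Ca (y, false).
    by rewrite under_left // under_right //; case: positive.
  (* The over ends join top to right and bottom to left; the outgoing understrand joins these two
     pairs. *)
  have hl x : C (inl (h x)) (inr (l x)) .
    case E : (positive x); first by have := Ca (x, false); rewrite /= E.
    have rt : C (inr (r x)) (inl (t x)).
      by rewrite Csym; have := Ca (x, false); rewrite /= E.
    exact: (Ctr _ _ _ (hr x) (Ctr _ _ _ rt (tl x))).
  have all_x x (o1 : vertex G + face G) : o1 \in [:: inl (h x); inl (t x); inr (l x); inr (r x)] ->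
      C (inl (h x)) o1.
    rewrite !inE => /or4P[] /eqP -> //; first exact: connect0.
    by apply: (Ctr (inr (l x))) => //; rewrite Csym.
  have xs x s : C (inl (h x)) (inl (h (succ s x))).
    have [v v1 v2] := share_vertex D_alt x s.
    have Hv y : @endpoint G y v -> C (inl (h y)) (inl v).
      by move=> /orP[]/eqP ->; apply: all_x; rewrite !inE eqxx ?orbT.
    by apply: (Ctr (inl v)); rewrite ?Hv // Csym Hv.
  have hh x y : C (inl (h x)) (inl (h y)).
    apply: (@crossings_ind D D_connected (fun y => C (inl (h x)) (inl (h y))) x) => [z s|z s|].
    - by move/Ctr; apply.
    - by move/Ctr; apply; rewrite Csym.
    - exact: connect0.
  have eh (u : vertex G + face G) : exists x, C (inl (h x)) u.
    case: u => [v|f].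
      have [x [o ->]] := surj_vertex v; exists x; apply: all_x.
      by case: o; rewrite !inE eqxx ?orbT.
    have [x [o ->]] := surj_face f; exists x; apply: all_x.
    by case: o; rewrite !inE eqxx ?orbT.
  move=> u v; have [x xu] := eh u; have [y yv] := eh v.
  by apply: (Ctr (inl (h y))) => //; apply: (Ctr (inl (h x))) => //; rewrite Csym.
have := tait_euler D_planar D_alt; rewrite /= card_sum card_prod card_bool.
by move=> /= ->; lia.
Qed.

Theorem flow_potential (f : Defs.arc D -> int) : is_flow f ->
  exists (a : vertex G -> int) (b : face G -> int), f =1 pot_flow a b.
Proof.
move=> /is_flowP ff.
have [c|phi phiE] := @exact_int (dual arc_digraph) (spherical_dual arc_spherical) f; last first.
  by exists (phi \o inl), (phi \o inr) => z; rewrite phiE pot_flowE.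
transitivity (\sum_(z : Defs.arc D) c (succ z.2 z.1) * f z - \sum_(z : Defs.arc D) c z.1 * f z).
  by rewrite -sumrB; apply: eq_bigr => z _; rewrite mulrC /cobound /= mulrBl.
rewrite (sum_arc_in (fun z x => c x * f z)) sum_arc -!big_split -sumrB big1 // => x _ /=.
have := ff x; rewrite /over_in /under_in /over_out /under_out => H.
by rewrite -!mulrDr H subrr.
Qed.

(* [band] up to sign: the flow is counted from the understrand to the overstrand,
   whatever the sign of the crossing. *)
Definition band_over (R : zmodType) (f : Defs.arc D -> R) x : R := over_out f x - under_in f x.

Lemma band_overE (f : Defs.arc D -> int) x : is_flow f ->
  band f x = if positive x then band_over f x else - band_over f x.
Proof.
move=> /is_flowP/(_ x); rewrite /band /band_over /left_in /left_out.
rewrite /over_in /under_in /over_out /under_out /arc_out.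
by case: positive => /=; clear; lia.
Qed.

Lemma band_over_pot (R : zmodType) (a : vertex G -> R) (b : face G -> R) x :
  band_over (pot_flow a b) x = if positive x then a (h x) - a (t x) else b (l x) - b (r x).
Proof.
rewrite /band_over pot_under_in pot_over_out; case: positive.
  by rewrite opprB addrA subrK.
by rewrite opprB addrC -addrA addKr.
Qed.

Lemma seifert_formE (f g : Defs.arc D -> int) : is_flow f ->
  seifert_form f g = \sum_x (if positive x then - (band_over f x * over_in g x)
                             else band_over f x * over_out g x).
Proof.
move=> ff; rewrite /seifert_form -sumrN; apply: eq_bigr => x _; rewrite band_overE //.
rewrite /left_in /left_out /over_in /over_out /arc_out.
by case: positive => //=; rewrite mulNr opprK.
Qed.

(* In linking numbers: [lk(g, f^+) = lk(f, g^-)]. *)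
Lemma seifert_form_transpose (f g : Defs.arc D -> int) : is_flow f -> is_flow g ->
  seifert_form g f = \sum_x (if positive x then - (band_over f x * over_out g x)
                             else band_over f x * over_in g x).
Proof.
move=> ff fg; rewrite seifert_formE //.
have [a [b fE]] := flow_potential ff; have [a' [b' gE]] := flow_potential fg.
have E (f1 f2 : Defs.arc D -> int) : f1 =1 f2 -> [/\ band_over f1 =1 band_over f2,
    over_in f1 =1 over_in f2 & over_out f1 =1 over_out f2].
  by move=> e; split=> x; rewrite /band_over /over_in /over_out /under_in !e.
have [fb fi fo] := E _ _ fE; have [gb gi go] := E _ _ gE.
apply/eqP; rewrite -subr_eq0; apply/eqP; rewrite -sumrB.
(* In terms of potentials, the difference of the two members is the sum of these two corner
   identities, crossing by crossing. *)
have H1 := corner_sum_over D_alt (fun v f => a v * a' v + b f * b' f - a v * b' f).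
have H2 := corner_sum_under D_alt (fun v f => a' v * b f).
move/eqP: H1; rewrite -subr_eq0 -sumrB => /eqP H1.
move/eqP: H2; rewrite -subr_eq0 -sumrB => /eqP H2.
rewrite -[RHS]addr0 -[X in _ = X + _]H1 -[X in _ = _ + X]H2 -big_split.
apply: eq_bigr => x _; rewrite fb gb fi go gi fo !band_over_pot !pot_over_in !pot_over_out.
by case: positive => /=; ring.
Qed.
End Flows.

(** * The Seifert matrix *)

Section TreeOrder.
Variables (G : plane_digraph) (v0 : vertex G).
Hypothesis G_conn : spans [set: edge G].

(* A list of edge-vertex pairs, the most recent first, that grows a tree from [v0]:
   each edge joins its vertex to an older one. *)
Fixpoint grown (s : seq (edge G * vertex G)) : Prop :=
  if s is (x, c) :: s' then
    [/\ grown s', c \notin v0 :: unzip2 s' &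
      exists2 u, u \in v0 :: unzip2 s' &
        (ehead x = c /\ etail x = u) \/ (etail x = c /\ ehead x = u)]
  else True.

Lemma grow s : grown s -> (forall v, v \in v0 :: unzip2 s) \/ exists p, grown (p :: s).
Proof.
move=> gs; have [/forallP all|/forallPn[v vN]] := boolP [forall v, v \in v0 :: unzip2 s].
  by left.
right; pose old v := v \in v0 :: unzip2 s.
have [/existsP[e]|] := boolP [exists e, old (ehead e) != old (etail e)].
  case he : (old (ehead e)); case te : (old (etail e)) => // _.
    exists (e, etail e); split=> //; first by move/negbT: te.
    by exists (ehead e); [exact: he|right].
  exists (e, ehead e); split=> //; first by move/negbT: he.
  by exists (etail e); [exact: te|left].
move=> /existsPn H; have := @joined_const G _ _ old v0 v _ (G_conn v0 v).
rewrite /old (negPf vN) mem_head => H'.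
suff : true = false by []. apply: H' => e _.
by have := H e; rewrite negbK => /eqP.
Qed.

Lemma grown_uniq s : grown s -> uniq (v0 :: unzip2 s).
Proof.
elim: s => [|[x c] s IH] //= [gs cN _]; have /andP[v0s us] := IH gs.
move: cN; rewrite !inE negb_or => /andP[ne cs].
by rewrite negb_or eq_sym ne v0s cs.
Qed.

Lemma grown_all : exists2 s, grown s & forall v, v \in v0 :: unzip2 s.
Proof.
have H n : (exists2 s, grown s & forall v, v \in v0 :: unzip2 s) \/
           exists2 s, grown s & size s = n.
  elim: n => [|n [IH|[s gs ss]]]; [by right; exists [::] | by left |].
  have [all|[p gp]] := grow gs; first by left; exists s.
  by right; exists (p :: s) => //=; rewrite ss.
have [//|[s gs ss]] := H #|vertex G|.
have := max_card (mem (v0 :: unzip2 s)).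
by rewrite (card_uniqP (grown_uniq gs)) /= size_map ss ltnn.
Qed.

Lemma grown_nth p0 s i : grown s -> (i < size s)%N ->
  exists2 u, u \in v0 :: unzip2 (drop i.+1 s) &
    (ehead (nth p0 s i).1 = (nth p0 s i).2 /\ etail (nth p0 s i).1 = u) \/
    (etail (nth p0 s i).1 = (nth p0 s i).2 /\ ehead (nth p0 s i).1 = u).
Proof.
elim: s i => [|[x c] s IH] [|i] //= [gs _ H]; first by rewrite drop0.
by move=> /(IH _ gs).
Qed.

(** Small indices belong to vertices added late: [xs i] joins [cs i] to [v0] or to a vertex of
    larger index, which makes the incidence matrix of the tree triangular. *)
Theorem tree_order : exists (k : nat) (xs : 'I_k -> edge G) (cs : 'I_k -> vertex G),
  [/\ injective cs, forall i, cs i != v0, forall v, v != v0 -> exists i, cs i = v &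
   forall i : 'I_k, exists2 u, forall j : 'I_k, (j <= i)%N -> cs j != u &
     (ehead (xs i) = cs i /\ etail (xs i) = u) \/ (etail (xs i) = cs i /\ ehead (xs i) = u)].
Proof.
have [s gs all] := grown_all; have us := grown_uniq gs.
exists (size s), (fun i => (tnth (in_tuple s) i).1), (fun i => (tnth (in_tuple s) i).2).
have nthE (i : 'I_(size s)) : (tnth (in_tuple s) i).2 = nth v0 (unzip2 s) i.
  by rewrite (tnth_nth (tnth (in_tuple s) i)) (nth_map (tnth (in_tuple s) i)) //.
have /andP[v0N us'] := us.
split.
- move=> i j; rewrite !nthE => /eqP.
  by rewrite nth_uniq ?size_map // => /eqP/val_inj.
- move=> i; rewrite nthE; apply: contraNneq v0N => <-.
  by rewrite mem_nth // size_map.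
- move=> v ne; have := all v; rewrite inE (negPf ne) /= => /(nthP v0)[i].
  by rewrite size_map => lt <-; exists (Ordinal lt); rewrite nthE.
move=> i; have p0 := tnth (in_tuple s) i.
have [u uin H] := grown_nth p0 gs (ltn_ord i).
exists u; last by rewrite (tnth_nth p0).
move=> j ji; rewrite nthE; apply: contraTneq uin => <-.
move: us; rewrite -{1}(cat_take_drop i.+1 s) /unzip2 map_cat -cat_cons cat_uniq.
case/and3P => _ /hasPn H' _; rewrite inE negb_or.
have nj : nth v0 (unzip2 s) j \in unzip2 (take i.+1 s).
  have lt : (j < size (take i.+1 s))%N.
    by rewrite size_take; case: ifP => // _; exact: leq_ltn_trans ji _.
  rewrite /unzip2 (nth_map p0) // -(nth_take p0 (n0 := i.+1)) //.
  by rewrite map_f // mem_nth.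
apply/andP; split.
  by apply: contraNneq v0N => <-; rewrite mem_nth // size_map.
apply/negP => nd; have := H' _ nd.
by rewrite inE negb_or nj andbF.
Qed.
End TreeOrder.

Section Triangular.
Variables (G : plane_digraph) (k : nat) (xs : 'I_k -> edge G) (cs : 'I_k -> vertex G).
Hypothesis cs_inj : injective cs.
Hypothesis xs_order : forall i : 'I_k, exists2 u, forall j : 'I_k, (j <= i)%N -> cs j != u &
  (ehead (xs i) = cs i /\ etail (xs i) = u) \/ (etail (xs i) = cs i /\ ehead (xs i) = u).

Definition end_mx (R : pzRingType) (p q : edge G -> R) : 'M[R]_k :=
  \matrix_(i, j) (p (xs j) * (ehead (xs j) == cs i)%:R - q (xs j) * (etail (xs j) == cs i)%:R).

Lemma det_end_mx (R : comNzRingType) (p q : edge G -> R) :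
  \det (end_mx p q) = \prod_i (if ehead (xs i) == cs i then p (xs i) else - q (xs i)).
Proof.
rewrite det_trig; last first.
  apply/is_trig_mxP => i j ij; rewrite mxE.
  have [u uN H] := xs_order j; have csu := uN i (ltnW ij).
  have csj : cs j != cs i by rewrite (inj_eq cs_inj) -val_eqE /= gtn_eqF.
  by case: H => -[-> ->]; rewrite (negPf csj) eq_sym (negPf csu) !mulr0 subrr.
apply: eq_bigr => i _; rewrite mxE; have [u uN H] := xs_order i; have csu := uN i (leqnn i).
by case: H => -[-> ->]; rewrite eqxx [u == _]eq_sym (negPf csu) mulr1 mulr0 ?subr0 ?sub0r.
Qed.
End Triangular.

(** * Seifert circles and cycles of the Seifert graph *)

Section SeifertCircles.
Variable D : crossing_diagram.
Hypothesis D_connected : crossings_connected D.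
Hypothesis D_alt : strands_alternate D.
Local Notation X := (crossing D).
Implicit Types (x y : X) (s : bool) (z : Defs.arc D).

(* In an alternating diagram smoothing a crossing keeps an arc that leaves a crossing
   as overstrand (understrand) followed by another such arc. *)
Definition arc_succ z : Defs.arc D := (succ z.2 z.1, z.2).

Lemma arc_succ_inj : injective arc_succ.
Proof. by move=> [x s] [y s'] [E ss]; move: E; rewrite /= ss => /(succ_inj D_alt) ->. Qed.

Definition circle := {z : Defs.arc D | froot arc_succ z == z}.

Lemma froot_idem z : froot arc_succ (froot arc_succ z) == froot arc_succ z.
Proof. by rewrite (root_root (fconnect_sym arc_succ_inj)). Qed.

Definition circle_of z : circle := exist _ (froot arc_succ z) (froot_idem z).

Lemma circle_ofP z z' : reflect (circle_of z = circle_of z') (fconnect arc_succ z z').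
Proof.
have sym := fconnect_sym arc_succ_inj.
apply: (iffP idP) => [c|[E]]; last by rewrite -(root_connect sym); apply/eqP.
by apply: val_inj; apply/eqP; rewrite /= root_connect.
Qed.

Lemma circle_of_succ z : circle_of (arc_succ z) = circle_of z.
Proof. by symmetry; apply/circle_ofP; apply: fconnect1. Qed.

Lemma circle_of_val (c : circle) : circle_of (val c) = c.
Proof. by apply: val_inj; apply/eqP/(valP c). Qed.

Definition seifert_digraph : plane_digraph :=
  @PlaneDigraph circle X unit (fun x => circle_of (x, false)) (fun x => circle_of (x, true))
    (fun=> tt) (fun=> tt) (@positive D).

Lemma seifert_conn : @spans seifert_digraph [set: X].
Proof.
pose C := connect (@joined seifert_digraph [set: X]).
have Csym u v : C u v = C v u by rewrite /C connect_joined_sym.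
have Ce x : C (circle_of (x, true)) (circle_of (x, false)).
  by apply: (@joined_edgeV seifert_digraph); rewrite inE.
have Cx x y : C (circle_of (x, true)) (circle_of (y, true)).
  have st w s : C (circle_of (w, true)) (circle_of (succ s w, true)).
    case: s; first by rewrite -[(succ true w, true)]/(arc_succ (w, true)) circle_of_succ;
      exact: connect0.
    apply: connect_trans (Ce w) _.
    rewrite -circle_of_succ -/(C _ _) Csym.
    exact: Ce.
  apply: (@crossings_ind D D_connected (fun y => C (circle_of (x, true)) (circle_of (y, true))) x).
  - by move=> z s /connect_trans; apply.
  - by move=> z s /connect_trans; apply; rewrite -/(C _ _) Csym.
  - exact: connect0.
have ex (c : circle) : exists x, C c (circle_of (x, true)).
  rewrite -[c]circle_of_val; case: (val c) => x [|]; exists x; first exact: connect0.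
  by rewrite Csym.
move=> u v; have [x ux] := ex u; have [y vy] := ex v.
rewrite Csym in vy.
exact: connect_trans (connect_trans ux (Cx x y)) vy.
Qed.

Section CircleFlows.
Variables (R : zmodType) (g : circle -> R).
Local Notation f := (fun z => g (circle_of z)).

Lemma circle_over_in x : over_in f x = g (circle_of (x, false)).
Proof.
rewrite /over_in; have [y -> <-] := arc_inE D_alt x true.
by rewrite -[(succ _ y, false)]/(arc_succ (y, false)) circle_of_succ.
Qed.

Lemma circle_under_in x : under_in f x = g (circle_of (x, true)).
Proof.
rewrite /under_in; have [y -> <-] := arc_inE D_alt x false.
by rewrite -[(succ _ y, true)]/(arc_succ (y, true)) circle_of_succ.
Qed.

Lemma circle_band x : band_over f x = 0.
Proof. by rewrite /band_over circle_under_in subrr. Qed.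
End CircleFlows.

Lemma circle_is_flow (g : circle -> int) : is_flow (fun z => g (circle_of z)).
Proof.
apply/is_flowP => x.
by rewrite (circle_over_in g) (circle_under_in g) /over_out /under_out addrC.
Qed.

Lemma band0_circle (f : Defs.arc D -> int) : is_flow f -> (forall x, band_over f x = 0) ->
  exists g : circle -> int, forall z, f z = g (circle_of z).
Proof.
move=> /is_flowP ff b0.
have fs z : f (arc_succ z) = f z.
  case: z => y []; rewrite /arc_succ /=.
    have := b0 (succ true y); rewrite /band_over /over_out /under_in.
    by have := arc_in_succ D_alt y true => /= -> /eqP; rewrite subr_eq0 => /eqP.
  have := b0 (succ false y); have := ff (succ false y).
  rewrite /band_over /over_out /over_in /under_out /under_in.
  have := arc_in_succ D_alt y false => /= -> E /eqP; rewrite subr_eq0 => /eqP E'.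
  by move: E; rewrite E' addrC => /addrI.
have fi n z : f (iter n arc_succ z) = f z by elim: n => //= n <-; rewrite fs.
exists (fun c => f (val c)) => z /=.
by rewrite -(iter_findex (connect_root _ z)) fi.
Qed.

Lemma sum_succ (V : nmodType) (F : X -> V) s : \sum_x F (succ s x) = \sum_x F x.
Proof. by rewrite [RHS](reindex_inj (@succ_inj D D_alt s)). Qed.

(** The jumps of a flow around a Seifert circle sum to zero, so its band crossings form a cycle of
    the Seifert graph. *)
Lemma band_closed (f : Defs.arc D -> int) (g : circle -> int) : is_flow f ->
  \sum_x band_over f x * @cobound seifert_digraph _ g x = 0.
Proof.
move=> /is_flowP ff.
transitivity ((\sum_x over_out f x * g (circle_of (x, true)) - \sum_x under_in f x * g (circle_of
  (x, true)))
  + (\sum_x under_out f x * g (circle_of (x, false)) - \sum_x over_in f x * g (circle_of (x,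
    false)))).
  rewrite -!sumrB -big_split; apply: eq_bigr => x _ /=; have := ff x.
  rewrite /band_over /cobound /= => /eqP; rewrite -subr_eq => /eqP H.
  by rewrite -[under_out f x](addKr (over_out f x)) -H; ring.
have tr : \sum_x under_in f x * g (circle_of (x, true)) = \sum_x over_out f x * g (circle_of (x,
  true)).
  rewrite -(sum_succ _ true); apply: eq_bigr => x _.
  rewrite /under_in -[(succ _ x, true)]/(arc_succ (x, true)) circle_of_succ.
  by have := arc_in_succ D_alt x true => /= ->.
have fa : \sum_x over_in f x * g (circle_of (x, false)) = \sum_x under_out f x * g (circle_of (x,
  false)).
  rewrite -(sum_succ _ false); apply: eq_bigr => x _.
  rewrite /over_in -[(succ _ x, false)]/(arc_succ (x, false)) circle_of_succ.
  by have := arc_in_succ D_alt x false => /= ->.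
by rewrite tr fa !subrr.
Qed.

(** Conversely, integrate the prescribed jumps around each Seifert circle from a base arc; the cycle
    condition at that circle makes the result close up. *)
Lemma band_realize (be : X -> int) :
  (forall g : circle -> int, \sum_x be x * @cobound seifert_digraph _ g x = 0) ->
  exists2 f : Defs.arc D -> int, is_flow f & band_over f =1 be.
Proof.
move=> closed; pose inc z := if z.2 then be z.1 else - be z.1.
pose f z : int := \sum_(j < findex arc_succ (froot arc_succ z) z)
   inc (iter j.+1 arc_succ (froot arc_succ z)).
have tot z : \sum_(j < fingraph.order arc_succ z) inc (iter j.+1 arc_succ z) = 0.
  transitivity (\sum_(z' | fconnect arc_succ z z') inc (arc_succ z')).
    transitivity (\sum_(z' <- fingraph.orbit arc_succ z) inc (arc_succ z')).
      rewrite (big_nth z) fingraph.size_orbit big_mkord; apply: eq_bigr => j _.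
      by rewrite /fingraph.orbit nth_traject.
    rewrite big_uniq ?fingraph.orbit_uniq //; apply: eq_bigl => z'.
    by rewrite fconnect_orbit.
  transitivity (\sum_(z' | circle_of z' == circle_of z) inc z').
    rewrite [RHS](reindex_inj arc_succ_inj); apply: eq_bigl => z'.
    rewrite circle_of_succ eq_sym; apply/idP/eqP => /circle_ofP //.
  rewrite -[RHS](closed (fun c => (c == circle_of z)%:R)) big_mkcond.
  rewrite sum_arc -big_split; apply: eq_bigr => x _ /=.
  by rewrite /cobound /= /inc /=; case: eqP; case: eqP => _ _ /=; ring.
have fS z : f (arc_succ z) - f z = inc (arc_succ z).
  have rS : froot arc_succ (arc_succ z) = froot arc_succ z.
    by have [] := circle_of_succ z.
  rewrite /f rS; set z0 := froot arc_succ z.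
  have z0z : fconnect arc_succ z0 z.
    by rewrite fconnect_sym ?connect_root //; exact: arc_succ_inj.
  have := iter_findex z0z; have := findex_max z0z; set i := findex arc_succ z0 z => lt zE.
  have zE' : arc_succ z = iter i.+1 arc_succ z0 by rewrite iterS zE.
  have [lt'|ge] := ltnP i.+1 (fingraph.order arc_succ z0).
    have -> : findex arc_succ z0 (arc_succ z) = i.+1 by rewrite zE' findex_iter.
    by rewrite big_ord_recr /= [_ + inc _]addrC addrK zE.
  (* The last arc of the circle, after which the sum restarts at the base arc. *)
  have iE : i.+1 = fingraph.order arc_succ z0 by apply/anti_leq; rewrite lt ge.
  have zz : arc_succ z = z0 by rewrite zE' iE (iter_order arc_succ_inj).
  rewrite zz findex0 big_ord0 sub0r; have := tot z0.
  by rewrite -iE big_ord_recr /= zE zz => /eqP; rewrite addr_eq0 => /eqP ->; rewrite opprK.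
have fb x : over_out f x - under_in f x = be x.
  rewrite /over_out /under_in; have [y -> <-] := arc_inE D_alt x false.
  exact: (fS (y, true)).
have fb' x : under_out f x - over_in f x = - be x.
  rewrite /under_out /over_in; have [y -> <-] := arc_inE D_alt x true.
  exact: (fS (y, false)).
exists f => [|x]; last exact: fb.
by apply/is_flowP => x; move: (fb x) (fb' x); clear; lia.
Qed.
End SeifertCircles.

Lemma split_lshift m n (i : 'I_m) : split (lshift n i) = inl i.
Proof. exact: (unsplitK (inl i)). Qed.

Lemma split_rshift m n (i : 'I_n) : split (rshift m i) = inr i.
Proof. exact: (unsplitK (inr i)). Qed.

(** * Completing a homology basis by the edges of a tree *)

Section SeifertDeterminant.
Variable D : crossing_diagram.
Hypothesis D_alt : strands_alternate D.
Local Notation X := (crossing D).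
Local Notation G := (tait_of_crossings D).
Local Notation SG := (seifert_digraph D_alt).
Local Notation circle := (circle D).
Implicit Types (x y : X) (z : Defs.arc D).

Section HomologyMatrix.
Variables (m : nat) (b : 'I_m -> Defs.arc D -> int).
Hypothesis b_basis : homology_basis b.
Variables (c0 : circle) (k : nat) (xs : 'I_k -> X) (cs : 'I_k -> circle).
Hypothesis cs_inj : injective cs.
Hypothesis cs_surj : forall c, c != c0 -> exists i, cs i = c.
Hypothesis xs_order : forall i : 'I_k, exists2 u, forall j : 'I_k, (j <= i)%N -> cs j != u &
  (@ehead SG (xs i) = cs i /\ @etail SG (xs i) = u)
  \/ (@etail SG (xs i) = cs i /\ @ehead SG (xs i) = u).

Lemma end_mx_unit : @end_mx SG k xs cs int (fun=> 1) (fun=> 1) \in unitmx.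
Proof.
rewrite unitmxE (@det_end_mx SG k xs cs cs_inj xs_order).
by apply: rpred_prod => i _; case: ifP; rewrite ?unitrN unitr1.
Qed.

Lemma band_over_sum (I : finType) (z : I -> int) (f : I -> Defs.arc D -> int) x :
  band_over (fun a => \sum_i z i * f i a) x = \sum_i z i * band_over (f i) x.
Proof.
rewrite /band_over /over_out /under_in -sumrB.
by apply: eq_bigr => i _; rewrite mulrBr.
Qed.

Lemma is_flow_sum (I : finType) (z : I -> int) (f : I -> Defs.arc D -> int) :
  (forall i, is_flow (f i)) -> is_flow (fun a => \sum_i z i * f i a).
Proof.
move=> ff; apply/is_flowP => x; rewrite /over_in /under_in /over_out /under_out -!big_split.
apply: eq_bigr => i _ /=; rewrite -!mulrDr; congr (_ * _).
by have /is_flowP/(_ x) := ff i.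
Qed.

Lemma is_flowB (f g : Defs.arc D -> int) : is_flow f -> is_flow g -> is_flow (fun a => f a - g a).
Proof.
move=> /is_flowP ff /is_flowP fg; apply/is_flowP => x; move: (ff x) (fg x).
by rewrite /over_in /under_in /over_out /under_out; clear; lia.
Qed.

Lemma band_overB (f g : Defs.arc D -> int) x :
  band_over (fun a => f a - g a) x = band_over f x - band_over g x.
Proof. by rewrite /band_over /over_out /under_in; ring. Qed.

Lemma homology_coord (f : Defs.arc D -> int) : is_flow f ->
  exists z : 'I_m -> int, forall x, band_over f x = \sum_i z i * band_over (b i) x.
Proof.
move=> ff; have [z [zE _]] := b_basis.2 f ff; exists (z 0) => x.
have := zE x; rewrite band_overE //.
under eq_bigr => i _ do rewrite (band_overE x (b_basis.1 i)).
case: (positive x) => // H; apply: oppr_inj; rewrite H -sumrN.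
by apply: eq_bigr => i _; rewrite mulrN.
Qed.

Lemma homology_free (z : 'I_m -> int) :
  (forall x, \sum_i z i * band_over (b i) x = 0) -> forall i, z i = 0.
Proof.
move=> z0; have f0 : is_flow (fun _ : Defs.arc D => 0 : int) by apply/is_flowP.
have [w [_ wU]] := b_basis.2 _ f0.
have b0 x : band (fun _ : Defs.arc D => 0 : int) x = 0 by rewrite /band subrr.
have E1 : w = 0.
  apply: wU => x; rewrite b0 big1 // => i _.
  by rewrite mxE mul0r.
have E2 : w = \row_i z i.
  apply: wU => x; rewrite b0.
  under eq_bigr => i _ do rewrite mxE (band_overE x (b_basis.1 i)).
  case: (positive x); first by rewrite z0.
  under eq_bigr => i _ do rewrite mulrN.
  by rewrite sumrN z0 oppr0.
by move=> i; have /rowP/(_ i) := etrans (esym E1) E2; rewrite !mxE.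
Qed.

Definition band_rows (i : 'I_(m + k)) x : int :=
  match split i with inl i => band_over (b i) x | inr j => (xs j == x)%:R end.

Lemma band_rows_sum (v : 'I_(m + k) -> int) x : \sum_i v i * band_rows i x =
  \sum_i v (lshift k i) * band_over (b i) x + \sum_j v (rshift m j) * (xs j == x)%:R.
Proof.
by rewrite big_split_ord /=; congr (_ + _); apply: eq_bigr => i _;
  rewrite /band_rows ?split_lshift ?split_rshift.
Qed.

Lemma tree_boundary (w : 'I_k -> int) i :
  \sum_x (\sum_j w j * (xs j == x)%:R) * @cobound SG _ (fun c => (c == cs i)%:R) x =
  \sum_j @end_mx SG k xs cs int (fun=> 1) (fun=> 1) i j * w j.
Proof.
under eq_bigr => x _ do rewrite mulr_suml.
rewrite exchange_big /=; apply: eq_bigr => j _.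
rewrite (bigD1 (xs j)) //= eqxx mulr1 big1 ?addr0 => [|x ne].
  by rewrite mxE !mul1r mulrC.
by rewrite eq_sym (negPf ne) mulr0 mul0r.
Qed.

(** The tree edges absorb the boundary of [y]; what remains is a cycle of the Seifert graph, hence
    the band crossings of a flow and a combination of the basis. *)
Lemma band_rows_span y : exists v : 'I_(m + k) -> int,
  forall x, \sum_i v i * band_rows i x = (y == x)%:R.
Proof.
pose rhs : 'cV[int]_k := \col_i @cobound SG _ (fun c => (c == cs i)%:R) y.
pose w := invmx (@end_mx SG k xs cs int (fun=> 1) (fun=> 1)) *m rhs.
have wE i : \sum_j @end_mx SG k xs cs int (fun=> 1) (fun=> 1) i j * w j 0 =
    @cobound SG _ (fun c => (c == cs i)%:R) y.
  have /colP/(_ i) := mulKVmx end_mx_unit rhs; rewrite !mxE => <-.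
  by apply: eq_bigr => j _; rewrite mxE.
pose u x : int := (y == x)%:R - \sum_j w j 0 * (xs j == x)%:R.
pose bd c := \sum_x u x * @cobound SG _ (fun c' => (c' == c)%:R) x.
have bd_cs i : bd (cs i) = 0.
  rewrite /bd /u; under eq_bigr => x _ do rewrite mulrBl.
  rewrite sumrB tree_boundary wE (bigD1 y) //= eqxx mul1r big1 ?addr0 ?subrr // => x.
  by rewrite eq_sym => /negPf ->; rewrite mul0r.
have one (c : circle) : \sum_c' (c == c')%:R = 1 :> int.
  by rewrite -[RHS](@sum_pick int circle (fun=> 1) c); apply: eq_bigr => ? _; rewrite mul1r.
have bd_sum : \sum_c bd c = 0.
  rewrite /bd exchange_big big1 // => x _; rewrite -mulr_sumr /cobound sumrB.
  by rewrite !one subrr mulr0.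
have bd0 c : bd c = 0.
  have [->|ne] := eqVneq c c0; last by have [i <-] := cs_surj ne; apply: bd_cs.
  move: bd_sum; rewrite (bigD1 c0) //= big1 ?addr0 // => c' /cs_surj[i <-].
  exact: bd_cs.
have [g|f ff fE] := @band_realize D D_alt u.
  transitivity (\sum_c g c * bd c); last by apply: big1 => c _; rewrite bd0 mulr0.
  rewrite /bd; under [RHS]eq_bigr => c _ do rewrite mulr_sumr.
  rewrite exchange_big /=; apply: eq_bigr => x _.
  under eq_bigr => c _ do rewrite mulrCA mulrBr.
  by rewrite -mulr_sumr sumrB !sum_pick.
have [z zE] := homology_coord ff.
exists (fun i => match split i with inl i => z i | inr j => w j 0 end) => x.
rewrite band_rows_sum.
have -> : \sum_i match split (lshift k i) with inl i0 => z i0 | inr j => w j 0 end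
    * band_over (b i) x = \sum_i z i * band_over (b i) x.
  by apply: eq_bigr => i _; rewrite split_lshift.
have -> : \sum_j match split (rshift m j) with inl i0 => z i0 | inr j => w j 0 end
    * (xs j == x)%:R = \sum_j w j 0 * (xs j == x)%:R.
  by apply: eq_bigr => i _; rewrite split_rshift.
by rewrite -zE fE /u subrK.
Qed.

(** Taking boundaries kills the basis part and leaves an invertible system for the coefficients of
    the tree edges. *)
Lemma band_rows_free (v : 'I_(m + k) -> int) :
  (forall x, \sum_i v i * band_rows i x = 0) -> forall i, v i = 0.
Proof.
move=> v0; pose w : 'cV[int]_k := \col_j v (rshift m j).
pose f a := \sum_i - v (lshift k i) * b i a.
have ff : is_flow f by apply: is_flow_sum; apply: b_basis.1.
have fE x : band_over f x = \sum_j w j 0 * (xs j == x)%:R.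
  rewrite band_over_sum; apply/eqP; rewrite -subr_eq0 -oppr_eq0 opprB.
  rewrite -[X in _ == X](v0 x) band_rows_sum addrC; apply/eqP; congr (_ + _).
    by rewrite -sumrN; apply: eq_bigr => i _; rewrite mulNr opprK.
  by apply: eq_bigr => j _; rewrite mxE.
have w0 : w = 0.
  rewrite -[w](mulKmx end_mx_unit); set A := end_mx _ _ _ _.
  suff -> : A *m w = 0 by rewrite mulmx0.
  apply/colP => i; rewrite !mxE -tree_boundary.
  rewrite -[RHS](band_closed D_alt (fun c => (c == cs i)%:R) ff).
  by apply: eq_bigr => x _; rewrite fE.
have vr j : v (rshift m j) = 0 by have /colP/(_ j) := w0; rewrite !mxE.
have vl : forall i, v (lshift k i) = 0.
  apply: homology_free => x; rewrite -[RHS](v0 x) band_rows_sum.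
  by rewrite [X in _ = _ + X]big1 ?addr0 // => j _; rewrite vr mul0r.
by move=> i; case: (split_ordP i) => j ->.
Qed.

Definition band_rows_mx n (xi : 'I_n -> X) : 'M[int]_(m + k, n) :=
  \matrix_(i, j) band_rows i (xi j).

(** Spanning gives a left inverse; freeness makes it two-sided before [m + k] is known to be the
    number of crossings. *)
Lemma band_rows_inv n (xi : 'I_n -> X) : bijective xi ->
  exists2 Q', Q' *m band_rows_mx xi = 1%:M & band_rows_mx xi *m Q' = 1%:M.
Proof.
move=> xb; have [v vE] := fin_all_exists band_rows_span.
pose Q' : 'M[int]_(n, m + k) := \matrix_(j, i) v (xi j) i.
have E : Q' *m band_rows_mx xi = 1%:M.
  apply/matrixP => j j'; rewrite !mxE -(inj_eq (bij_inj xb)) -[RHS]vE.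
  by apply: eq_bigr => i _; rewrite !mxE.
exists Q' => //; apply/eqP; rewrite -subr_eq0; apply/eqP/matrixP => i j; rewrite [RHS]mxE.
pose N := band_rows_mx xi *m Q' - 1%:M; rewrite -/N.
have NQ : N *m band_rows_mx xi = 0 by rewrite mulmxBl -mulmxA E mulmx1 mul1mx subrr.
clearbody N; apply: (@band_rows_free (N i)) => x; case: xb => xi' _ xiK; rewrite -[x]xiK.
have /matrixP/(_ i (xi' x)) := NQ; rewrite !mxE => H; rewrite -[RHS]H.
by apply: eq_bigr => i' _; rewrite [X in _ = _ * X]mxE.
Qed.

Lemma card_crossings : (m + k)%N = #|X|.
Proof.
have [Q' E1 E2] := band_rows_inv (enum_val_bij X).
by apply/anti_leq; rewrite (mulmx1_min E1) (mulmx1_min E2).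
Qed.
End HomologyMatrix.
End SeifertDeterminant.

Lemma common_edge (D : crossing_diagram) (q : face (tait_of_crossings D))
    (r : vertex (tait_of_crossings D)) : adjacent q r ->
  exists2 e : edge (tait_of_crossings D),
    endpoint e r & @endpoint (dual (tait_of_crossings D)) e q.
Proof.
case/orP=> [/existsP[x /andP[xr xq]]|/forallP H].
  by exists x; [exact: xr|rewrite /endpoint orbC; exact: xq].
by have [x xr] := vertex_endpoint r; have := H x; rewrite xr.
Qed.

Lemma other_regions (D : crossing_diagram) (q : face (tait_of_crossings D))
    (r : vertex (tait_of_crossings D)) n :
  euler_sphere D -> strands_alternate D -> n = #|crossing D| ->
  exists rho : 'I_n -> vertex (tait_of_crossings D) + face (tait_of_crossings D),
    [/\ injective rho, forall j, rho j != inl r & forall j, rho j != inr q].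
Proof.
move=> D_planar D_alt nX.
pose Z := ~: [set inl r; inr q : (vertex (tait_of_crossings D) + face (tait_of_crossings D))%type].
have nZ : n = #|Z|.
  have := cardsC [set inl r;
    inr q : (vertex (tait_of_crossings D) + face (tait_of_crossings D))%type].
  rewrite -/Z cards2 card_sum (tait_euler D_planar D_alt) nX /=.
  by move: #|crossing D| #|Z|; clear; lia.
pose rho (j : 'I_n) := enum_val (cast_ord nZ j).
have H j : (rho j != inl r) && (rho j != inr q).
  by have := enum_valP (cast_ord nZ j); rewrite in_setC in_set2 negb_or.
have rho_inj : injective rho by move=> i j /enum_val_inj/cast_ord_inj.
have [rho_r rho_q] : (forall j, rho j != inl r) /\ (forall j, rho j != inr q).
  by split=> j; case/andP: (H j).
exists rho; exact: And3 rho_inj rho_r rho_q.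
Qed.

(** * Potentials vanishing at the root and at the base face *)

Section NormalizedPotentials.
Variable D : crossing_diagram.
Hypotheses (D_planar : euler_sphere D) (D_connected : crossings_connected D).
Hypothesis D_alt : strands_alternate D.
Local Notation X := (crossing D).
Local Notation G := (tait_of_crossings D).
Local Notation reg := (vertex G + face G)%type.
Local Notation pf phi := (pot_flow (fun v => phi (inl v)) (fun f => phi (inr f))).
Implicit Types (x y : X) (z : Defs.arc D).

(** The arc [z] has [r0] on one side and [q0] on the other, expressed through flows. *)
Definition separates (r0 : vertex G) (q0 : face G) z :=
  forall a b, (pot_flow a b z == 0 :> int) = (a r0 == b q0).

Lemma adjacent_arc r0 q0 : adjacent q0 r0 -> exists z, separates r0 q0 z.
Proof.
have E (u v : int) : (u - v == 0) = (u == v) by rewrite subr_eq0.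
case/orP => [|/forallP H]; last by have [x xr] := vertex_endpoint r0; have := H x; rewrite xr.
case/existsP => x /andP[/orP[]/eqP -> /orP[]/eqP ->].
- by exists (arc_in x true) => a b; rewrite -/(over_in _ x) pot_over_in // E eq_sym.
- case px : (positive x).
    by exists (arc_in x false) => a b; rewrite -/(under_in _ x) pot_under_in // px E.
  by exists (x, false) => a b; rewrite -/(under_out _ x) pot_under_out px E eq_sym.
- case px : (positive x).
    by exists (x, false) => a b; rewrite -/(under_out _ x) pot_under_out px E eq_sym.
  by exists (arc_in x false) => a b; rewrite -/(under_in _ x) pot_under_in // px E.
- by exists (x, true) => a b; rewrite -/(over_out _ x) pot_over_out E.
Qed.

Lemma pot_flow0 (phi : reg -> int) : (forall z, pf phi z = 0) -> forall u v, phi u = phi v.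
Proof.
move=> H u v.
have [_ dc _ _] := arc_spherical D_planar D_connected D_alt.
apply: (@joined_const (dual (arc_digraph D)) [set: Defs.arc D] _ phi u v); last exact: dc.
move=> z _; apply/eqP; rewrite -subr_eq0.
by have := pot_flowE phi z; rewrite /cobound => ->; rewrite -[X in _ == X](H z).
Qed.

Variables (r0 : vertex G) (q0 : face G) (a0 : Defs.arc D).
Hypothesis a0_sep : separates r0 q0 a0.

Definition vanishes (R : zmodType) (phi : reg -> R) := (phi (inl r0) = 0) /\ (phi (inr q0) = 0).

Lemma flow_potential0 (f : Defs.arc D -> int) : is_flow f -> f a0 = 0 ->
  exists2 phi : reg -> int, vanishes phi & forall z, f z = pf phi z.
Proof.
move=> ff f0; have [a [b fE]] := flow_potential D_planar D_connected D_alt ff.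
have /eqP ab : a r0 == b q0 by rewrite -a0_sep -fE f0.
exists (fun u : reg => match u with inl v => a v - a r0 | inr g => b g - b q0 end).
  by rewrite /vanishes !subrr.
move=> z; rewrite fE /pot_flow ab; case: z.2; first by ring.
by case: (positive z.1); ring.
Qed.

Lemma vanishing_unique (phi psi : reg -> int) : vanishes phi -> vanishes psi ->
  (forall z, pf phi z = pf psi z) -> phi =1 psi.
Proof.
move=> [p1 p2] [p3 p4] H u; apply/eqP; rewrite -subr_eq0; apply/eqP.
rewrite (@pot_flow0 (fun w => phi w - psi w) _ u (inl r0)) ?p1 ?p3 ?subrr // => z.
have := H z; rewrite /pot_flow; case: z.2 => /=; last case: (positive z.1) => /=.
all: by clear; lia.
Qed.

Section Columns.
Variables (n : nat) (rho : 'I_n -> reg).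
Hypotheses (rho_inj : injective rho).
Hypotheses (rho_r : forall j, rho j != inl r0) (rho_q : forall j, rho j != inr q0).
Hypothesis n_card : n = #|X|.

Lemma rho_surj (z : reg) : z != inl r0 -> z != inr q0 -> exists j, rho j = z.
Proof.
move=> zr zq; have : z \in rho @: [set: 'I_n]; last by case/imsetP => e _ ->; exists e.
suff E : rho @: [set: 'I_n] == ~: [set inl r0; inr q0].
  by rewrite (eqP E) !inE negb_or zr zq.
rewrite eqEcard; apply/andP; split.
  apply/subsetP => _ /imsetP[e _ ->]; rewrite !inE negb_or.
  by rewrite rho_r rho_q.
rewrite card_imset // cardsT card_ord n_card.
have := cardsC [set inl r0; inr q0 : reg].
rewrite cards2 card_sum (tait_euler D_planar D_alt) /=.
by move: #|crossing D| (#|pred_of_set _|); clear; lia.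
Qed.

Lemma pot_expand (R : comNzRingType) (phi : reg -> R) u : vanishes phi ->
  \sum_j phi (rho j) * (rho j == u)%:R = phi u.
Proof.
move=> [p1 p2]; have [->|ur] := eqVneq u (inl r0).
  by rewrite p1 big1 // => j _; rewrite (negPf (rho_r j)) mulr0.
have [->|uq] := eqVneq u (inr q0).
  by rewrite p2 big1 // => j _; rewrite (negPf (rho_q j)) mulr0.
have [j <-] := rho_surj ur uq.
rewrite (bigD1 j) //= eqxx mulr1 big1 ?addr0 // => i ne.
by rewrite (inj_eq rho_inj) (negPf ne) mulr0.
Qed.

(** The indicator of a column region has a flow vanishing on [a0], hence a combination of the [F i].
    Uniqueness of normalized potentials turns these combinations into an inverse matrix. *)
Lemma potential_matrix (F : 'I_n -> Defs.arc D -> int) :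
  (forall i, is_flow (F i)) -> (forall i, F i a0 = 0) ->
  (forall g, is_flow g -> g a0 = 0 -> exists v : 'I_n -> int, forall z, g z = \sum_i v i * F i z) ->
  exists2 phi : 'I_n -> reg -> int,
    (\matrix_(i, j) phi i (rho j)) \in unitmx &
    forall i, vanishes (phi i) /\ forall z, F i z = pf (phi i) z.
Proof.
move=> Ff F0 Fspan.
have [phi phiE] : exists phi : 'I_n -> reg -> int,
    forall i, vanishes (phi i) /\ forall z, F i z = pf (phi i) z.
  apply: (fin_all_exists (P := fun i (p : reg -> int) => vanishes p /\ forall z, F i z = pf p z))
    => i.
  by have [p p1 p2] := flow_potential0 (Ff i) (F0 i); exists p.
exists phi => //; set Psi := \matrix_(i, j) _.
have ex j : exists v : 'I_n -> int, forall z, pf (fun u => (rho j == u)%:R : int) z = \sum_i v i *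
  F i z.
  apply: Fspan; first exact: pot_flow_is_flow.
  by apply/eqP; rewrite a0_sep (negPf (rho_r j)) (negPf (rho_q j)).
have [v vE] := fin_all_exists ex.
suff : (\matrix_(j, i) v j i) *m Psi = 1%:M by case/mulmx1_unit.
apply/matrixP => j j'; rewrite !mxE.
transitivity (\sum_i v j i * phi i (rho j')).
  by apply: eq_bigr => i _; rewrite !mxE.
rewrite -(inj_eq rho_inj).
apply: (@vanishing_unique (fun u => \sum_i v j i * phi i u) (fun u => (rho j == u)%:R)).
- by split; rewrite big1 // => i _; have [[p1 p2] _] := phiE i; rewrite ?p1 ?p2 mulr0.
- by split; rewrite ?(negPf (rho_r j)) ?(negPf (rho_q j)).
move=> z; rewrite vE; transitivity (\sum_i v j i * pf (phi i) z); last first.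
  by apply: eq_bigr => i _; have [_ ->] := phiE i.
rewrite /pot_flow; case: z.2 => /=.
  by rewrite -sumrB; apply: eq_bigr => i _; ring.
by case: (positive z.1); rewrite -sumrB; apply: eq_bigr => i _; ring.
Qed.
End Columns.
End NormalizedPotentials.

(** Sign and exponent must not depend on [s], since the determinants at [s] and [s^-1] are compared
    later. *)
Definition is_monomial (K : fieldType) (f : K -> K) :=
  exists (e : bool) (j : int), forall s, s != 0 -> f s = (-1) ^+ e * s ^ j.

Section Monomials.
Variable K : fieldType.
Implicit Types f g : K -> K.

Lemma monomial_eq f g : (forall s, s != 0 -> f s = g s) -> is_monomial g -> is_monomial f.
Proof. by move=> E [e [j H]]; exists e, j => s s0; rewrite E // H. Qed.

Lemma monomial_sign (e : bool) : is_monomial (fun=> (-1) ^+ e : K).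
Proof. by exists e, 0 => s _; rewrite expr0z mulr1. Qed.

Lemma monomial1 : is_monomial (fun=> 1 : K).
Proof. by apply: monomial_eq (monomial_sign false) => s _; rewrite expr0. Qed.

Lemma monomial_id : is_monomial (fun s : K => s).
Proof. by exists false, 1 => s _; rewrite expr0 mul1r expr1z. Qed.

Lemma monomialM f g : is_monomial f -> is_monomial g -> is_monomial (fun s => f s * g s).
Proof.
move=> [e [j fE]] [e' [j' gE]]; exists (e (+) e'), (j + j') => s s0.
by rewrite fE // gE // mulrACA -signr_addb expfzDr.
Qed.

Lemma monomialN f : is_monomial f -> is_monomial (fun s => - f s).
Proof.
move=> H; apply: monomial_eq (monomialM (monomial_sign true) H) => s _.
by rewrite expr1 mulN1r.
Qed.

Lemma monomialV f : is_monomial f -> is_monomial (fun s => (f s)^-1).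
Proof.
move=> [e [j fE]]; exists e, (- j) => s s0.
by rewrite fE // invfM invr_sign invr_expz.
Qed.

Lemma monomialZ f (z : int) : is_monomial f -> is_monomial (fun s => f s ^ z).
Proof.
have X g n : is_monomial g -> is_monomial (fun s => g s ^+ n).
  move=> H; elim: n => [|n IH]; first by apply: monomial_eq monomial1 => s _; rewrite expr0.
  by apply: monomial_eq (monomialM H IH) => s _; rewrite exprS.
move=> H; case: z => n; first by apply: monomial_eq (X f n H) => s _.
by apply: monomial_eq (monomialV (X f n.+1 H)) => s _; rewrite NegzE -exprnN.
Qed.

Lemma monomial_if (b : bool) f g :
  is_monomial f -> is_monomial g -> is_monomial (fun s => if b then f s else g s).
Proof. by case: b. Qed.

Lemma monomial_prod (I : finType) (f : I -> K -> K) :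
  (forall i, is_monomial (f i)) -> is_monomial (fun s => \prod_i f i s).
Proof.
move=> H; suff G r : is_monomial (fun s => \prod_(i <- r) f i s) by apply: G.
elim: r => [|i r IH]; first by apply: monomial_eq monomial1 => s _; rewrite big_nil.
by apply: monomial_eq (monomialM (H i) IH) => s _; rewrite big_cons.
Qed.

Lemma monomial_neq0 f s : is_monomial f -> s != 0 -> f s != 0.
Proof.
move=> [e [j fE]] s0; rewrite fE // mulf_neq0 ?signr_eq0 //.
by rewrite expfz_neq0.
Qed.
End Monomials.

Lemma monomial_intr_det (K : fieldType) n (A : 'M[int]_n) : A \in unitmx ->
  is_monomial (fun=> \det (map_mx (intr : int -> K) A)).
Proof.
rewrite unitmxE -[_ \in _]/((\det A == 1) || (\det A == -1)) => /orP[]/eqP E.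
  exists false, 0 => s _; by rewrite det_map_mx E expr0 mul1r expr0z.
by exists true, 0 => s _; rewrite det_map_mx E expr0z mulr1 rmorphN1.
Qed.

Lemma sum_four (R : pzRingType) (I : finType) (a f1 f2 f3 f4 : I -> R) :
  \sum_i a i * f1 i - \sum_i a i * f2 i + (\sum_i a i * f3 i - \sum_i a i * f4 i) =
  \sum_i a i * ((f1 i - f2 i) + (f3 i - f4 i)).
Proof. by rewrite -!sumrB -big_split; apply: eq_bigr => i _; rewrite mulrDr !mulrBr. Qed.

Section Blocks.
Variables (R : Type) (m1 m2 n1 n2 : nat) (A : 'M[R]_(m1 + m2, n1 + n2)).

Lemma ulsubmxE i j : ulsubmx A i j = A (lshift m2 i) (lshift n2 j).
Proof. by rewrite !mxE. Qed.

Lemma dlsubmxE i j : dlsubmx A i j = A (rshift m1 i) (lshift n2 j).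
Proof. by rewrite !mxE. Qed.

Lemma drsubmxE i j : drsubmx A i j = A (rshift m1 i) (rshift n1 j).
Proof. by rewrite !mxE. Qed.
End Blocks.

(** * The Seifert determinant as a sum over trees *)

Section SeifertDeterminant.
Variable D : crossing_diagram.
Hypotheses (D_planar : euler_sphere D) (D_connected : crossings_connected D).
Hypothesis D_alt : strands_alternate D.
Local Notation X := (crossing D).
Local Notation G := (tait_of_crossings D).
Local Notation h := (@ehead G).
Local Notation t := (@etail G).
Local Notation l := (@eleft G).
Local Notation r := (@eright G).
Local Notation reg := (vertex G + face G)%type.
Local Notation pf phi := (pot_flow (fun v => phi (inl v)) (fun f => phi (inr f))).
Local Notation circle_of := (circle_of D_alt).
Implicit Types (x y : X) (z : Defs.arc D).

(** The form descends to homology; the transposed formula settles the second argument. *)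
Lemma seifert_band (f f' g : Defs.arc D -> int) :
  is_flow f -> is_flow f' -> is_flow g -> band_over f =1 band_over f' ->
  seifert_form f g = seifert_form f' g /\ seifert_form g f = seifert_form g f'.
Proof.
move=> ff ff' fg E; split; first by rewrite !seifert_formE //; apply: eq_bigr => x _; rewrite E.
rewrite !(seifert_form_transpose D_planar D_connected D_alt _ fg) //.
by apply: eq_bigr => x _; rewrite E.
Qed.

Lemma seifert_band0 (f g : Defs.arc D -> int) :
  is_flow f -> is_flow g -> band_over f =1 (fun=> 0) ->
  seifert_form f g = 0 /\ seifert_form g f = 0.
Proof.
move=> ff fg E; rewrite seifert_formE // (seifert_form_transpose D_planar D_connected D_alt ff fg).
by split; apply: big1 => x _; rewrite E !mul0r oppr0 if_same.
Qed.

Variables (K : fieldType).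

(** The coefficients of the outgoing and incoming overstrand values in [s V - s^-1 V^T], read off
    from the formulas for the form and its transpose. *)
Definition out_coef (s : K) x : K := if positive x then s^-1 else s.
Definition in_coef (s : K) x : K := if positive x then s else s^-1.

Definition alexander_row (s : K) (g : Defs.arc D -> int) x : K :=
  out_coef s x * (over_out g x)%:~R - in_coef s x * (over_in g x)%:~R.

Lemma alexander_pairing (s : K) (f g : Defs.arc D -> int) : is_flow f -> is_flow g ->
  \sum_x alexander_row s g x * (band_over f x)%:~R =
  s * (seifert_form f g)%:~R - s^-1 * (seifert_form g f)%:~R.
Proof.
move=> ff fg; rewrite seifert_formE // (seifert_form_transpose D_planar D_connected D_alt ff fg).
rewrite !rmorph_sum !mulr_sumr -sumrB; apply: eq_bigr => x _.
rewrite /alexander_row /out_coef /in_coef.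
by case: (positive x); rewrite ?rmorphN !rmorphM /=; ring.
Qed.

Variables (r0 : vertex G) (q0 : face G).
Hypothesis qr : adjacent q0 r0.

Section Columns.
Variables (n : nat) (rho : 'I_n -> reg).
Hypotheses (rho_inj : injective rho).
Hypotheses (rho_r : forall j, rho j != inl r0) (rho_q : forall j, rho j != inr q0).
Hypothesis n_card : n = #|X|.

Lemma alexander_row_potential (s : K) (g : Defs.arc D -> int) (phi : reg -> int) x :
  vanishes r0 q0 phi -> (forall z, g z = pf phi z) ->
  alexander_row s g x = \sum_j (phi (rho j))%:~R *
    (vertex_part (G := G) (out_coef s) (fun x => - in_coef s x) x (rho j)
     + face_part (G := G) (fun x => - in_coef s x) (out_coef s) x (rho j)).
Proof.
move=> [p1 p2] gE; have van : vanishes r0 q0 (fun u => (phi u)%:~R : K).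
  by rewrite /vanishes p1 p2.
have ex u c : \sum_j (phi (rho j))%:~R * (c * (rho j == u)%:R) = c * (phi u)%:~R :> K.
  rewrite -(pot_expand D_planar D_alt rho_inj rho_r rho_q n_card u van) mulr_sumr.
  by apply: eq_bigr => j _; rewrite mulrCA.
transitivity (out_coef s x * (phi (inl (h x)))%:~R - - in_coef s x * (phi (inl (t x)))%:~R
   + (- in_coef s x * (phi (inr (l x)))%:~R - out_coef s x * (phi (inr (r x)))%:~R)); last first.
  by rewrite -4!ex sum_four.
rewrite /alexander_row.
have -> : over_out g x = over_out (pf phi) x by rewrite /over_out gE.
have -> : over_in g x = over_in (pf phi) x by rewrite /over_in gE.
rewrite pot_over_out pot_over_in // !rmorphB /=.
by ring.
Qed.
End Columns.

(** The matrix [B] is computed in two ways: as [W^T] between two unimodular matrices, and as a block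
    triangular matrix whose diagonal blocks are the transposed skew Seifert matrix and the weighted
    incidence matrix of a tree. *)
Lemma det_seifert_weighted m (b : 'I_m -> Defs.arc D -> int) : homology_basis b ->
  exists2 f : K -> K, is_monomial f & forall s, s != 0 ->
    let V : 'M[K]_m := map_mx intr (seifert_mx b) in
    \det (s *: V - s^-1 *: V^T) = f s *
    \sum_(T : {set edge G} | spanning_tree T)
      tree_weight r0 q0 (out_coef s) (fun x => - in_coef s x)
        (fun x => - in_coef s x) (out_coef s) T.
Proof.
move=> bb; have [a0 a0_sep] := adjacent_arc D_alt qr; set c0 := circle_of a0.
have [k [xs [cs [cs_inj cs_c0 cs_surj xs_order]]]] :=
  @tree_order (seifert_digraph D_alt) c0 (@seifert_conn D D_connected D_alt).
have nX := @card_crossings D D_alt m b bb c0 k xs cs cs_inj cs_surj xs_order.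
pose xi (j : 'I_(m + k)) : X := enum_val (cast_ord nX j).
have xi_bij : bijective xi.
  by apply: bij_comp; [exact: enum_val_bij|exact: (Bijective (cast_ordK nX) (cast_ordKV nX))].
have [rho [rho_inj rho_r rho_q]] := other_regions q0 r0 D_planar D_alt nX.
(* Subtracting a multiple of the base circle makes a basis flow vanish on [a0] without changing its
   band crossings; the other circles avoid [a0]. *)
pose F (i : 'I_(m + k)) z : int :=
  match split i with
  | inl i => b i z - b i a0 * (circle_of z == c0)%:R
  | inr j => (circle_of z == cs j)%:R end.
have Fl i : F (lshift k i) =1 fun z => b i z - b i a0 * (circle_of z == c0)%:R.
  by move=> z; rewrite /F split_lshift.
have Fr j : F (rshift m j) =1 fun z => (circle_of z == cs j)%:R.
  by move=> z; rewrite /F split_rshift.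
have F_flow i : is_flow (F i).
  rewrite /F; case: (split i) => j.
    apply: is_flowB; first exact: bb.1.
    exact: (circle_is_flow D_alt (fun c => b j a0 * (c == c0)%:R)).
  exact: (circle_is_flow D_alt (fun c => (c == cs j)%:R)).
have F_a0 i : F i a0 = 0.
  rewrite /F; case: (split i) => j; first by rewrite eqxx mulr1 subrr.
  by rewrite eq_sym (negPf (cs_c0 j)).
have Fl_band i : band_over (F (lshift k i)) =1 band_over (b i).
  move=> x; transitivity (band_over (fun z => b i z - b i a0 * (circle_of z == c0)%:R) x).
    by rewrite /band_over /over_out /under_in !Fl.
  rewrite band_overB (circle_band D_alt (fun c => b i a0 * (c == c0)%:R)).
  by rewrite subr0.
have Fr_band j : band_over (F (rshift m j)) =1 fun=> 0.
  move=> x; transitivity (band_over (fun z => (circle_of z == cs j)%:R : int) x).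
    by rewrite /band_over /over_out /under_in !Fr.
  by rewrite (circle_band D_alt (fun c => (c == cs j)%:R)).
have F_span g : is_flow g -> g a0 = 0 ->
    exists v : 'I_(m + k) -> int, forall z, g z = \sum_i v i * F i z.
  move=> gf g0; have [w wE] := homology_coord bb gf.
  (* The remainder crosses no band, so it is constant on circles, and it is zero on the circle of
     [a0]. *)
  pose g' z := g z - \sum_i w i * F (lshift k i) z.
  have gf' : is_flow g' by apply: is_flowB => //; apply: is_flow_sum.
  have gb' x : band_over g' x = 0.
    rewrite band_overB band_over_sum wE; apply/eqP; rewrite subr_eq0; apply/eqP.
    by apply: eq_bigr => i _; rewrite Fl_band.
  have [ga gaE] := band0_circle D_alt gf' gb'.
  exists (fun i => match split i with inl i => w i | inr j => ga (cs j) end) => z.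
  rewrite big_split_ord /=.
  under eq_bigr => i _ do rewrite split_lshift.
  under [X in _ + X]eq_bigr => i _ do rewrite split_rshift Fr.
  have -> : \sum_j ga (cs j) * (circle_of z == cs j)%:R = g' z.
    rewrite gaE; have [E|ne] := eqVneq (circle_of z) c0.
      rewrite E big1 => [|j _]; last by rewrite eq_sym (negPf (cs_c0 j)) mulr0.
      by rewrite -gaE /g' g0 big1 ?subrr // => i _; rewrite F_a0 mulr0.
    have [j <-] := cs_surj _ ne; rewrite (bigD1 j) //= eqxx mulr1 big1 ?addr0 // => i ij.
    by rewrite (inj_eq cs_inj) eq_sym (negPf ij) mulr0.
  by rewrite /g' addrC subrK.
have [phi Psi_unit phiE] := potential_matrix D_planar D_connected D_alt a0_sep rho_inj rho_r rho_q
  F_flow F_a0 F_span.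
set Psi := \matrix_(i, j) _ in Psi_unit.
have [Q' Q1 Q2] := @band_rows_inv D D_alt m b bb c0 k xs cs cs_inj cs_surj xs_order _ xi xi_bij.
set Q := band_rows_mx b xs xi in Q1 Q2.
have Q_unit : Q \in unitmx by have [] := mulmx1_unit Q2.
have [e0 e0r e0q] := common_edge qr.
have [e treeE] := det_weighted_trees (tait_spherical D_planar D_connected D_alt)
  (tait_star D_alt) (tait_dstar D_alt) e0r e0q xi_bij rho_inj rho_r rho_q.
pose cf s := \prod_i (if @ehead (seifert_digraph D_alt) (xs i) == cs i
  then out_coef s (xs i) else - in_coef s (xs i)).
have outM x : is_monomial (fun s => out_coef s x).
  by rewrite /out_coef; apply: monomial_if; [apply: monomialV|]; exact: monomial_id.
have inM x : is_monomial (fun s => in_coef s x).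
  by rewrite /in_coef; apply: monomial_if; [|apply: monomialV]; exact: monomial_id.
have cfM : is_monomial cf.
  by apply: monomial_prod => i; apply: monomial_if; [exact: outM|apply: monomialN; exact: inM].
exists (fun s => (cf s)^-1 * (\det (map_mx (intr : int -> K) Psi) *
   \det (map_mx (intr : int -> K) Q) * (-1) ^+ e)).
  apply: monomialM; first exact: monomialV.
  apply: monomialM; last exact: monomial_sign.
  by apply: monomialM; apply: monomial_intr_det.
move=> s s0 V; apply: (mulfI (monomial_neq0 cfM s0)); rewrite !mulrA mulfV ?(monomial_neq0 cfM) //.
rewrite mul1r -!mulrA -treeE.
set W := (@weighted_mx G (m + k) xi rho K _ _ _ _).
pose B := map_mx intr Psi *m W^T *m (map_mx intr Q)^T.
have BE i j : B i j = \sum_x alexander_row s (F i) x * (band_rows b xs j x)%:~R.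
  rewrite !mxE (reindex xi) /=; last exact: onW_bij.
  apply: eq_bigr => j' _; rewrite !mxE; congr (_ * _).
  have [van E] := phiE i.
  rewrite (alexander_row_potential rho_inj rho_r rho_q nX s _ van E).
  by apply: eq_bigr => j'' _; rewrite !mxE.
have Brow i j : B i (lshift k j) =
    s * (seifert_form (b j) (F i))%:~R - s^-1 * (seifert_form (F i) (b j))%:~R.
  rewrite BE -(alexander_pairing s (bb.1 j) (F_flow i)).
  by apply: eq_bigr => x _; rewrite /band_rows split_lshift.
have dl : dlsubmx B = 0.
  apply/matrixP => i j; rewrite dlsubmxE Brow [RHS]mxE.
  have [-> ->] := seifert_band0 (F_flow (rshift m i)) (bb.1 j) (Fr_band i).
  by rewrite !mulr0 subrr.
have ul : ulsubmx B = (s *: V - s^-1 *: V^T)^T.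
  apply/matrixP => i j; rewrite ulsubmxE Brow !mxE.
  by have [-> ->] := seifert_band (F_flow (lshift k i)) (bb.1 i) (bb.1 j) (Fl_band i).
have dr : drsubmx B = @end_mx (seifert_digraph D_alt) k xs cs K (out_coef s) (in_coef s).
  apply/matrixP => i j; rewrite drsubmxE [RHS]mxE BE (bigD1 (xs j)) //=.
  rewrite big1 => [|x ne]; last by rewrite /band_rows split_rshift eq_sym (negPf ne) mulr0.
  rewrite /band_rows split_rshift eqxx mulr1 addr0 /alexander_row.
  have -> : over_out (F (rshift m i)) (xs j) = (circle_of (xs j, true) == cs i)%:R.
    by rewrite /over_out Fr.
  have -> : over_in (F (rshift m i)) (xs j) = (circle_of (xs j, false) == cs i)%:R.
    rewrite -(circle_over_in D_alt (fun c => (c == cs i)%:R : int)).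
    by rewrite /over_in Fr.
  by rewrite !rmorph_nat.
have detB : \det B = \det (s *: V - s^-1 *: V^T) * cf s.
  rewrite -[B]submxK dl det_ublock ul det_tr dr.
  by rewrite (@det_end_mx (seifert_digraph D_alt) k xs cs cs_inj xs_order).
rewrite [LHS]mulrC -detB !det_mulmx !det_tr.
by move: (\det W) (\det _) (\det _); clear => ? ? ?; ring.
Qed.
End SeifertDeterminant.

(** * The state sum *)

(* Activity weights: internal activity counts at positive, external activity at negative edges. *)
Section StateSum.
Variables (G : plane_digraph) (r : vertex G) (q : face G) (K : fieldType).

Definition head_coef (s : K) (e : edge G) : K := if epositive e then s else 1.
Definition tail_coef (s : K) (e : edge G) : K := if epositive e then - s^-1 else 1.
Definition left_coef (s : K) (e : edge G) : K := if epositive e then 1 else - s.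
Definition right_coef (s : K) (e : edge G) : K := if epositive e then 1 else s^-1.

Definition state_sum (s : K) : K :=
  \sum_(T | spanning_tree T)
     tree_weight r q (head_coef s) (tail_coef s) (left_coef s) (right_coef s) T.
End StateSum.

Section GaugeIdentities.
Variables (K : fieldType) (s y : K).
Hypotheses (s0 : s != 0) (y0 : y != 0).

(** In these four lemmas the first identity is for a positive crossing and the second for a negative
    one; [y] is a power of the scaling factor [- s^-1 ^+ 2]. *)
Lemma gauge_head : y^-1 * (s^-1 * y) = s^-1 /\ - s * y^-1 * (s * (y * - s^-1 ^+ 2)) = 1.
Proof. by split; field; rewrite ?oppr_eq0 ?oner_eq0 ?s0 ?y0. Qed.

Lemma gauge_tail : y^-1 * (- s * y) = - s^-1^-1 /\ - s * y^-1 * (- s^-1 * y) = 1.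
Proof. by split; field; rewrite ?oner_eq0 ?s0 ?y0. Qed.

Lemma gauge_left :
  y^-1 * (- s * (- s^-1 * y)) = 1 /\ - s * y^-1 * (- s^-1 * (- s^-1 * y)) = - s^-1.
Proof. by split; field; rewrite ?oppr_eq0 ?oner_eq0 ?s0 ?y0. Qed.

Lemma gauge_right :
  (y * - s^-1 ^+ 2)^-1 * (s^-1 * (- s^-1 * y)) = 1 /\
  - s * y^-1 * (s * (- s^-1 * y)) = s^-1^-1.
Proof. by split; field; rewrite ?oppr_eq0 ?oner_eq0 ?s0 ?y0. Qed.
End GaugeIdentities.

(** * Rescaling to the activity weights *)

Section Gauge.
Variable D : crossing_diagram.
Hypotheses (D_planar : euler_sphere D) (D_connected : crossings_connected D).
Hypothesis D_alt : strands_alternate D.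
Local Notation X := (crossing D).
Local Notation G := (tait_of_crossings D).
Local Notation h := (@ehead G).
Local Notation t := (@etail G).
Local Notation l := (@eleft G).
Local Notation r := (@eright G).
Local Notation reg := (vertex G + face G)%type.
Implicit Types (x y : X) (z : Defs.arc D).

(* The potential of the flow that is 1 on the arcs leaving a crossing as overstrand; twice
   this potential is the Alexander numbering of the regions, up to a shift. *)
Lemma over_potential : exists (P : vertex G -> int) (Q : face G -> int),
  forall x, [/\ Q (r x) = P (h x) - 1, P (t x) = Q (l x) &
    if positive x then Q (l x) = P (h x) else Q (r x) = P (t x)].
Proof.
pose g z : int := z.2%:R.
have gi x s : g (arc_in x s) = (~~ s)%:R by have [y -> _] := arc_inE D_alt x s.
have gf : is_flow g by apply/is_flowP => x; rewrite /over_in /under_in !gi.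
have [P [Q gE]] := flow_potential D_planar D_connected D_alt gf.
exists P, Q => x.
have := gE (x, true); have := gE (x, false); have := gE (arc_in x true).
rewrite gi -[pot_flow P Q (arc_in x true)]/(over_in (pot_flow P Q) x) pot_over_in //.
rewrite /g /pot_flow /= -![shaded_corner x true]/(h x) -![shaded_corner x false]/(t x).
rewrite -![unshaded_corner x true]/(l x) -![unshaded_corner x false]/(r x).
move: (P (h x)) (P (t x)) (Q (l x)) (Q (r x)) => a b c d E1 E2 E3.
split; [move: E3|move: E1|move: E2]; last case: (positive x).
all: by rewrite /= ?mulr1n ?mulr0n; clear; lia.
Qed.

Variables (K : fieldType) (r0 : vertex G) (q0 : face G).

Section Columns.
Variables (n : nat) (xi : 'I_n -> X) (rho : 'I_n -> reg).

Lemma det_gauge : exists2 f : K -> K, is_monomial f & forall s, s != 0 ->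
  \det (weighted_mx (G := G) xi rho (out_coef s) (fun x => - in_coef s x)
          (fun x => - in_coef s x) (out_coef s)) =
  f s * \det (weighted_mx (G := G) xi rho (head_coef (G := G) s^-1) (tail_coef (G := G) s^-1)
          (left_coef (G := G) s^-1) (right_coef (G := G) s^-1)).
Proof.
have [P [Q PQ]] := over_potential.
(* At a negative crossing both ends must get weight 1, so the column factors of head and tail have
   quotient [- s^-1 ^+ 2], while [P] grows by 1 from tail to head. The two sides at a positive
   crossing give the same quotient. *)
pose w (s : K) := - s^-1 ^+ 2.
pose ka s x := if positive x then w s ^ (- P (h x)) else - s * w s ^ (- P (t x)).
(* The factor [- s^-1] on faces cancels the weight [- s] of the left side at a positive crossing,
   where [Q] at the left equals [P] at the head. *)
pose ch s (u : reg) := match u with inl v => w s ^ P v | inr f => - s^-1 * w s ^ Q f end.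
have wM : is_monomial w.
  apply: monomialN; apply: monomial_eq (monomialM (monomialV (monomial_id K)) (monomialV
    (monomial_id K))) => s _.
  by rewrite expr2.
have kaM x : is_monomial (fun s => ka s x).
  apply: monomial_if; first exact: monomialZ.
  by apply: monomialM; [apply: monomialN; apply: monomial_id|apply: monomialZ].
have chM u : is_monomial (fun s => ch s u).
  case: u => v; first exact: monomialZ.
  by apply: monomialM; [apply: monomialN; apply: monomialV; apply: monomial_id|apply: monomialZ].
exists (fun s => ((\prod_i ka s (xi i)) * (\prod_j ch s (rho j)))^-1).
  by apply: monomialV; apply: monomialM; apply: monomial_prod.
move=> s s0.
set W := weighted_mx _ _ _ _ _ _; set W' := weighted_mx _ _ _ _ _ _.
have kn : \prod_i ka s (xi i) != 0 by apply/prodf_neq0 => i _; exact: (monomial_neq0 (kaM _) s0).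
have cn : \prod_j ch s (rho j) != 0 by apply/prodf_neq0 => i _; exact: (monomial_neq0 (chM _) s0).
suff -> : W' = diag_mx (\row_i ka s (xi i)) *m W *m diag_mx (\row_j ch s (rho j)).
  rewrite !det_mulmx !det_diag.
  under [X in _ = _ * (X * _ * _)]eq_bigr => i _ do rewrite mxE.
  under [X in _ = _ * (_ * X)]eq_bigr => i _ do rewrite mxE.
  by field; rewrite kn cn.
apply/matrixP => i j; rewrite mul_mx_diag mul_diag_mx !mxE.
move: (xi i) (rho j) => x u.
have w0 : w s != 0 by exact: (monomial_neq0 wM s0).
have w1 (p : int) : w s ^ (p + 1) = w s ^ p * w s by rewrite expfzDr // expr1z.
have wV (p : int) : w s ^ (- p) = (w s ^ p)^-1 by rewrite invr_expz.
have [E1 E2 E3] := PQ x.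
have chl v : ch s (inl v) = w s ^ P v by [].
have chr f : ch s (inr f) = - s^-1 * w s ^ Q f by [].
have ws : w s = - s^-1 ^+ 2 by [].
have sub c c' (u0 : reg) : ka s x * (c * ch s u0) = c' ->
    ka s x * (c * (u == u0)%:R) * ch s u = c' * (u == u0)%:R.
  move=> <-; case: eqP => [->|_]; last by rewrite !mulr0 mul0r.
  by rewrite !mulr1 mulrA.
have pre c1 c2 c3 c4 : ka s x * (c1 - c2 + (c3 - c4)) * ch s u =
   (ka s x * c1 * ch s u - ka s x * c2 * ch s u)
   + (ka s x * c3 * ch s u - ka s x * c4 * ch s u) by ring.
have y0 (p : int) : w s ^ p != 0 by apply: expfz_neq0.
have [h1 h2] := gauge_head s0 (y0 (P (t x))); have [t1 t2] := gauge_tail s0 (y0 (P (t x))).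
have [l1 l2] := gauge_left s0 (y0 (P (t x))); have [r1 r2] := gauge_right s0 (y0 (Q (r x))).
have Eh : ka s x * (out_coef s x * ch s (inl (h x))) = head_coef (G := G) s^-1 x.
  rewrite chl /ka /out_coef /head_coef /=; case: ifP E3 => px E3; first by rewrite -E3 -E2 wV.
  have -> : P (h x) = P (t x) + 1 by rewrite -E3 E1 subrK.
  by rewrite w1 wV.
have Et : ka s x * (- in_coef s x * ch s (inl (t x))) = tail_coef (G := G) s^-1 x.
  rewrite chl /ka /in_coef /tail_coef /=; case: ifP E3 => px E3; first by rewrite -E3 -E2 wV.
  by rewrite wV.
have El : ka s x * (- in_coef s x * ch s (inr (l x))) = left_coef (G := G) s^-1 x.
  rewrite chr /ka /in_coef /left_coef /=; case: ifP E3 => px E3; first by rewrite -E3 -E2 wV.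
  by rewrite -E2 wV.
have Er : ka s x * (out_coef s x * ch s (inr (r x))) = right_coef (G := G) s^-1 x.
  rewrite chr /ka /out_coef /right_coef /=; case: ifP E3 => px E3; last by rewrite -E3 wV.
  have -> : P (h x) = Q (r x) + 1 by rewrite E1 subrK.
  by rewrite wV w1.
rewrite /vertex_part /face_part; symmetry; rewrite pre.
exact: (congr2 +%R (congr2 (fun c c' => c - c') (sub _ _ _ Eh) (sub _ _ _ Et))
  (congr2 (fun c c' => c - c') (sub _ _ _ El) (sub _ _ _ Er))).
Qed.
End Columns.
End Gauge.

(** * Exchanging tree edges and the mean exponent *)

Section Exchange.
Variables (G : plane_digraph) (G_sph : spherical G).
Implicit Types (A T : {set edge G}) (e : edge G).

(** If the complement of [T] did not connect the faces, some dual coboundary supported on [T] would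
    be nonzero at an edge [e']. By orthogonality a coboundary vanishing on the rest of [T] then
    vanishes at [e'] too, so [T :\ e'] already determines functions up to constants, against the
    count. *)
Lemma spans_card_tree T : spans T -> #|vertex G| = #|T|.+1 -> is_tree T.
Proof.
move=> sT cT; split=> // f0 f1; apply: contraT => nc.
pose b f : rat := (connect (@joined (dual G) (~: T)) f0 f)%:R.
have bT e : e \notin T -> dcobound b e = 0.
  move=> eT; rewrite /cobound /b /= (same_connect_r (@connect_joined_sym (dual G) _) (y := eright
    e)) ?subrr //.
  by apply: (@joined_edgeV (dual G)); rewrite inE.
have [/existsP[e' be']|] := boolP [exists e : edge G, dcobound b e != 0]; last first.
  move=> /existsPn H; case/negP: nc; have : b f0 = b f1.
    apply: (@joined_const (dual G) [set: edge G]); last exact: (spherical_dconn G_sph).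
    by move=> e _; have := H e; rewrite negbK subr_eq0 => /eqP.
  by rewrite /b connect0; case: connect.
have e'T : e' \in T by apply: contraR be' => /bT ->.
pose v0 := @etail G e'.
have : (#|[set~ v0]| <= #|T :\ e'| + #|@set0 (edge G)|)%N.
  apply: (@exact_card rat (vertex G) (edge G) (edge G) [set~ v0] (T :\ e') set0
    (fun v e => (ehead e == v)%:R - (etail e == v)%:R) (fun _ _ => 0)).
  move=> a a0 aker; exists (fun=> 0) => v; rewrite big1 => [|z _]; last by rewrite mulr0.
  have cb e : \sum_v a v * ((ehead e == v)%:R - (etail e == v)%:R) = cobound a e.
    rewrite (eq_bigr (fun v => a v * (ehead e == v)%:R - a v * (etail e == v)%:R)) => [|i _].
      by rewrite sumrB !sum_pick.
    by rewrite mulrBr.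
  have dT e : e \in T :\ e' -> cobound a e = 0 by move=> eT; rewrite -cb; apply: aker.
  have de' : cobound a e' = 0.
    have := spherical_orth G_sph a b; rewrite (bigD1 e') //= big1 ?addr0.
      by move/eqP; rewrite mulf_eq0 (negPf be') orbF => /eqP.
    move=> e ne; have [eT|neT] := boolP (e \in T); last by rewrite (bT e neT) mulr0.
    by rewrite dT ?mul0r // !inE ne.
  rewrite -(a0 v0) ?inE ?eqxx //; apply: (joined_const _ (sT v v0)) => e eT.
  apply/eqP; rewrite -subr_eq0; apply/eqP.
  by have [->|ne] := eqVneq e e'; [exact: de'|apply: dT; rewrite !inE ne].
by move: cT; rewrite cards0 cardsC1 (cardsD1 e' T) e'T; clear; lia.
Qed.

(* Two trees differing by one edge: both added edges join the two halves of [A]. *)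
Lemma tree_exchange r A e0 : e0 \notin A -> is_tree (e0 |: A) ->
  forall e, (e \notin A) && spanning_tree (e |: A) =
    (connect (joined A) r (ehead e) != connect (joined A) r (etail e)).
Proof.
move=> e0A tT e; pose W := connect (joined A) r.
have DA x : x \notin A -> (x |: A) :\ x = A.
  by move=> xA; apply/setP => y; rewrite !inE; case: eqP => [->|]; rewrite ?(negPf xA).
have sym := connect_joined_sym A.
have two x : x \notin A -> is_tree (x |: A) -> exists u v, [/\ W u, ~~ W v &
    (u = ehead x /\ v = etail x) \/ (u = etail x /\ v = ehead x)].
  move=> xA tx; have xT : x \in x |: A by rewrite !inE eqxx.
  have := parentW r tx xT; have := childNW G_sph r tx xT; rewrite (DA x xA) /child /parent.
  by case: ifP => _ c p; [exists (etail x), (ehead x)|exists (ehead x), (etail x)]; split; auto.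
apply/andP/idP => [[eA /(spanning_treeP G_sph) te]|ne].
  have [u [v [Wu Wv H]]] := two e eA te.
  by case: H Wu Wv => -[-> ->]; rewrite /W => hu hv; rewrite hu (negPf hv).
have eA : e \notin A.
  apply: contra ne => eA; apply/eqP; apply: (same_connect_r sym); exact: joined_edgeV.
split=> //; apply/(spanning_treeP G_sph); apply: spans_card_tree; last first.
  by rewrite (tree_card G_sph tT) !cardsU1 eA e0A.
have [u [v [Wu Wv H]]] := two e0 e0A tT.
have cov x : W x \/ connect (joined A) v x.
  apply: (@joined_ind G (e0 |: A) (fun x => W x \/ connect (joined A) v x) r x _ _ (tT.1 r x)).
  - move=> y; rewrite !inE => /orP[/eqP -> _|yA [wy|cy]].
    + by case: H => -[uE vE]; [left; rewrite -uE|right; rewrite -vE; apply: connect0].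
    + by left; apply: connect_trans wy _; apply: joined_edge.
    by right; apply: connect_trans cy _; apply: joined_edge.
  - move=> y; rewrite !inE => /orP[/eqP -> _|yA [wy|cy]].
    + by case: H => -[uE vE]; [right; rewrite -vE; apply: connect0|left; rewrite -uE].
    + by left; apply: connect_trans wy _; apply: joined_edgeV.
    by right; apply: connect_trans cy _; apply: joined_edgeV.
  by left; apply: connect0.
have big x y : connect (joined A) x y -> connect (joined (e |: A)) x y.
  by apply: joinedS; apply: subsetUr.
have symE := connect_joined_sym (e |: A).
have eE : e \in e |: A by rewrite !inE eqxx.
have rv : connect (joined (e |: A)) r v.
  have [c [d [Wc Wd Hcd]]] : exists c d, [/\ W c, ~~ W d &
     (c = ehead e /\ d = etail e) \/ (c = etail e /\ d = ehead e)].
    move: ne; rewrite -[connect _ r (ehead e)]/(W (ehead e)) -[connect _ r (etail e)]/(W (etail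
      e)); case wh : (W (ehead e)); case wt : (W (etail e)) => // _.
      by exists (ehead e), (etail e); rewrite wh wt; split; auto.
    by exists (etail e), (ehead e); rewrite wh wt; split; auto.
  apply: connect_trans (big _ _ Wc) _; have [wd|vd] := cov d; first by rewrite wd in Wd.
  rewrite symE; apply: connect_trans (big _ _ vd) _.
  by case: Hcd => -[-> ->]; [apply: joined_edge|apply: joined_edgeV].
have rx x : connect (joined (e |: A)) r x.
  have [|vx] := cov x; first exact: big.
  exact: connect_trans rv (big _ _ vx).
by move=> x y; apply: connect_trans (rx y); rewrite symE.
Qed.

(* For a fixed forest [A] the added edges that are active and those that are passive
   are counted by the coboundary of the indicator of the component of the root. *)
Lemma active_passive_balance (r : vertex G) :
  (forall a : vertex G -> int, \sum_(e | epositive e) cobound a e = 0) ->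
  \sum_(T | spanning_tree T) ((iota_pos r T)%:Z - (iota_pos_bar r T)%:Z) = 0.
Proof.
move=> bal.
pose sg A e : int := if connect (joined A) r (etail e) then 1 else -1.
transitivity (\sum_(T | spanning_tree T) \sum_(e | epositive e && (e \in T)) sg (T :\ e) e).
  apply: eq_bigr => T _; rewrite (bigID (int_active r T)) /=; congr (_ + _).
    rewrite /iota_pos -natz -sum1_card natr_sum; apply: eq_big => [e|e].
      by rewrite inE andbA [X in X && _]andbC.
    by rewrite inE => /andP[_ /andP[_]]; rewrite /sg /int_active => ->.
  rewrite /iota_pos_bar -natz -sum1_card natr_sum -sumrN; apply: eq_big => [e|e].
    by rewrite inE andbA [X in X && _]andbC.
  by rewrite inE => /andP[_ /andP[_]]; rewrite /sg /int_active => /negPf ->.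
(* A tree with a chosen edge becomes a forest [A] with an added edge; the sign depends only on [A]
   and the tail. *)
transitivity (\sum_(A : {set edge G}) \sum_(e : edge G | epositive e && ((e \notin A) &&
  spanning_tree (e |: A))) sg A e).
  rewrite (exchange_big_dep (@epositive G)) /= => [|T e _ /andP[]//].
  rewrite [RHS](exchange_big_dep (@epositive G)) /= => [|A e _ /andP[]//].
  apply: eq_bigr => e pe.
  rewrite (reindex_onto (fun A => e |: A) (fun T => T :\ e)) /=; last first.
    by move=> T /andP[_ /andP[_ eT]]; rewrite setD1K.
  apply: eq_big => [A|A /andP[_ /eqP -> //]].
  rewrite pe /= setU11 andbT andbC; congr andb; apply/eqP/idP => [<-|eA].
    by rewrite !inE eqxx.
  by apply/setP => y; rewrite !inE; case: eqP => [->|]; rewrite ?(negPf eA).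
apply: big1 => A _.
have [e0 /andP[e0A t0]|none] := pickP [pred e | (e \notin A) && spanning_tree (e |: A)]; last first.
  by apply: big_pred0 => e; have := none e; rewrite /= => ->; rewrite andbF.
have ex := tree_exchange r e0A (elimT (spanning_treeP G_sph _) t0).
under eq_bigl => e do rewrite ex.
rewrite big_mkcondr /=.
(* An added edge leaving the component of the root counts 1 and changes the indicator by -1; an edge
   entering it does the opposite. *)
transitivity (- \sum_(e | epositive e) cobound (fun v => (connect (joined A) r v)%:Z) e);
  last by rewrite bal oppr0.
rewrite -sumrN; apply: eq_bigr => e _; rewrite /sg /cobound.
by case: (connect _ _ (ehead e)); case: (connect _ _ (etail e)).
Qed.
End Exchange.

Lemma dual_spanning_tree (G : plane_digraph) (T : {set edge G}) : spherical G ->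
  @spanning_tree (dual G) (~: T) = spanning_tree T.
Proof.
move=> G_sph; apply/idP/idP.
  move/(spanning_treeP (spherical_dual G_sph))/dual_tree; rewrite setCK => -[H1 H2].
  by apply/(spanning_treeP G_sph).
by move/(spanning_treeP G_sph)/dual_tree => H; apply/(spanning_treeP (spherical_dual G_sph)).
Qed.

(** The internal balance of the dual, where externally active means internally passive. *)
Lemma ext_balance (G : plane_digraph) (q : face G) : spherical G ->
  (forall b : face G -> int, \sum_(e : edge G | ~~ epositive e) dcobound b e = 0) ->
  \sum_(T : {set edge G} | spanning_tree T) ((eps_neg q T)%:Z - (eps_neg_bar q T)%:Z) = 0.
Proof.
move=> G_sph bal.
have := active_passive_balance (spherical_dual G_sph) q bal.
rewrite (reindex_inj (@setC_inj _)) /= => H; apply: oppr_inj; rewrite oppr0 -[RHS]H -sumrN.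
apply: eq_big => [T|T tT]; first by rewrite dual_spanning_tree.
rewrite opprB; congr (_%:Z - _%:Z); apply: eq_card => e; rewrite !inE;
  case eT : (e \in T) => //=; congr (_ && _).
  by rewrite (ext_active_dual G_sph _ (elimT (spanning_treeP G_sph _) tT)) ?eT // negbK.
by rewrite (ext_active_dual G_sph _ (elimT (spanning_treeP G_sph _) tT)) ?eT.
Qed.

Section TreeWeights.
Variables (G : plane_digraph) (r : vertex G) (q : face G).
Implicit Types T : {set edge G}.

Definition up_exponent T : int := (iota_pos r T)%:Z - (eps_neg q T)%:Z.
Definition down_exponent T : int := (eps_neg_bar q T)%:Z - (iota_pos_bar r T)%:Z.

Lemma prod_expr_mem (R : comPzSemiRingType) (I : finType) (A : {set I}) (x : R) :
  \prod_i x ^+ (i \in A) = x ^+ #|A|.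
Proof.
by rewrite prodrXr -sum1_card [in RHS]big_mkcond; congr (_ ^+ _).
Qed.

Lemma state_weightE (K : fieldType) (s : K) T : s != 0 ->
  tree_weight r q (head_coef s) (tail_coef s) (left_coef s) (right_coef s) T =
  s ^ up_exponent T * (- s) ^ down_exponent T.
Proof.
move=> s0; have sN0 : - s != 0 by rewrite oppr_eq0.
rewrite /up_exponent /down_exponent !expfzDr // -!invr_expz -!exprnP.
rewrite /iota_pos /eps_neg /iota_pos_bar /eps_neg_bar -!prod_expr_mem.
rewrite -!prodfV -!big_split; apply: eq_bigr => e _; rewrite !inE.
rewrite /head_coef /tail_coef /left_coef /right_coef.
case: (e \in T); case: (epositive e); case: (int_active r T e); case: (ext_active q T e) => /=;
  by rewrite ?expr0 ?expr1 ?invr1 ?mulr1 ?mul1r ?invrN.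
Qed.

(** The difference counts the positive edges in [T] minus the negative edges outside [T], that is,
    [#|T|] minus the number of negative edges. *)
Lemma exponent_difference T : spherical G -> spanning_tree T ->
  up_exponent T - down_exponent T = #|vertex G|%:Z - 1 - #|[set e | ~~ @epositive G e]|%:Z.
Proof.
move=> G_sph /(spanning_treeP G_sph) /(tree_card G_sph) cV.
have split_card (A B C : {set edge G}) : A :|: B = C -> [disjoint A & B] -> #|C| = (#|A| + #|B|)%N.
  by move=> <- d; have [_] := leq_card_setU A B; rewrite d => /eqP.
have dis (p1 p2 : pred (edge G)) : (forall e, ~~ (p1 e && p2 e)) ->
    [disjoint [set e | p1 e] & [set e | p2 e]].
  by move=> H; rewrite disjoint_subset; apply/subsetP => e; rewrite !inE => p1e; have := H e;
    rewrite p1e.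
have c1 : #|[set e in T | epositive e]| = (iota_pos r T + iota_pos_bar r T)%N.
  apply: split_card; last by apply: dis => e; case: (int_active r T e); rewrite ?andbF.
  by apply/setP => e; rewrite !inE; case: (int_active r T e); rewrite ?andbF ?andbT ?orbF.
have c2 : #|[set e in ~: T | ~~ epositive e]| = (eps_neg q T + eps_neg_bar q T)%N.
  apply: split_card; last by apply: dis => e; case: (ext_active q T e); rewrite ?andbF.
  by apply/setP => e; rewrite !inE; case: (ext_active q T e); rewrite ?andbF ?andbT ?orbF.
have c3 : #|T| = (#|[set e in T | epositive e]| + #|[set e in T | ~~ epositive e]|)%N.
  apply: split_card; last by apply: dis => e; case: (epositive e); rewrite ?andbF.
  by apply/setP => e; rewrite !inE; case: (epositive e); rewrite ?andbF ?andbT ?orbF.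
have c4 : #|[set e | ~~ @epositive G e]| =
    (#|[set e in T | ~~ epositive e]| + #|[set e in ~: T | ~~ epositive e]|)%N.
  apply: split_card; last by apply: dis => e; rewrite !inE; case: (e \in T); rewrite ?andbF.
  by apply/setP => e; rewrite !inE; case: (e \in T); rewrite ?andbF ?andbT ?orbF.
rewrite /up_exponent /down_exponent cV c4 c3 c1 c2 -addn1; move: #|[set e in T | _]|; clear; lia.
Qed.

Lemma state_sumE (K : fieldType) (s : K) : s != 0 ->
  state_sum r q s = \sum_(T | spanning_tree T) s ^ up_exponent T * (- s) ^ down_exponent T.
Proof. by move=> s0; apply: eq_bigr => T _; apply: state_weightE. Qed.
End TreeWeights.

Lemma sqrt_t_neq0 : sqrt_t != 0.
Proof. by rewrite tofrac_eq0 polyX_eq0. Qed.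

(* Evaluation and derivative at 1. *)
Lemma laurent_mean (I : finType) (P : pred I) (u v : I -> int) (f : bool) :
  \sum_(i | P i) sqrt_t ^ u i = (-1) ^+ f * \sum_(i | P i) sqrt_t ^ v i ->
  \sum_(i | P i) u i = \sum_(i | P i) v i.
Proof.
have X0 := sqrt_t_neq0.
pose N : int := \sum_i (`|u i| + `|v i|).
have bnd i : `|u i| + `|v i| <= N.
  by rewrite /N (bigD1 i) //= lerDl sumr_ge0.
move=> /(congr1 (fun x => sqrt_t ^ N * x)); rewrite /= mulrCA.
have pw (w : I -> int) : (forall i, `|w i| <= N) ->
    sqrt_t ^ N * (\sum_(i | P i) sqrt_t ^ w i) =
    tofrac (\sum_(i | P i) 'X^(absz (N + w i)) : {poly algC}).
  move=> wN; rewrite mulr_sumr rmorph_sum; apply: eq_bigr => i _.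
  rewrite -expfzDr // rmorphXn /= -/sqrt_t exprnP; congr (_ ^ _).
  by rewrite gez0_abs //; have := wN i; lia.
rewrite !pw; [|by move=> i; have := bnd i; lia..].
have -> : (-1) ^+ f = tofrac ((-1) ^+ f : {poly algC}) by rewrite rmorph_sign.
rewrite -rmorphM => /eqP; rewrite tofrac_eq => /eqP E.
have E0 := congr1 (fun p => p.[1]) E; have E1 := congr1 (fun p => p^`().[1]) E.
have ev (w : I -> int) : (\sum_(i | P i) 'X^(absz (N + w i)) : {poly algC}).[1] = #|P|%:R.
  by rewrite horner_sum (eq_bigr (fun=> 1)) ?sumr_const // => i _; rewrite hornerXn expr1n.
have dv (w : I -> int) : (forall i, `|w i| <= N) ->
   ((\sum_(i | P i) 'X^(absz (N + w i)) : {poly algC})^`()).[1] =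
     (\sum_(i | P i) (N + w i))%:~R.
  move=> wN; rewrite (big_morph (@deriv _) (@derivD _) (linear0 _)) horner_sum rmorph_sum;
    apply: eq_bigr => i _.
  by rewrite derivXn hornerMn hornerXn expr1n pmulrn gez0_abs //; have := wN i; lia.
move: E0 E1; case: f E => _; rewrite ?expr1 ?expr0 ?mulN1r ?mul1r ?derivN ?hornerN !ev.
  move=> E0 _; have : (#|P|%:R : algC) == 0.
    by rewrite -eqNr -E0.
  rewrite pnatr_eq0 => /eqP/card0_eq P0.
  by rewrite !big_pred0 // => i; have := P0 i.
move=> _; rewrite !dv; [|by move=> i; have := bnd i; lia..].
by move=> /intr_inj; rewrite !big_split /= => /addrI.
Qed.

Lemma imag_sqr : imag ^+ 2 = -1.
Proof. by rewrite /imag -rmorphXn -rmorphXn /= sqrCi !rmorphN1. Qed.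

Lemma sqrt_opp1_neq0 (K : fieldType) (i : K) : i ^+ 2 = -1 -> i != 0.
Proof. by move=> i2; rewrite -sqrf_eq0 i2 oppr_eq0 oner_eq0. Qed.

Section Symmetry.
Variables (K : fieldType) (i X : K) (I : finType) (P : pred I) (v : I -> int) (c : int).
Hypotheses (i2 : i ^+ 2 = -1) (X0 : X != 0).
Definition laurent_sum (s : K) : K := \sum_(T | P T) s ^ (v T + c) * (- s) ^ v T.

Lemma expN1z (z : int) : (-1 : K) ^ z = (-1) ^+ `|z|%N.
Proof.
case: z => n; first by rewrite exprnP.
by rewrite NegzE -invr_expz abszN absz_nat -exprnP -signr_odd invr_sign signr_odd.
Qed.

Lemma laurent_sumE s : s != 0 ->
  laurent_sum s = s ^ c * \sum_(T | P T) (- s ^+ 2) ^ v T.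
Proof.
move=> s0; rewrite /laurent_sum mulr_sumr; apply: eq_bigr => T tT.
by rewrite addrC expfzDr // -mulrA -expfzMl expr2 mulrN.
Qed.

(* Compare [laurent_sum] at the points [i X] and [(i X)^-1]. *)
Lemma laurent_symmetry (e : bool) (m : nat) (j : int) :
  (-1) ^+ m * ((-1) ^+ e * (i * X) ^ j * laurent_sum (i * X)^-1) =
    (-1) ^+ e * (i * X)^-1 ^ j * laurent_sum (i * X) ->
  exists f : bool, \sum_(T | P T) X ^ (2 * (c - j) + 2 * v T) =
    (-1) ^+ f * \sum_(T | P T) X ^ (- (2 * v T)).
Proof.
have i0 := sqrt_opp1_neq0 i2.
set s := i * X; have s0 : s != 0 by rewrite mulf_neq0.
have s2 : - s ^+ 2 = X ^+ 2 by rewrite exprMn i2 mulN1r opprK.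
rewrite !laurent_sumE ?invr_eq0 // exprVn -invrN s2.
set A := \sum_(T | _) _; set B := \sum_(T | _) _ => E.
exists (odd (`|(c - j)%R|%N + m)).
have -> : \sum_(T | P T) X ^ (- (2 * v T)) = A.
  by apply: eq_bigr => T _; rewrite exprz_inv exprnP exprz_exp mulrN.
have -> : \sum_(T | P T) X ^ (2 * (c - j) + 2 * v T) = X ^ (2 * (c - j)) * B.
  by rewrite mulr_sumr; apply: eq_bigr => T _; rewrite expfzDr // exprnP exprz_exp.
have Xd : X ^ (2 * (c - j)) = (-1) ^+ odd `|(c - j)%R|%N * s ^ (2 * (c - j)).
  have ss : s ^ (2 : int) = -1 * X ^ (2 : int) by rewrite -!exprnP -s2 mulN1r opprK.
  rewrite -!exprz_exp ss (expfzMl (-1) (X ^ 2)) expN1z signr_odd mulrA -exprD addnn -signr_odd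
    odd_double.
  by rewrite mul1r.
have s2d : s ^ (2 * (c - j)) = (s ^ c / s ^ j) ^+ 2.
  by rewrite mulrC -exprz_exp expfzDr // -invr_expz.
rewrite Xd s2d oddD signr_addb -!mulrA; congr (_ * _); rewrite signr_odd.
have [y0 x0] : s ^ c != 0 /\ s ^ j != 0 by rewrite !expfz_neq0.
move: E; rewrite !exprz_inv -!invr_expz; move: (s ^ c) (s ^ j) y0 x0 => y x y0 x0 E.
have E' : (-1) ^+ m * A = y / x * (y / x * B).
  apply: (mulfI (_ : (-1) ^+ e * x / y != 0)).
    by rewrite !mulf_neq0 ?invr_eq0 ?signr_eq0.
  transitivity ((-1) ^+ m * ((-1) ^+ e * x * (y^-1 * A))); first by ring.
  by rewrite E; field; rewrite x0 y0.
by rewrite E' -!mulrA.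
Qed.
End Symmetry.

Lemma mean_shift (I : finType) (P : pred I) (v : I -> int) (c j : int) :
  \sum_(T | P T) (2 * (c - j) + 2 * v T) = \sum_(T | P T) - (2 * v T) ->
  \sum_(T | P T) (2 * v T + c) = 0 -> j = 0 \/ P =1 pred0.
Proof.
rewrite !big_split /= sumrN !sumr_const; set Sd := \sum_(T | P T) _; set n := #|_|.
move=> M1 M2; have : j *+ n = 0.
  move: M1 M2; rewrite -(mulr_natr (2 * (c - j)) n) -(mulr_natr c n) -(mulr_natr j n).
  by move: (n%:R : int) Sd; clear => ? ?; lia.
move=> /eqP; rewrite mulrn_eq0 => /orP[/eqP/card0_eq n0|/eqP]; last by left.
by right=> T; have := n0 T.
Qed.

Section SeifertDeterminant.
Variable D : crossing_diagram.
Hypotheses (D_planar : euler_sphere D) (D_connected : crossings_connected D).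
Hypothesis D_alt : strands_alternate D.
Local Notation G := (tait_of_crossings D).
Variables (r0 : vertex G) (q0 : face G).
Hypothesis qr : adjacent q0 r0.
Variables (m : nat) (b : 'I_m -> Defs.arc D -> int).
Hypothesis bb : homology_basis b.

Lemma tait_int_balance (a : vertex G -> int) : \sum_(e | @epositive G e) cobound a e = 0.
Proof.
have := corner_sum_over D_alt (fun v _ => a v); move/eqP.
rewrite -subr_eq0 -sumrB => /eqP H; rewrite -[RHS]H big_mkcond; apply: eq_bigr => x _.
by rewrite /cobound /= ; case: (positive x); rewrite ?subrr.
Qed.

Lemma tait_ext_balance (a : face G -> int) : \sum_(e : edge G | ~~ epositive e) dcobound a e = 0.
Proof.
have := corner_sum_over D_alt (fun _ f => a f); move/eqP.
rewrite -subr_eq0 -sumrB => /eqP H; apply: oppr_inj; rewrite oppr0 -[RHS]H -sumrN big_mkcond.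
apply: eq_bigr => x _.
by rewrite /cobound /= ; case: (positive x); rewrite ?subrr //= opprB.
Qed.

Lemma exponent_mean :
  \sum_(T : {set edge G} | spanning_tree T) (up_exponent r0 q0 T + down_exponent r0 q0 T) = 0.
Proof.
have G_sph := tait_spherical D_planar D_connected D_alt.
have H1 := active_passive_balance G_sph r0 tait_int_balance.
have H2 := ext_balance q0 G_sph tait_ext_balance.
transitivity (\sum_(T : {set edge G} | spanning_tree T) ((iota_pos r0 T)%:Z - (iota_pos_bar r0
  T)%:Z)
  - \sum_(T : {set edge G} | spanning_tree T) ((eps_neg q0 T)%:Z - (eps_neg_bar q0 T)%:Z)).
  by rewrite -sumrB; apply: eq_bigr => T _; rewrite /up_exponent /down_exponent; ring.
by rewrite H1 H2 subr0.
Qed.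

Lemma state_sum_gauge (K : fieldType) : exists2 f : K -> K, is_monomial f &
  forall s, s != 0 ->
    \sum_(T : {set edge G} | spanning_tree T)
      tree_weight r0 q0 (out_coef s) (fun x => - in_coef s x)
        (fun x => - in_coef s x) (out_coef s) T = f s * state_sum r0 q0 s^-1.
Proof.
have [e0 e0r e0q] := common_edge qr.
have [rho [rho_inj rho_r rho_q]] := other_regions q0 r0 D_planar D_alt (erefl _).
have [e treeE] := det_weighted_trees (tait_spherical D_planar D_connected D_alt)
  (tait_star D_alt) (tait_dstar D_alt) e0r e0q (enum_val_bij (crossing D)) rho_inj rho_r rho_q.
have [f fM fE] := det_gauge D_planar D_connected D_alt K enum_val rho.
exists f => // s s0; have := fE s s0; rewrite !treeE mulrCA.
by move/(mulfI (_ : (-1) ^+ e != 0)); apply; rewrite signr_eq0.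
Qed.

Lemma det_seifert_monomial (K : fieldType) : exists (e : bool) (j : int), forall s : K, s != 0 ->
    let V : 'M[K]_m := map_mx intr (seifert_mx b) in
    \det (s *: V - s^-1 *: V^T) = (-1) ^+ e * s ^ j * state_sum r0 q0 s^-1.
Proof.
have [f fM fE] := det_seifert_weighted D_planar D_connected D_alt K qr bb.
have [g gM gE] := state_sum_gauge K.
have [e [j fgE]] := monomialM fM gM.
by exists e, j => s s0 V; rewrite fE // gE // mulrA fgE.
Qed.

Section LaurentField.
(* [K] stands for the field of rational functions in [X]. *)
Variables (K : fieldType) (i X : K).
Hypotheses (i2 : i ^+ 2 = -1) (X0 : X != 0).
Hypothesis X_mean : forall (I : finType) (P : pred I) (u v : I -> int) (f : bool),
  \sum_(T | P T) X ^ u T = (-1) ^+ f * \sum_(T | P T) X ^ v T ->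
  \sum_(T | P T) u T = \sum_(T | P T) v T.

Theorem det_seifert_state_sum : exists e : bool, forall s : K, s != 0 ->
    let V : 'M[K]_m := map_mx intr (seifert_mx b) in
    \det (s *: V - s^-1 *: V^T) = (-1) ^+ e * state_sum r0 q0 s^-1.
Proof.
have [e [j detE]] := det_seifert_monomial K.
exists e => s s0 V; rewrite detE // => {V}.
suff [->|tr0] : j = 0 \/ forall T : {set edge G}, ~~ spanning_tree T; first by rewrite expr0z mulr1.
  by rewrite state_sumE ?invr_eq0 // big_pred0 ?mulr0 // => T; apply/negbTE.
move=> {s s0}.
pose c : int := #|vertex G|%:Z - 1 - #|[set x | ~~ @epositive G x]|%:Z.
have G_sph := tait_spherical D_planar D_connected D_alt.
have upE T : spanning_tree T -> up_exponent r0 q0 T = down_exponent r0 q0 T + c.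
  move=> tT; have H : up_exponent r0 q0 T - down_exponent r0 q0 T = c := exponent_difference r0 q0
    G_sph tT.
  by rewrite -H addrC subrK.
pose P (T : {set edge G}) := spanning_tree T.
have sumE (s : K) : s != 0 -> state_sum r0 q0 s = laurent_sum P (down_exponent r0 q0) c s.
  by move=> s0; rewrite state_sumE //; apply: eq_bigr => T tT; rewrite (upE T tT).
have i0 := sqrt_opp1_neq0 i2.
have s0 : i * X != 0 by rewrite mulf_neq0.
have sV0 : (i * X)^-1 != 0 by rewrite invr_eq0.
have := detE _ s0; have := detE _ sV0; rewrite /= invrK !sumE //.
set V := map_mx _ _.
have -> : \det ((i * X)^-1 *: V - (i * X) *: V^T) =
    (-1) ^+ m * \det ((i * X) *: V - (i * X)^-1 *: V^T).
  rewrite -[X in _ = _ * X]det_tr -detZ; congr (\det _).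
  by apply/matrixP => x y; rewrite !mxE; ring.
move=> E1 E2; rewrite E2 {E2} in E1.
have [f /X_mean mean] := laurent_symmetry i2 X0 E1.
have : \sum_(T | P T) (2 * down_exponent r0 q0 T + c) = 0.
  rewrite -[RHS]exponent_mean; apply: eq_bigr => T tT.
  by rewrite (upE T tT); ring.
move/(mean_shift mean) => [->|none]; [by left|right=> T].
by apply/negP => tT; have := none T; rewrite /P tT.
Qed.
End LaurentField.
End SeifertDeterminant.

(** * Inertia and S-equivalence *)

Local Open Scope sesquilinear_scope.

Lemma adjM (C : numClosedFieldType) m n p (A : 'M[C]_(m, n)) (B : 'M[C]_(n, p)) :
  (A *m B)^t* = B^t* *m A^t*.
Proof. by rewrite trmx_mul map_mxM. Qed.

Section Inertia.
Variable C : numClosedFieldType.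
Implicit Types eps : C.

Lemma sqr1_real eps : eps ^+ 2 = 1 -> eps \is Num.real.
Proof. by move/eqP; rewrite sqrf_eq1 => /orP[]/eqP ->; rewrite ?rpredN rpred1. Qed.

Definition hform n (A : 'M[C]_n) (z : 'rV_n) : C := (z *m A *m z^t*) 0 0.

(* For [eps = 1] or [-1], the number of eigenvalues of sign [eps]. *)
Definition inertia eps n (A : 'M[C]_n) : nat := #|[set i | 0 < eps * spectral_diag A 0 i]|.

Definition definite eps n (A : 'M[C]_n) :=
  forall z : 'rV_n, z != 0 -> 0 < eps * hform A z.

Lemma hform_diag n (d z : 'rV[C]_n) : hform (diag_mx d) z = \sum_j d 0 j * `|z 0 j| ^+ 2.
Proof.
rewrite /hform mxE; apply: eq_bigr => j _; rewrite mul_mx_diag !mxE normCK.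
by rewrite [z 0 j * d 0 j]mulrC mulrA.
Qed.

Lemma hform_congr k n (G : 'M[C]_(k, n)) (A : 'M[C]_n) z :
  hform (G *m A *m G^t*) z = hform A (z *m G).
Proof. by rewrite /hform adjM !mulmxA. Qed.

Lemma left_kernel_neq0 k c (B : 'M[C]_(k, c)) : (c < k)%N ->
  exists2 w : 'rV_k, w != 0 & w *m B = 0.
Proof.
move=> ck; have : kermx B != 0.
  rewrite -mxrank_eq0 mxrank_ker subn_eq0 -ltnNge.
  exact: leq_ltn_trans (rank_leq_col B) ck.
by move/rowV0Pn => [w /sub_kermxP wB w0]; exists w.
Qed.

Section Spectrum.
Variables (n : nat) (A : 'M[C]_n).
Hypothesis A_herm : A \is hermsymmx.
Let P := spectralmx A.
Let d := spectral_diag A.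

Lemma spectralE : A = P^t* *m diag_mx d *m P.
Proof.
have /orthomx_spectralP := hermitian_normalmx A_herm.
by rewrite invmx_unitary // spectral_unitarymx.
Qed.

Lemma spectral_unitary : P *m P^t* = 1%:M.
Proof. exact/unitarymxP/spectral_unitarymx. Qed.

Lemma hform_spectral z : hform A z = hform (diag_mx d) (z *m P^t*).
Proof. by rewrite -hform_congr trmxCK -spectralE. Qed.

Lemma inertia_ge eps k (G : 'M[C]_(k, n)) : eps \is Num.real ->
  definite eps (G *m A *m G^t*) -> (k <= inertia eps A)%N.
Proof.
move=> eps_real def; rewrite leqNgt; apply/negP => lt.
pose S := [set i | 0 < eps * d 0 i].
have [w w0 wY] := left_kernel_neq0 (colsub (fun i : 'I_#|S| => enum_val i) (G *m P^t*)) lt.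
have := def w w0; rewrite hform_congr.
have -> : hform A (w *m G) = hform (diag_mx d) (w *m (G *m P^t*)).
  by rewrite hform_spectral mulmxA.
rewrite hform_diag mulr_sumr; apply/negP; rewrite -real_leNgt ?real0 //; last first.
  by apply: sum_real => j _; rewrite !realM ?realX ?normr_real //;
    apply/mxOverP/hermitian_spectral_diag_real.
apply: sumr_le0 => j _; rewrite mulrA.
have [jS|jS] := boolP (j \in S).
  suff -> : (w *m (G *m P^t*)) 0 j = 0 by rewrite normr0 expr0n mulr0.
  have /rowP/(_ (enum_rank_in jS j)) := wY; rewrite mxE [RHS]mxE => <-.
  by rewrite mxE; apply: eq_bigr => i _; rewrite [in RHS]mxE enum_rankK_in.
apply: mulr_le0_ge0; last by rewrite exprn_ge0.
rewrite real_leNgt ?real0 //; first by rewrite inE in jS.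
by rewrite realM //; apply/mxOverP/hermitian_spectral_diag_real.
Qed.

Lemma inertia_attained eps : exists G : 'M[C]_(inertia eps A, n),
  definite eps (G *m A *m G^t*).
Proof.
pose S := [set i | 0 < eps * d 0 i].
pose E : 'M[C]_(#|S|, n) := \matrix_(i, j) (j == enum_val i)%:R.
exists (E *m P) => w w0; rewrite hform_congr.
have -> : hform A (w *m (E *m P)) = hform (diag_mx d) (w *m E).
  by rewrite hform_spectral -!mulmxA spectral_unitary mulmx1.
rewrite hform_diag mulr_sumr.
have wE i : (w *m E) 0 (enum_val i) = w 0 i.
  rewrite mxE (bigD1 i) //= mxE eqxx mulr1 big1 ?addr0 // => i' ne.
  by rewrite mxE (inj_eq enum_val_inj) eq_sym (negPf ne) mulr0.
have term j : 0 <= eps * (d 0 j * `|(w *m E) 0 j| ^+ 2).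
  have [jS|jS] := boolP (j \in S).
    by rewrite mulrA mulr_ge0 ?exprn_ge0 //; rewrite inE in jS; apply: ltW.
  suff -> : (w *m E) 0 j = 0 by rewrite normr0 expr0n !mulr0.
  rewrite mxE big1 // => i _; rewrite mxE; case: eqP => [E'|_]; last by rewrite mulr0.
  by case/negP: jS; rewrite E' enum_valP.
rewrite lt_neqAle sumr_ge0 // andbT eq_sym psumr_neq0 //.
have [i wi] : exists i, w 0 i != 0 by apply/rV0Pn.
apply/hasP; exists (enum_val i); first exact: mem_index_enum.
rewrite /= wE mulrA mulr_gt0 ?exprn_gt0 ?normr_gt0 //.
by have := enum_valP i; rewrite inE.
Qed.
End Spectrum.

Lemma definite_pull eps k k' n (G : 'M[C]_(k, n)) (A : 'M[C]_n) (H : 'M[C]_(k', k)) :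
  row_free H -> definite eps (G *m A *m G^t*) ->
  definite eps ((H *m G) *m A *m (H *m G)^t*).
Proof.
move=> Hfree def w w0; rewrite hform_congr mulmxA -hform_congr; apply: def.
by apply: contraNneq w0 => /eqP; rewrite mulmx_free_eq0 // => /eqP ->.
Qed.

Lemma inertia_codim eps n n' c (A : 'M[C]_n) (A' : 'M[C]_n') (L : 'M[C]_(n', n))
    (M : 'M[C]_(n', c)) :
  eps \is Num.real -> A \is hermsymmx -> A' \is hermsymmx ->
  (forall z, z *m M = 0 -> hform A (z *m L) = hform A' z) ->
  (inertia eps A' <= inertia eps A + c)%N.
Proof.
move=> eps_real hA hA' agree; have [G' def] := inertia_attained hA' eps.
pose K := row_base (kermx (G' *m M)).
have rK : (inertia eps A' <= \rank (kermx (G' *m M)) + c)%N.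
  by rewrite mxrank_ker; have := rank_leq_col (G' *m M); clear; lia.
apply: leq_trans rK _; rewrite leq_add2r.
apply: (@inertia_ge _ _ hA eps _ (K *m G' *m L)) => // w w0.
rewrite hform_congr mulmxA agree; last first.
  have KM : K *m (G' *m M) = 0.
    by apply/sub_kermxP; rewrite eq_row_base.
  by rewrite -2!mulmxA KM mulmx0.
rewrite -hform_congr; apply: (definite_pull _ def) => //.
exact: row_base_free.
Qed.

Lemma inertia_congr eps n (A P : 'M[C]_n) :
  eps \is Num.real -> A \is hermsymmx -> P *m A *m P^t* \is hermsymmx -> P \in unitmx ->
  inertia eps (P *m A *m P^t*) = inertia eps A.
Proof.
move=> eps_real hA hPA Pu.
apply/eqP; rewrite eqn_leq -[X in (_ <= X)%N]addn0 -[X in _ && (_ <= X)%N]addn0; apply/andP; split.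
  by apply: (@inertia_codim _ _ _ 0 _ _ P 0) => // z _; rewrite hform_congr.
by apply: (@inertia_codim _ _ _ 0 _ _ (invmx P) 0) => // z _; rewrite hform_congr mulmxKV.
Qed.

Lemma inertia_opp_le n (A : 'M[C]_n) : (inertia 1 A + inertia (-1) A <= n)%N.
Proof.
rewrite /inertia -cardsUI [X in (_ + X)%N]eq_card0 ?addn0.
  by rewrite -[X in (_ <= X)%N]card_ord max_card.
move=> i; rewrite !inE mul1r mulN1r oppr_gt0; apply/negP => /andP[p q].
by have := lt_trans p q; rewrite ltxx.
Qed.
End Inertia.

Lemma matrix_signatureE n (A : 'M[algC]_n) :
  matrix_signature A = (inertia 1 A)%:Z - (inertia (-1) A)%:Z.
Proof.
rewrite /matrix_signature /inertia; congr (Posz _ - Posz _); apply: eq_card => i.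
  by rewrite !inE mul1r.
by rewrite !inE mulN1r oppr_gt0.
Qed.

Lemma det_enlarged (K : fieldType) n (M : 'M[K]_n) (a : 'cV_n) (b : 'rV_n) (p q : K) :
  q != 0 ->
  \det (block_mx M (row_mx a 0) (col_mx b 0) (block_mx 0 p%:M q%:M 0) : 'M_(n + (1 + 1))) =
    \det M * (- (p * q)).
Proof.
move=> q0.
have -> : block_mx M (row_mx a 0) (col_mx b 0) (block_mx 0 p%:M q%:M 0) =
  block_mx 1%:M (row_mx 0 (q^-1 *: a)) 0 1%:M *m
    block_mx M 0 (col_mx b 0) (block_mx 0 p%:M q%:M 0) :> 'M_(n + (1 + 1)).
  rewrite mulmx_block !mul1mx !mul0mx !add0r mul_row_col mul0mx mulmx0 !addr0.
  by rewrite mul_row_block !mul0mx mulmx0 !add0r mul_mx_scalar scalerA mulfV // scale1r.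
rewrite det_mulmx det_ublock det_lblock !det1 !mul1r; congr (_ * _).
have : block_mx 1%:M 1%:M 0 1%:M *m block_mx 0 p%:M q%:M 0 =
    block_mx 1%:M 0 1%:M 1%:M *m block_mx q%:M p%:M 0 (- p%:M) :> 'M[K]_(1 + 1).
  by rewrite !mulmx_block !mul1mx !mul0mx !add0r !addr0 subrr.
move/(congr1 (fun N : 'M[K]_(1 + 1) => \det N)).
rewrite !det_mulmx !det_ublock det_lblock !det1 !mul1r => ->.
by rewrite -(raddfN (@scalar_mx K 1)) !det_scalar1 mulrN mulrC.
Qed.

Definition symm_part (C : numClosedFieldType) n (V : 'M[int]_n) : 'M[C]_n := map_mx intr (V + V^T).

Section SEquivalence.
Variables (C : numClosedFieldType) (K : fieldType) (s : K).
Hypothesis s0 : s != 0.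
Local Notation S V := (symm_part C V).
Definition skew_det n (V : 'M[int]_n) : K :=
  let W : 'M[K]_n := map_mx intr V in \det (s *: W - s^-1 *: W^T).

Lemma adj_intr m n (A : 'M[int]_(m, n)) : (map_mx intr A : 'M[C]_(m, n))^t* = map_mx intr A^T.
Proof. by apply/matrixP => i j; rewrite !mxE rmorph_int. Qed.

Lemma hermsym_adj n (A : 'M[C]_n) : A^t* = A -> A \is hermsymmx.
Proof. by move=> AE; apply/is_hermitianmxP; rewrite expr0 scale1r AE. Qed.

Lemma symm_part_herm n (V : 'M[int]_n) : S V \is hermsymmx.
Proof.
by apply: hermsym_adj; rewrite /symm_part adj_intr linearD /= trmxK addrC.
Qed.

Definition enlarged n (A : 'M[C]_n) (U : 'rV_n) : 'M_(n + (1 + 1)) :=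
  block_mx A (row_mx (U^t*) 0) (col_mx U 0) (block_mx 0 1%:M 1%:M 0).

Lemma hform_enlarged n (A : 'M[C]_n) U w (x y : 'M_1) :
  hform (enlarged A U) (row_mx w (row_mx x y)) =
    hform A w + (x *m U *m w^t* + w *m U^t* *m x^t* + x *m y^t* + y *m x^t*) 0 0.
Proof.
rewrite /hform /enlarged.
rewrite mul_row_block mul_mx_row mul_row_block mul_row_col !mulmx0 !mulmx1 ?addr0 ?add0r.
rewrite add_row_mx add0r !tr_row_mx !map_col_mx !mul_row_col !mulmxDl.
have addE (B1 B2 : 'M[C]_1) : (B1 + B2) 0 0 = B1 0 0 + B2 0 0 by rewrite mxE.
by rewrite !addE; ring.
Qed.

Lemma inertia_enlarged eps n (A : 'M[C]_n) U : eps ^+ 2 = 1 -> A \is hermsymmx ->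
  inertia eps (enlarged A U) = (inertia eps A + 1)%N.
Proof.
move=> eps2 hA.
have eps_real := sqr1_real eps2.
have AE : A^t* = A by have := is_hermitianmxP _ _ _ hA; rewrite expr0 scale1r.
have hE : enlarged A U \is hermsymmx.
  apply: hermsym_adj; rewrite /enlarged tr_block_mx map_block_mx AE.
  rewrite tr_row_mx tr_col_mx map_row_mx map_col_mx trmxCK tr_block_mx map_block_mx.
  by rewrite !trmx0 !map_mx0 !trmx1 !map_mx1.
apply/eqP; rewrite eqn_leq; apply/andP; split.
  apply: (@inertia_codim C eps _ _ 1 A (enlarged A U) (col_mx 1%:M 0)
    (col_mx 0 (col_mx 1%:M 0))) => // z.
  rewrite -[z]hsubmxK -[rsubmx z]hsubmxK.
  move: (lsubmx z) (lsubmx (rsubmx z)) (rsubmx (rsubmx z)) => w x y.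
  rewrite !mul_row_col !mulmx0 !mulmx1 !(add0r, addr0) => ->.
  by rewrite hform_enlarged trmx0 map_mx0 !mulmx0 !mul0mx !addr0 mxE addr0.
have [G def] := inertia_attained hA eps.
pose G' := block_mx G (row_mx 0 (- (G *m U^t*))) 0 (row_mx 1%:M eps%:M) : 'M[C]_(inertia eps A +
  1, n + (1 + 1)).
apply: (@inertia_ge C _ _ hE eps _ G') => // w w0.
rewrite hform_congr -[w]hsubmxK; move: (lsubmx w) (rsubmx w) (hsubmxK w) => v a wE.
rewrite mul_row_block mulmx0 addr0 !mul_mx_row mulmx0 mulmx1 add_row_mx add0r.
rewrite hform_enlarged -hform_congr.
set X := (X in X 0 0).
have -> : X = eps%:M *m (a *m a^t*) *+ 2.
  rewrite /X mulmxN mul_mx_scalar; set b := v *m G.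
  have -> : v *m (G *m U^t*) = b *m U^t* by rewrite mulmxA.
  have -> : (- (b *m U^t*) + eps *: a)^t* = - (U *m b^t*) + eps *: a^t*.
    rewrite linearD linearN linearZ /= map_mxD map_mxN map_mxZ /= adjM trmxCK.
    by rewrite (CrealP eps_real).
  rewrite mulmxDr mulmxDl mulmxN mulNmx mul_scalar_mx -scalemxAl -scalemxAr mulmxA mulr2n.
  by rewrite addrACA addrK addrA addNKr.
have aE : (eps%:M *m (a *m a^t*) *+ 2) 0 0 = eps * `|a 0 0| ^+ 2 *+ 2.
  by rewrite mul_scalar_mx !mxE big_ord1 !mxE normCK.
have pos : eps * (hform (G *m A *m G^t*) v + eps * `|a 0 0| ^+ 2 *+ 2) =
    eps * hform (G *m A *m G^t*) v + `|a 0 0| ^+ 2 *+ 2.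
  by rewrite mulrDr mulrnAr mulrA -expr2 eps2 mul1r.
rewrite aE pos.
have [v0|v0] := eqVneq v 0.
  have a0 : a 0 0 != 0.
    apply: contraNneq w0 => a0; rewrite -wE v0; apply/eqP.
    rewrite (_ : a = 0) ?row_mx0 //.
    by apply/matrixP => i j; rewrite !ord1 a0 mxE.
  rewrite v0 /hform !mul0mx mxE mulr0 add0r pmulrn_lgt0 //.
  by rewrite exprn_gt0 ?normr_gt0.
apply: ltr_wpDr; first by rewrite mulrn_wge0 ?exprn_ge0.
exact: def.
Qed.

Lemma symm_part_row n (W : 'M[int]_n) u :
  S (row_enlargement W u) = enlarged (S W) (map_mx intr u).
Proof.
rewrite /symm_part /row_enlargement /enlarged adj_intr tr_block_mx tr_col_mx tr_block_mx !trmx0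
  trmx1.
rewrite !add_block_mx !add0r !addr0 !map_block_mx map_row_mx map_col_mx.
by rewrite !map_mx0 !map_mx1.
Qed.

Lemma symm_part_col n (W : 'M[int]_n) u :
  S (col_enlargement W u) = enlarged (S W) (map_mx intr u^T).
Proof.
rewrite /symm_part /col_enlargement /enlarged adj_intr trmxK tr_block_mx tr_row_mx tr_block_mx
  !trmx0 trmx1.
rewrite !add_block_mx !add0r !addr0 !map_block_mx map_row_mx map_col_mx.
by rewrite !map_mx0 !map_mx1.
Qed.

Lemma symm_part_congr n (W P : 'M[int]_n) :
  S (P *m W *m P^T) = map_mx intr P *m S W *m (map_mx intr P)^t*.
Proof.
rewrite /symm_part adj_intr -!map_mxM !trmx_mul trmxK mulmxA.
by rewrite -mulmxDl -mulmxDr.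
Qed.

Lemma skew_det_row n (W : 'M[int]_n) u : skew_det (row_enlargement W u) = skew_det W.
Proof.
rewrite /skew_det /row_enlargement !map_block_mx map_col_mx !map_mx0 !map_mx1.
rewrite tr_block_mx tr_col_mx tr_block_mx !trmx0 trmx1 !scale_block_mx opp_block_mx add_block_mx.
rewrite opp_block_mx add_block_mx scale_col_mx scale_row_mx !scaler0 opp_row_mx !oppr0 !add0r
  !addr0.
rewrite !scalemx1 -(raddfN (@scalar_mx K 1)).
by rewrite det_enlarged // mulNr opprK mulVf // mulr1.
Qed.

Lemma skew_det_col n (W : 'M[int]_n) u : skew_det (col_enlargement W u) = skew_det W.
Proof.
rewrite /skew_det /col_enlargement !map_block_mx map_row_mx !map_mx0 !map_mx1.
rewrite tr_block_mx tr_row_mx tr_block_mx !trmx0 trmx1 !scale_block_mx opp_block_mx add_block_mx.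
rewrite opp_block_mx add_block_mx scale_col_mx scale_row_mx !scaler0 opp_col_mx !oppr0 !add0r
  !addr0.
rewrite !scalemx1 -(raddfN (@scalar_mx K 1)).
by rewrite det_enlarged ?oppr_eq0 ?invr_eq0 // (mulrN s) opprK mulfV // mulr1.
Qed.

Lemma skew_det_congr n (W P : 'M[int]_n) : P \in unitmx ->
  skew_det (P *m W *m P^T) = skew_det W.
Proof.
rewrite unitmxE => Pu; have P2 : \det P ^+ 2 = 1 :> int.
  by move: Pu; rewrite qualifE /= => /orP[]/eqP ->.
rewrite /skew_det; set Wk := map_mx intr W; set Pk : 'M[K]_n := map_mx intr P.
have -> : map_mx intr (P *m W *m P^T) = Pk *m Wk *m Pk^T by rewrite !map_mxM map_trmx.
have -> : s *: (Pk *m Wk *m Pk^T) - s^-1 *: (Pk *m Wk *m Pk^T)^T =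
    Pk *m (s *: Wk - s^-1 *: Wk^T) *m Pk^T.
  rewrite !trmx_mul trmxK mulmxBr mulmxBl -!scalemxAr -!scalemxAl.
  by rewrite !mulmxA.
rewrite !det_mulmx det_tr mulrAC -expr2 det_map_mx -rmorphXn /= P2.
by rewrite mul1r.
Qed.
End SEquivalence.

Lemma signature_row n (W : 'M[int]_n) u : signature (row_enlargement W u) = signature W.
Proof.
rewrite /signature !matrix_signatureE -!/(symm_part _ _) symm_part_row.
by rewrite !inertia_enlarged ?expr1n ?sqrrN ?expr1n ?symm_part_herm // !PoszD; ring.
Qed.

Lemma signature_col n (W : 'M[int]_n) u : signature (col_enlargement W u) = signature W.
Proof.
rewrite /signature !matrix_signatureE -!/(symm_part _ _) symm_part_col.
by rewrite !inertia_enlarged ?expr1n ?sqrrN ?expr1n ?symm_part_herm // !PoszD; ring.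
Qed.

Lemma signature_congr n (W P : 'M[int]_n) : P \in unitmx ->
  signature (P *m W *m P^T) = signature W.
Proof.
move=> Pu; rewrite /signature !matrix_signatureE -!/(symm_part _ _) symm_part_congr.
have hP : map_mx intr P *m symm_part algC W *m (map_mx intr P)^t* \is hermsymmx.
  by rewrite -symm_part_congr symm_part_herm.
have Pu' : (map_mx intr P : 'M[algC]_n) \in unitmx.
  by rewrite unitmxE det_map_mx; apply: rmorph_unit; rewrite -unitmxE.
by rewrite !inertia_congr ?rpredN ?rpred1 ?symm_part_herm.
Qed.

Theorem s_equivalent_invariant (K : fieldType) (s : K) m (V : 'M[int]_m) n (W : 'M[int]_n) :
  s != 0 -> s_equivalent V W -> skew_det s W = skew_det s V /\ signature W = signature V.
Proof.
move=> s0; elim=> {n W} // n W.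
- by move=> P Pu _ [<- <-]; rewrite skew_det_congr // signature_congr.
- by move=> u _ [<- <-]; rewrite skew_det_row // signature_row.
- by move=> u _ [<- <-]; rewrite skew_det_col // signature_col.
- by move=> u _ [<- <-]; rewrite skew_det_row // signature_row.
- by move=> u _ [<- <-]; rewrite skew_det_col // signature_col.
Qed.

(** * The signature *)

Lemma row_of_incmx (G : plane_digraph) (K : fieldType) (A : {set edge G}) (a : vertex G -> K) j :
  (row_of a *m incmx K A) 0 j = cobound a (enum_val j).
Proof. by rewrite mul_incmx /cobound !row_ofK. Qed.

Section RankDuality.
Variables (G : plane_digraph) (K : fieldType).
Hypothesis G_sph : spherical G.
Local Notation dincmx := (@incmx (dual G) K).

Lemma ker_tr_dincmx (A : {set edge G}) (y : 'rV[K]_#|A|) :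
  y *m (dincmx A)^T = 0 <->
  forall b : face G -> K, \sum_j y 0 j * dcobound b (enum_val j) = 0.
Proof.
have pairing (b : face G -> K) : \sum_j y 0 j * dcobound b (enum_val j) =
    (row_of b *m (dincmx A *m y^T)) 0 0.
  rewrite mulmxA mxE; apply: eq_bigr => j _.
  by rewrite (@row_of_incmx (dual G) K A b j) mxE mulrC.
split=> [y0 b|H].
  rewrite pairing -[dincmx A *m _]trmxK trmx_mul trmxK y0 trmx0 mulmx0 mxE //.
apply: trmx_inj; rewrite trmx_mul trmxK trmx0; set N := _ *m _ in pairing *.
apply/colP => i; rewrite [RHS]mxE.
have := H (fun f => (f == enum_val i)%:R); rewrite pairing mxE (bigD1 i) //=.
rewrite [in X in X + _]mxE eqxx mul1r big1 ?addr0 => [->//|k ne].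
by rewrite mxE (inj_eq enum_val_inj) (negPf ne) mul0r.
Qed.

Lemma rank_common_kernel (A : {set edge G}) (v0 : vertex G) :
  \rank (kermx (incmx K A) :&: kermx (incmx K (~: A)))%MS = 1%N.
Proof.
set N := (_ :&: _)%MS.
have inN (r : 'rV_#|vertex G|) : (r <= N)%MS <-> forall e, cobound (fun_of r) e = 0.
  rewrite sub_capmx; split=> [/andP[/sub_kermxP/ker_incmx H1 /sub_kermxP/ker_incmx H2] e|H].
    by have [/H1//|eA] := boolP (e \in A); apply: H2; rewrite inE.
  by apply/andP; split; apply/sub_kermxP/ker_incmx => e _.
have Nconst : (N == (const_mx 1 : 'rV[K]_#|vertex G|))%MS.
  apply/andP; split; last first.
    by apply/inN => e; rewrite /cobound /fun_of !mxE subrr.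
  apply/rV_subP => r /inN H; apply/submxP; exists (fun_of r v0)%:M; rewrite mul_scalar_mx.
  apply/rowP => i; rewrite !mxE mulr1 -[i]enum_valK -/(fun_of r _).
  apply: (joined_const _ (spherical_conn G_sph _ _)) => e _.
  by apply/eqP; rewrite -subr_eq0; apply/eqP; exact: H.
rewrite (eqmx_rank Nconst) rank_rV; apply/eqP; rewrite eqb1.
apply/eqP => /rowP/(_ (enum_rank v0)); rewrite !mxE => /eqP.
by rewrite oner_eq0.
Qed.

Theorem rank_duality (A : {set edge G}) (v0 : vertex G) :
  (\rank (incmx K A) + #|~: A| + 1 = \rank (dincmx (~: A)) + #|vertex G|)%N.
Proof.
pose kA := kermx (incmx K A).
have sumE (y : edge G -> K) : (forall e, e \in A -> y e = 0) ->
    \sum_(j < #|~: A|) y (enum_val j) = \sum_e y e.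
  move=> yA; rewrite -(big_enum_val y) [RHS](bigID (mem (~: A))) /= [X in _ + X]big1 ?addr0 //.
  by move=> e; rewrite inE negbK => /yA.
have r1 := rank_common_kernel A v0; rewrite -/kA in r1.
have r2 : (kA *m incmx K (~: A) :=: kermx (dincmx (~: A))^T)%MS.
  apply/eqmxP/andP; split; apply/rV_subP => y.
    case/submxP => w ->; rewrite mulmxA; set a := w *m kA.
    have a0 : a *m incmx K A = 0 by rewrite -mulmxA mulmx_ker mulmx0.
    have /ker_incmx aA := a0.
    apply/sub_kermxP/ker_tr_dincmx => b.
    rewrite (eq_bigr (fun j => cobound (fun_of a) (enum_val j) * dcobound b (enum_val j)));
      last by move=> j _; rewrite mul_incmx.
    rewrite (sumE (fun e => cobound (fun_of a) e * dcobound b e)); first exact: spherical_orth.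
    by move=> e /aA ->; rewrite mul0r.
  move=> /sub_kermxP/ker_tr_dincmx y0.
  pose y' e := \sum_j y 0 j * (enum_val j == e)%:R.
  have y'E j : y' (enum_val j) = y 0 j.
    rewrite /y' (bigD1 j) //= eqxx mulr1 big1 ?addr0 // => i ne.
    by rewrite (inj_eq enum_val_inj) (negPf ne) mulr0.
  have y'A e : e \in A -> y' e = 0.
    move=> eA; rewrite /y' big1 // => j _; case: eqP => [E|]; rewrite ?mulr0 //.
    by have := enum_valP j; rewrite E inE eA.
  have [b|a aE] := @exact_field G G_sph K y'.
    rewrite -(sumE (fun e => y' e * dcobound b e)); last by move=> e /y'A ->; rewrite mul0r.
    by rewrite -[RHS](y0 b); apply: eq_bigr => j _; rewrite y'E.
  have -> : y = row_of a *m incmx K (~: A).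
    by apply/rowP => j; rewrite row_of_incmx -aE y'E.
  apply: submxMr; apply/sub_kermxP; apply/rowP => j.
  by rewrite row_of_incmx -aE y'A ?enum_valP // mxE.
have := mxrank_mul_ker kA (incmx K (~: A)); rewrite r1 r2 !mxrank_ker mxrank_tr.
have := rank_leq_row (incmx K A); have := rank_leq_col (dincmx (~: A)).
have arith (x y v c : nat) : (x <= c -> y <= v -> c - x + 1 = v - y -> y + c + 1 = x + v)%N.
  by clear; lia.
exact: arith.
Qed.
End RankDuality.

Lemma inertia_kernel (C : numClosedFieldType) (eps : C) m c p (S : 'M[C]_m)
    (X : 'M[C]_(m, c)) (Y : 'M[C]_(m, p)) :
  eps ^+ 2 = 1 -> S \is hermsymmx ->
  (forall z, z *m X = 0 -> hform S z = eps * hform 1%:M (z *m Y)) ->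
  (forall z : 'rV_m, z *m X = 0 -> z *m Y = 0 -> z = 0) ->
  (m <= inertia eps S + \rank X)%N.
Proof.
move=> eps2 hS SE free.
have eps_real := sqr1_real eps2.
suff H : (\rank (kermx X) <= inertia eps S)%N.
  by move: H; rewrite mxrank_ker; have := rank_leq_row X; clear; lia.
apply: (@inertia_ge _ _ _ hS eps _ (row_base (kermx X))) => // w w0.
rewrite hform_congr; set z := w *m _.
have zX : z *m X = 0.
  by apply/sub_kermxP/(submx_trans (submxMl _ _)); rewrite eq_row_base.
have z0 : z != 0.
  by apply: contraNneq w0 => /eqP; rewrite mulmx_free_eq0 ?row_base_free // => /eqP ->.
rewrite SE // mulrA -expr2 eps2 mul1r.
have [k yk] : exists k, (z *m Y) 0 k != 0.
  by apply/rV0Pn; apply: contraNneq z0 => zY; rewrite (free z).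
rewrite -diag_const_mx hform_diag lt_neqAle sumr_ge0 => [|j _]; last first.
  by rewrite mxE mul1r exprn_ge0.
rewrite andbT eq_sym psumr_neq0 => [|j _]; last by rewrite mxE mul1r exprn_ge0.
by apply/hasP; exists k; rewrite ?mem_index_enum //= mxE mul1r exprn_gt0 ?normr_gt0.
Qed.

Section SeifertSignature.
Variable D : crossing_diagram.
Hypotheses (D_planar : euler_sphere D) (D_connected : crossings_connected D).
Hypothesis D_alt : strands_alternate D.
Local Notation X := (crossing D).
Local Notation G := (tait_of_crossings D).
Variables (m : nat) (b : 'I_m -> Defs.arc D -> int).
Hypothesis bb : homology_basis b.
Local Notation C := algC.

Lemma band_inverse : exists Q : X -> 'I_m -> int,
  forall i j, \sum_x band_over (b i) x * Q x j = (i == j)%:R.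
Proof.
pose c0 := circle_of D_alt (crossing0 D_planar, true).
have [k [xs [cs [cs_inj cs_c0 cs_surj xs_order]]]] :=
  @tree_order (seifert_digraph D_alt) c0 (@seifert_conn D D_connected D_alt).
have [Q' _ Q2] := @band_rows_inv D D_alt m b bb c0 k xs cs cs_inj cs_surj xs_order _ _
  (enum_val_bij X).
exists (fun x j => Q' (enum_rank x) (lshift k j)) => i j.
have /matrixP/(_ (lshift k i) (lshift k j)) := Q2.
rewrite [RHS]mxE (inj_eq (@lshift_inj _ _)) => <-; rewrite [RHS]mxE.
rewrite (reindex (fun y : 'I_#|X| => enum_val y)) /=; last exact/onW_bij/enum_val_bij.
by apply: eq_bigr => y _; rewrite mxE /band_rows split_lshift enum_valK.
Qed.

Lemma band_free (z : 'I_m -> C) :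
  (forall x, \sum_i z i * (band_over (b i) x)%:~R = 0) -> forall i, z i = 0.
Proof.
move=> z0 j; have [Q QE] := band_inverse.
rewrite -[LHS](@sum_pick _ _ z j).
transitivity (\sum_i z i * \sum_x (band_over (b i) x)%:~R * (Q x j)%:~R).
  apply: eq_bigr => i _; congr (_ * _).
  under eq_bigr => x _ do rewrite -intrM.
  by rewrite -rmorph_sum QE eq_sym; case: eqP.
under eq_bigr => i _ do rewrite mulr_sumr.
rewrite exchange_big big1 // => x _ /=.
under eq_bigr => i _ do rewrite mulrA.
by rewrite -mulr_suml z0 mul0r.
Qed.

Local Notation Ep := [set x : edge G | epositive x].
Local Notation dincmx := (@incmx (dual G) C).

Lemma potentials : exists (a : 'I_m -> vertex G -> int) (c : 'I_m -> face G -> int),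
  forall i, b i =1 pot_flow (a i) (c i).
Proof.
have H i : exists p : (vertex G -> int) * (face G -> int), b i =1 pot_flow p.1 p.2.
  by have [a [c E]] := flow_potential D_planar D_connected D_alt (bb.1 i); exists (a, c).
have [p pE] := fin_all_exists H.
by exists (fun i => (p i).1), (fun i => (p i).2).
Qed.

Section Potentials.
Variables (a : 'I_m -> vertex G -> int) (c : 'I_m -> face G -> int).
Hypothesis bE : forall i, b i =1 pot_flow (a i) (c i).
Local Notation al i x := (@cobound G _ (a i) x).
Local Notation be i x := (@cobound (dual G) _ (c i) x).

Lemma band_over_cobound i x : band_over (b i) x = if positive x then al i x else be i x.
Proof.
have -> : band_over (b i) x = band_over (pot_flow (a i) (c i)) x.
  by rewrite /band_over /over_out /under_in !bE.
by rewrite band_over_pot.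
Qed.

Lemma over_sum i x : over_in (b i) x + over_out (b i) x = al i x + be i x.
Proof.
have -> : over_out (b i) x = a i (@ehead G x) - c i (@eright G x) by apply: bE.
have -> : over_in (b i) x = over_in (pot_flow (a i) (c i)) x by apply: bE.
by rewrite (pot_over_in D_alt) /cobound /=; ring.
Qed.

Lemma seifert_symm i j : seifert_form (b i) (b j) + seifert_form (b j) (b i) =
  \sum_x (if positive x then - (al i x * (al j x + be j x)) else be i x * (al j x + be j x)).
Proof.
rewrite (seifert_form_transpose D_planar D_connected D_alt (bb.1 i) (bb.1 j)).
rewrite seifert_formE ?(bb.1 i) //; last exact: bb.1.
rewrite -big_split /=; apply: eq_bigr => x _.
by rewrite -over_sum band_over_cobound; case: (positive x); ring.
Qed.

Local Notation S := (symm_part C (seifert_mx b)).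
Local Notation pos_rows := (\matrix_(i < m, j < #|Ep|) (al i (enum_val j))%:~R : 'M[C]_(m, _)).
Local Notation neg_rows := (\matrix_(i < m, j < #|~: Ep|) (be i (enum_val j))%:~R : 'M[C]_(m, _)).

Section Form.
Variable z : 'rV[C]_m.
Let A x : C := \sum_i z 0 i * (al i x)%:~R.
Let B x : C := \sum_i z 0 i * (be i x)%:~R.

Lemma hform_symm_part : hform S z =
  \sum_x (if positive x then - A x else B x) * (A x + B x)^*.
Proof.
pose gm : 'M[C]_(m, #|X|) :=
  \matrix_(i, j) let x := enum_val j in (if positive x then - al i x else be i x)%:~R.
pose hm : 'M[C]_(m, #|X|) := \matrix_(i, j) (al i (enum_val j) + be i (enum_val j))%:~R.
have -> : S = gm *m hm^t*.
  apply/matrixP => i j; rewrite !mxE seifert_symm rmorph_sum.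
  rewrite (reindex (fun y : 'I_#|X| => enum_val y)) /=; last exact/onW_bij/enum_val_bij.
  apply: eq_bigr => k _; rewrite !mxE rmorph_int -rmorphM.
  by case: positive; rewrite ?mulNr.
rewrite /hform -!mulmxA -adjM mulmxA mxE.
rewrite [RHS](reindex (fun y : 'I_#|X| => enum_val y)) /=; last exact/onW_bij/enum_val_bij.
apply: eq_bigr => k _; rewrite [(z *m hm)^t* _ _]mxE [(z *m hm)^T _ _]mxE; congr (_ * _^*).
  rewrite mxE; under eq_bigr => i _ do rewrite mxE /=.
  case: positive => //; rewrite -sumrN; apply: eq_bigr => i _.
  by rewrite rmorphN mulrN.
rewrite mxE -big_split; apply: eq_bigr => i _; rewrite mxE rmorphD /=.
by rewrite mulrDr.
Qed.

Lemma cross_terms : \sum_x A x * (B x)^* = 0.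
Proof.
pose aZ v : C := \sum_i z 0 i * (a i v)%:~R.
pose cZ f : C := (\sum_i z 0 i * (c i f)%:~R)^*.
rewrite -[RHS](spherical_orth (tait_spherical D_planar D_connected D_alt) aZ cZ).
apply: eq_bigr => x _; congr (_ * _).
  rewrite /A /cobound /aZ -sumrB; apply: eq_bigr => i _.
  by rewrite rmorphB mulrBr.
rewrite /B /cobound /cZ -rmorphB -sumrB; congr (_^*); apply: eq_bigr => i _.
by rewrite rmorphB mulrBr.
Qed.

Lemma conj_cross_terms : \sum_x B x * (A x)^* = 0.
Proof.
transitivity ((\sum_x A x * (B x)^*)^*); last by rewrite cross_terms rmorph0.
by rewrite rmorph_sum; apply: eq_bigr => x _ /=; rewrite rmorphM /= conjCK mulrC.
Qed.

Lemma mul_pos_rows j : (z *m pos_rows) 0 j = A (enum_val j).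
Proof. by rewrite mxE; apply: eq_bigr => i _; rewrite mxE. Qed.

Lemma mul_neg_rows j : (z *m neg_rows) 0 j = B (enum_val j).
Proof. by rewrite mxE; apply: eq_bigr => i _; rewrite mxE. Qed.

Lemma pos_rows_ker : z *m pos_rows = 0 <-> forall x, positive x -> A x = 0.
Proof.
split=> [H x xp|H]; last first.
  apply/rowP => j; rewrite mul_pos_rows H ?mxE //.
  by have := enum_valP j; rewrite inE.
have xE : x \in Ep by rewrite inE.
by have := mul_pos_rows (enum_rank_in xE x); rewrite H mxE enum_rankK_in.
Qed.

Lemma neg_rows_ker : z *m neg_rows = 0 <-> forall x, ~~ positive x -> B x = 0.
Proof.
split=> [H x xp|H]; last first.
  apply/rowP => j; rewrite mul_neg_rows H ?mxE //.
  by have := enum_valP j; rewrite !inE.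
have xE : x \in ~: Ep by rewrite !inE.
by have := mul_neg_rows (enum_rank_in xE x); rewrite H mxE enum_rankK_in.
Qed.

Lemma hform1 n (w : 'rV[C]_n) : hform 1%:M w = \sum_j `|w 0 j| ^+ 2.
Proof.
by rewrite -diag_const_mx hform_diag; apply: eq_bigr => j _; rewrite mxE mul1r.
Qed.

Lemma sum_neg_zero : (forall x, ~~ positive x -> B x = 0) ->
  hform S z = -1 * hform 1%:M (z *m pos_rows).
Proof.
move=> B0; rewrite hform_symm_part hform1.
have -> : \sum_j `|(z *m pos_rows) 0 j| ^+ 2 = \sum_(x in Ep) `|A x| ^+ 2.
  by rewrite [RHS]big_enum_val; apply: eq_bigr => j _; rewrite mul_pos_rows.
rewrite [in RHS]big_mkcond -[RHS]subr0 -[X in _ - X]cross_terms mulN1r -opprD -big_split -sumrN /=.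
apply: eq_bigr => x _; rewrite inE /= normCK.
have [xp|/B0 ->] := boolP (positive x); first by rewrite mulNr rmorphD mulrDr.
by rewrite rmorph0 mulr0 mul0r addr0 oppr0.
Qed.

Lemma sum_pos_zero : (forall x, positive x -> A x = 0) ->
  hform S z = 1 * hform 1%:M (z *m neg_rows).
Proof.
move=> A0; rewrite hform_symm_part hform1.
have -> : \sum_j `|(z *m neg_rows) 0 j| ^+ 2 = \sum_(x in ~: Ep) `|B x| ^+ 2.
  by rewrite [RHS]big_enum_val; apply: eq_bigr => j _; rewrite mul_neg_rows.
rewrite [in RHS]big_mkcond mul1r -[RHS]addr0 -[X in _ + X]conj_cross_terms -big_split /=.
apply: eq_bigr => x _; rewrite !inE /= normCK.
have [/A0 ->|xn] := boolP (positive x); last by rewrite rmorphD mulrDr addrC.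
by rewrite rmorph0 mulr0 oppr0 mul0r addr0.
Qed.

Lemma rows_free : z *m pos_rows = 0 -> z *m neg_rows = 0 -> z = 0.
Proof.
move=> /pos_rows_ker A0 /neg_rows_ker B0; apply/rowP => i; rewrite mxE.
apply: (@band_free (z 0)) => x.
transitivity (if positive x then A x else B x); last by case: ifP => [/A0|/negbT/B0].
by rewrite /A /B; case: ifP => xp; apply: eq_bigr => i' _; rewrite band_over_cobound xp.
Qed.
End Form.

Lemma rank_pos_rows : (\rank pos_rows <= \rank (incmx C Ep))%N.
Proof.
apply: mxrankS; apply/row_subP => i.
have -> : row i pos_rows = row_of (fun v => (a i v)%:~R) *m incmx C Ep.
  by apply/rowP => j; rewrite row_of_incmx !mxE /cobound rmorphB.
exact: submxMl.
Qed.

Lemma rank_neg_rows : (\rank neg_rows <= \rank (dincmx (~: Ep)))%N.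
Proof.
apply: mxrankS; apply/row_subP => i.
have -> : row i neg_rows = @row_of C (face G) (fun v => (c i v)%:~R) *m dincmx (~: Ep).
  by apply/rowP => j; rewrite (@row_of_incmx (dual G)) !mxE /cobound rmorphB.
exact: submxMl.
Qed.

(* In particular the vertices alone, or the faces alone, contribute to the row space. *)
Lemma potential_row (u : vertex G -> int) (w : face G -> int) :
  (row_mx (row_of (fun v => (u v)%:~R) *m incmx C Ep)
          (@row_of C (face G) (fun f => (w f)%:~R) *m dincmx (~: Ep))
     <= row_mx pos_rows neg_rows)%MS.
Proof.
have [z zE] := homology_coord bb (pot_flow_is_flow D_alt u w).
apply/submxP; exists (\row_i (z i)%:~R); rewrite mul_mx_row; congr row_mx.
  apply/rowP => j; rewrite row_of_incmx mul_pos_rows.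
  have xp : positive (enum_val j) by have := enum_valP j; rewrite inE.
  have := zE (enum_val j); rewrite band_over_pot // xp => /(congr1 (fun n : int => n%:~R : C)).
  rewrite rmorphB /= rmorph_sum /cobound => ->; apply: eq_bigr => i _.
  by rewrite mxE rmorphM /= band_over_cobound xp.
apply/rowP => j; rewrite (@row_of_incmx (dual G)) mul_neg_rows.
have xp : positive (enum_val j) = false by have := enum_valP j; rewrite !inE => /negbTE.
have := zE (enum_val j); rewrite band_over_pot // xp => /(congr1 (fun n : int => n%:~R : C)).
rewrite rmorphB /= rmorph_sum /cobound => ->; apply: eq_bigr => i _.
by rewrite mxE rmorphM /= band_over_cobound xp.
Qed.

Lemma rank_incidence_sum : (\rank (incmx C Ep) + \rank (dincmx (~: Ep)) <= m)%N.
Proof.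
rewrite -rank_diag_block_mx; apply: leq_trans (rank_leq_row (row_mx pos_rows neg_rows)).
have zero (H : plane_digraph) (A : {set edge H}) :
    row_of (fun=> (0 : int)%:~R : C) *m @incmx H C A = 0.
  by apply/rowP => j; rewrite row_of_incmx /cobound subrr mxE.
have unit (H : plane_digraph) (A : {set edge H}) i :
    row i (@incmx H C A) = row_of (fun v => ((v == enum_val i)%:R : int)%:~R) *m @incmx H C A.
  apply/rowP => j; rewrite row_of_incmx mxE [in LHS]mxE /cobound !rmorph_nat.
  by rewrite ![enum_val i == _]eq_sym.
apply: mxrankS; rewrite /block_mx col_mx_sub; apply/andP; split; apply/row_subP => i.
  rewrite row_row_mx row0 (unit G) -(zero (dual G) (~: Ep)).
  exact: potential_row (fun v => (v == enum_val i)%:R) (fun=> 0).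
rewrite row_row_mx row0 (unit (dual G)) -(zero G Ep).
exact: potential_row (fun=> 0) (fun f => (f == enum_val i)%:R).
Qed.

Theorem signature_seifert :
  signature (seifert_mx b) = #|~: Ep|%:Z - #|vertex G|%:Z + 1.
Proof.
rewrite /signature matrix_signatureE -/(symm_part C (seifert_mx b)).
have hS := symm_part_herm C (seifert_mx b).
have I1 : (m <= inertia 1 S + \rank pos_rows)%N.
  apply: (@inertia_kernel _ _ _ _ _ _ _ neg_rows _ hS); rewrite ?expr1n // => z.
    by move/pos_rows_ker; apply: sum_pos_zero.
  exact: rows_free.
have I2 : (m <= inertia (-1)%R S + \rank neg_rows)%N.
  apply: (@inertia_kernel _ _ _ _ _ _ _ pos_rows _ hS); rewrite ?sqrrN ?expr1n // => z.
    by move/neg_rows_ker; apply: sum_neg_zero.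
  by move=> *; apply: rows_free.
have v0 : vertex G := shaded_corner (crossing0 D_planar) true.
have I3 := inertia_opp_le S.
have I4 := rank_duality C (tait_spherical D_planar D_connected D_alt) Ep v0.
have arith (ip iq rp rn ra rb e v : nat) : (m <= ip + rp)%N -> (m <= iq + rn)%N ->
    (ip + iq <= m)%N -> (ra + e + 1 = rb + v)%N -> (ra + rb <= m)%N -> (rn <= rb)%N ->
    (rp <= ra)%N -> ip%:Z - iq%:Z = e%:Z - v%:Z + 1.
  by clear; lia.
exact: arith I1 I2 I3 I4 rank_incidence_sum rank_neg_rows rank_pos_rows.
Qed.
End Potentials.
End SeifertSignature.

Local Close Scope sesquilinear_scope.

(** * The Alexander polynomial *)

Section AlexanderFormula.
Variables (K : fieldType) (i X : K).
Hypotheses (i2 : i ^+ 2 = -1) (X0 : X != 0).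

Lemma fourth_root (c : K) : c ^+ 4 = 1 -> c \in [:: 1; -1; i; - i].
Proof.
move=> /eqP; rewrite -subr_eq0 (_ : c ^+ 4 - 1 = (c ^+ 2 - 1) * (c ^+ 2 - i ^+ 2)); last first.
  by rewrite i2; ring.
rewrite mulf_eq0 !subr_eq0 sqrf_eq1 eqf_sqr !inE => /orP[]/orP[]/eqP ->;
  by rewrite eqxx ?orbT.
Qed.

Lemma sign_in (b : bool) : (-1) ^+ b \in [:: 1; -1 : K].
Proof. by case: b; rewrite !inE eqxx ?orbT. Qed.

Lemma expz4 (u : K) (z : int) : u ^+ 4 = 1 -> (u ^ z) ^+ 4 = 1.
Proof. by move=> u4; rewrite exprnP exprzAC -exprnP u4 exp1rz. Qed.

Lemma imag4 : i ^+ 4 = 1.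
Proof. by rewrite (exprM i 2 2) i2 sqrrN expr1n. Qed.

Lemma sign4 k : ((-1) ^+ k : K) ^+ 4 = 1.
Proof. by rewrite exprAC (exprM _ 2 2) sqrrN !expr1n. Qed.

Hypothesis X_mean : forall (I : finType) (P : pred I) (u v : I -> int) (f : bool),
  \sum_(T | P T) X ^ u T = (-1) ^+ f * \sum_(T | P T) X ^ v T ->
  \sum_(T | P T) u T = \sum_(T | P T) v T.

Variable D : crossing_diagram.
Hypotheses (D_planar : euler_sphere D) (D_connected : crossings_connected D).
Hypothesis D_alt : strands_alternate D.
Local Notation G := (tait_of_crossings D).
Variables (r : vertex G) (q : face G).
Hypothesis qr : adjacent q r.
Variables (m n : nat) (b : 'I_m -> Defs.arc D -> int) (V : 'M[int]_n).
Hypothesis bb : homology_basis b.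
Hypothesis V_equiv : s_equivalent (seifert_mx b) V.

Lemma skew_detV k (W : 'M[int]_k) (s : K) :
  skew_det s^-1 W = (-1) ^+ k * skew_det s W.
Proof.
rewrite /skew_det invrK -[in RHS]det_tr -detZ; congr (\det _).
by apply/matrixP => x y; rewrite !mxE; ring.
Qed.

Lemma alexander_state_sum : exists e f : bool,
  skew_det X V = (-1) ^+ e * state_sum r q X /\ skew_det X V = (-1) ^+ f * state_sum r q X^-1.
Proof.
have [e detE] := det_seifert_state_sum D_planar D_connected D_alt qr bb i2 X0 X_mean.
have [-> _] := s_equivalent_invariant X0 V_equiv.
exists (odd (m + e)), e; split; last by rewrite /skew_det detE.
have XV0 : X^-1 != 0 by rewrite invr_eq0.
have := detE _ XV0; rewrite invrK /= -/(skew_det X^-1 (seifert_mx b)).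
have -> : \det (X^-1 *: map_mx intr (seifert_mx b) - X *: (map_mx intr (seifert_mx b))^T) =
    skew_det X^-1 (seifert_mx b) by rewrite /skew_det invrK.
rewrite skew_detV => H.
by rewrite signr_odd exprD -mulrA -H mulrA -exprD addnn -signr_odd odd_double mul1r.
Qed.

Lemma signature_exponent T : spanning_tree T ->
  up_exponent r q T - down_exponent r q T = - signature V.
Proof.
move=> tT; have [_ ->] := s_equivalent_invariant X0 V_equiv.
rewrite (exponent_difference r q (tait_spherical D_planar D_connected D_alt) tT).
have [a [c bE]] := potentials D_planar D_connected D_alt bb.
rewrite (signature_seifert D_planar D_connected D_alt bb bE).
have -> : #|~: [set x | @epositive G x]| = #|[set e | ~~ @epositive G e]|.
  by apply: eq_card => x; rewrite !inE.
by move: #|_| #|_|; clear; lia.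
Qed.

Theorem alexander_formulas :
  [/\ exists2 c : K, c \in [:: 1; -1] &
        skew_det X V = c * \sum_(T : {set edge G} | spanning_tree T)
                X ^ up_exponent r q T * (- X) ^ down_exponent r q T,
      exists2 c : K, c \in [:: 1; -1; i; - i] &
        skew_det X V = c * ((i * X) ^ (- signature V)
          * \sum_(T : {set edge G} | spanning_tree T) (- X ^+ 2) ^ (- up_exponent r q T))
    & exists2 c : K, c \in [:: 1; -1; i; - i] &
        skew_det X V = c * ((i * X) ^ (- signature V)
          * \sum_(T : {set edge G} | spanning_tree T) (- X ^+ 2) ^ down_exponent r q T)].
Proof.
have [e [f [E1 E2]]] := alexander_state_sum.
set c := - signature V.
have upE T : spanning_tree T -> up_exponent r q T = down_exponent r q T + c.
  by move=> tT; rewrite /c -(signature_exponent tT) addrC subrK.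
have i0 := sqrt_opp1_neq0 i2.
have sumE (s : K) : s != 0 -> state_sum r q s =
    s ^ c * \sum_(T : {set edge G} | spanning_tree T) (- s ^+ 2) ^ down_exponent r q T.
  move=> s0; rewrite -laurent_sumE // state_sumE //.
  by apply: eq_bigr => T tT; rewrite (upE T tT).
have ic : (i * X) ^ c = i ^ c * X ^ c by rewrite expfzMl.
have icN : i ^ (- c) * i ^ c = 1 by rewrite -expfzDr // addNr expr0z.
split.
- by exists ((-1) ^+ e); [exact: sign_in|rewrite E1 state_sumE].
- exists ((-1) ^+ f * ((-1) ^ c * i ^ (- c))).
    by apply: fourth_root; rewrite !exprMn sign4 !expz4 ?imag4 ?(sign4 1) ?mulr1.
  rewrite E2 sumE ?invr_eq0 // ic.
  have -> : \sum_(T : {set edge G} | spanning_tree T) (- X^-1 ^+ 2) ^ down_exponent r q T =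
      (- X ^+ 2) ^ c *
      \sum_(T : {set edge G} | spanning_tree T) (- X ^+ 2) ^ (- up_exponent r q T).
    rewrite mulr_sumr; apply: eq_bigr => T tT.
    rewrite exprVn -invrN exprz_inv -expfzDr ?oppr_eq0 ?expf_neq0 //.
    by congr (_ ^ _); rewrite upE //; ring.
  have -> : (- X ^+ 2) ^ c = (-1) ^ c * (X ^ c * X ^ c).
    by rewrite -[- X ^+ 2]mulN1r (expfzMl (-1)) (expfzMl X X).
  have -> : X^-1 ^ c = X ^ (- c) by rewrite exprz_inv.
  have XcN : X ^ (- c) * X ^ c = 1 by rewrite -expfzDr // addNr expr0z.
  move: (\sum_(T | _) _) (X ^ c) (X ^ (- c)) (i ^ c) (i ^ (- c)) ((-1) ^ c) ((-1) ^+ f) XcN icN.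
  move=> S x x' y y' u v xx yy.
  transitivity (v * (x' * x * (u * x * S))); first by ring.
  transitivity (v * (y' * y * (u * x * S))); last by ring.
  by rewrite xx yy.
exists ((-1) ^+ e * i ^ (- c)).
  by apply: fourth_root; rewrite !exprMn sign4 expz4 ?imag4 ?mulr1.
rewrite E1 sumE // ic.
move: (\sum_(T | _) _) (X ^ c) (i ^ c) (i ^ (- c)) ((-1) ^+ e) icN => S x y y' v yy.
transitivity (v * (y' * y * (x * S))); last by ring.
by rewrite yy mul1r.
Qed.
End AlexanderFormula.

Lemma signature_circle n (V : 'M[int]_n) : s_equivalent (0 : 'M[int]_0) V ->
  skew_det sqrt_t V = 1 /\ signature V = 0.
Proof.
move=> /(s_equivalent_invariant sqrt_t_neq0) [-> ->]; split; first exact: det_mx00.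
by rewrite /signature /matrix_signature !eq_card0 // => -[].
Qed.

Lemma void_set (T : {set edge tait_of_circle}) : T = set0.
Proof. by apply/setP => -[]. Qed.

Lemma circle_tree_sum (K : nmodType) (F : {set edge tait_of_circle} -> K) :
  \sum_(T : {set edge tait_of_circle} | spanning_tree T) F T = F set0.
Proof.
apply: big_pred1 => T /=; rewrite [T]void_set eqxx.
apply/andP; split; first by apply/'forall_forallP => -[] [].
by apply/forallP => C; rewrite [C]void_set /is_cycle eqxx.
Qed.

Lemma card_void (A : {set edge tait_of_circle}) : #|A| = 0%N.
Proof. by rewrite [A]void_set cards0. Qed.

Theorem theorem1p8 (D : link_diagram)
    (D_planar : planar D) (D_connected : connected_diagram D)
    (D_alternating : alternating D)
    (r : vertex (tait_digraph D)) (q : face (tait_digraph D))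
    (q_adjacent_r : adjacent q r)
    (n : nat) (V : 'M[int]_n) (V_seifert : seifert_matrix D V) :
  [/\ exists2 c : ratfun, c \in [:: 1; -1] &
        alexander V =
          c * \sum_(T : {set edge (tait_digraph D)} | spanning_tree T)
                sqrt_t ^ ((iota_pos r T)%:Z - (eps_neg q T)%:Z)
                * (- sqrt_t) ^ ((eps_neg_bar q T)%:Z - (iota_pos_bar r T)%:Z),
      exists2 c : ratfun, c \in [:: 1; -1; imag; - imag] &
        alexander V =
          c * ((imag * sqrt_t) ^ (- signature V)
          * \sum_(T : {set edge (tait_digraph D)} | spanning_tree T)
                (- var_t) ^ ((eps_neg q T)%:Z - (iota_pos r T)%:Z))
    & exists2 c : ratfun, c \in [:: 1; -1; imag; - imag] &
        alexander V =
          c * ((imag * sqrt_t) ^ (- signature V)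
          * \sum_(T : {set edge (tait_digraph D)} | spanning_tree T)
                (- var_t) ^ ((eps_neg_bar q T)%:Z - (iota_pos_bar r T)%:Z))].
Proof.
case: D D_planar D_connected D_alternating r q q_adjacent_r V_seifert => [|D0].
  move=> _ _ _ r0 q0 _ /signature_circle[det1 sign0].
  have E : alexander V = 1 := det1.
  have one (c : seq ratfun) (z : ratfun) : z = 1 -> exists2 c' : ratfun, c' \in 1 :: c & alexander
    V = c' * z.
    by move=> ->; exists 1; rewrite ?mem_head // mulr1.
  have z0 (A B : {set edge tait_of_circle}) : #|A|%:Z - #|B|%:Z = 0 by rewrite !card_void.
  split; apply: one; rewrite circle_tree_sum /iota_pos /eps_neg /iota_pos_bar /eps_neg_bar !z0.
  - by rewrite !expr0z mulr1.
  - by rewrite sign0 oppr0 !expr0z mulr1.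
  - by rewrite sign0 oppr0 !expr0z mulr1.
move=> pl co alt r0 q0 qr [m [b [bb VE]]].
have [H1 H2 H3] := alexander_formulas imag_sqr sqrt_t_neq0 laurent_mean pl co alt qr bb VE.
split; [exact: H1|case: H2 => c cU E|exact: H3].
exists c; first exact: cU.
rewrite [LHS]E; congr (_ * (_ * _)); apply: eq_bigr => T _; congr (_ ^ _).
exact: opprB.
Qed.
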